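(* There exists $\alpha_0>0$ such that for all $\alpha\ge\alpha_0$ the following holds. There is a constant $\lambda_1>0$ such that for every $1\le p\le\infty$ and every non-zero field $B_0\in L^p(\mathbb T^3;\mathbb R^3)$ with $\operatorname{div}B_0=0$ in the sense of distributions, there is a constant $\delta_p(B_0)>0$ such that the solution $B$ of the ideal induction equation with velocity $u_\alpha$ and initial datum $B_0$ satisfies $$\|B(t,\cdot)\|_{L^p}\ \ge\ \delta_p(B_0)\,e^{\lambda_1 t}\qquad\text{for all } t\ge 0 .$$ (The constant $\lambda_1$ is independent of $B_0$ and $p$.) In particular, $u_\alpha$ is a universal ideal dynamo for every $\alpha\ge\alpha_0$.
   Context: $\mathbb T=\mathbb R/2\pi\mathbb Z$, $\mathbb T^3=\mathbb R^3/(2\pi\mathbb Z)^3$, with points $\boldsymbol x=(x,y,z)$. Let $h:\mathbb T\to[0,\pi]$ be the $2\pi$-periodic function with $h(s)=|s-\pi|$ for $s\in[0,2\pi)$. For $\alpha\in\mathbb R$ and $t\in\mathbb R$ put $\tau=t-\lfloor t\rfloor\in[0,1)$ and define the time-periodic velocity field $$u_\alpha(t,x,y,z)=3\alpha\begin{cases}(h(y),0,0),&0\le\tau<1/3,\\(0,h(z),0),&1/3\le\tau<2/3,\\(0,0,h(x)),&2/3\le\tau<1.\end{cases}$$ Its flow map $\phi_t:\mathbb T^3\to\mathbb T^3$ is defined by $\frac{d}{dt}\phi_t(\boldsymbol x)=u_\alpha(t,\phi_t(\boldsymbol x))$, $\phi_0(\boldsymbol x)=\boldsymbol x$; it is a volume-preserving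 bi-Lipschitz homeomorphism. The ideal induction equation is $\partial_tB+(u\cdot\nabla)B=(B\cdot\nabla)u$, $\operatorname{div}B=0$, $B(0,\cdot)=B_0$. Its solution with velocity $u=u_\alpha$ means the Lagrangian solution, defined for almost every $\boldsymbol x$ by $$B(t,\boldsymbol x)=D\phi_t(\phi_t^{-1}(\boldsymbol x))\,B_0(\phi_t^{-1}(\boldsymbol x)).$$ A velocity field $u$ is a universal ideal dynamo if for every non-zero, divergence-free $B_0\in L^2(\mathbb T^3)$ there exist constants $\lambda,C>0$ such that the solution $B$ of the ideal induction equation with velocity $u$ and initial datum $B_0$ satisfies $\|B(t,\cdot)\|_{L^2}\ge Ce^{\lambda t}$ for all $t\ge0$. *)

(* Defs.v *)
From HB Require Import structures.
From mathcomp Require Import all_boot all_order all_algebra.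
From mathcomp Require Import all_classical all_reals all_analysis.
Set Implicit Arguments.
Unset Strict Implicit.
Unset Printing Implicit Defensive.
Import Order.TTheory GRing.Theory Num.Theory.
Import numFieldNormedType.Exports.
Local Open Scope classical_set_scope.
Local Open Scope ring_scope.

(* Scalar functions, vector fields and maps on the torus (R / 2 pi Z)^3 are
   represented by functions on R^3: a field on the torus is a 2 pi-periodic
   field, and the flow map is represented by its lift to R^3 starting at the
   identity.  The point (x, y, z) has coordinates p.1.1, p.1.2 and p.2.  The
   carrier is that of the product sigma-algebra on which the product of
   Lebesgue measures is a measure; it unfolds to R * R * R. *)
Notation R3 R :=
  (measurableTypeR R * measurableTypeR R * measurableTypeR R)%type.

Definition vec3 (R : realType) (a b c : R) : R3 R := (a, b, c).

Definition basis3 (R : realType) (i : 'I_3) : R3 R :=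
  vec3 (i == 0%N :> nat)%:R (i == 1%N :> nat)%:R (i == 2%N :> nat)%:R.

Definition dot3 (R : realType) (v w : R3 R) : R :=
  v.1.1 * w.1.1 + v.1.2 * w.1.2 + v.2 * w.2.

(* The norm of the normed module R * R * R is the maximum norm; Lebesgue norms
   of vector fields are taken with respect to the Euclidean norm instead. *)
Definition enorm3 (R : realType) (v : R3 R) : R := Num.sqrt (dot3 v v).

Definition torus_periodic (R : realType) (V : Type) (f : R3 R -> V) : Prop :=
  forall (x : R3 R) (i : 'I_3), f (x + (2 * pi) *: basis3 R i) = f x.

Definition cube (R : realType) : set (R3 R) :=
  (`[0, 2 * pi[ `*` `[0, 2 * pi[) `*` `[0, 2 * pi[.

Lemma measurable_cube (R : realType) : measurable (@cube R).
Proof.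
by do 2 (apply: measurableX; last exact: measurable_itv);
  exact: measurable_itv.
Qed.

Definition torus_measure (R : realType) : {measure set (R3 R) -> \bar R} :=
  mrestr ((@lebesgue_measure R \x @lebesgue_measure R) \x @lebesgue_measure R)%E
    (@measurable_cube R).

Definition Lp_norm (R : realType) (p : \bar R) (B : R3 R -> R3 R) : \bar R :=
  ('N[torus_measure R]_p[EFin \o (@enorm3 R \o B)])%E.

Definition Lp_field (R : realType) (p : \bar R) (B : R3 R -> R3 R) : Prop :=
  [/\ torus_periodic B, measurable_fun setT B & (Lp_norm p B < +oo)%E].

Definition nonzero_field (R : realType) (B : R3 R -> R3 R) : Prop :=
  ~ {ae torus_measure R, forall x, B x = 0}.

Definition partial (R : realType) (i : 'I_3) (f : R3 R -> R) : R3 R -> R :=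
  fun x => 'D_(basis3 R i) f x.

Definition iter_partial (R : realType) (s : seq 'I_3) (f : R3 R -> R) :
  R3 R -> R := foldr (@partial R) f s.

Definition smooth (R : realType) (f : R3 R -> R) : Prop :=
  forall s : seq 'I_3, continuous (iter_partial s f) /\
    forall (i : 'I_3) (x : R3 R), derivable (iter_partial s f) x (basis3 R i).

Definition grad (R : realType) (f : R3 R -> R) (x : R3 R) : R3 R :=
  vec3 (partial (inord 0) f x) (partial (inord 1) f x) (partial (inord 2) f x).

(* Since the torus is compact, the test functions are all smooth functions. *)
Definition div_free (R : realType) (B : R3 R -> R3 R) : Prop :=
  forall psi : R3 R -> R, torus_periodic psi -> smooth psi ->
    (\int[torus_measure R]_x dot3 (B x) (grad psi x))%R = 0.

(* Velocity fields may be discontinuous in time, so the differential equation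
   is required away from a set of switching times having finitely many
   elements in each bounded interval, and the trajectories are required to be
   continuous at all times. *)
Definition is_flow (R : realType) (u phi : R -> R3 R -> R3 R) : Prop :=
  [/\ forall x, phi 0 x = x,
      forall x, continuous (fun t : R => phi t x) &
      exists2 S : set R, (forall a b : R, finite_set (S `&` `[a, b])) &
        forall t, ~ S t -> forall x,
          is_derive (t : R) (1 : R) (fun s : R => phi s x) (u t (phi t x))].

(* For a velocity field that is Lipschitz in space, uniformly in time, there is
   at most one flow; the value is unspecified if there is none. *)
Definition flow_map (R : realType) (u : R -> R3 R -> R3 R) :
  R -> R3 R -> R3 R := get (is_flow u).

(* 'd f a is unspecified where f is not differentiable. *)
Definition ideal_solution (R : realType) (u : R -> R3 R -> R3 R)
    (B0 : R3 R -> R3 R) (t : R) (x : R3 R) : R3 R :=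
  let phi := flow_map u t in
  let a := pinv setT phi x in 'd phi a (B0 a).

Definition universal_ideal_dynamo (R : realType) (u : R -> R3 R -> R3 R) : Prop :=
  forall B0 : R3 R -> R3 R,
    Lp_field 2%:E B0 -> div_free B0 -> nonzero_field B0 ->
    exists lambda C : R, [/\ 0 < lambda, 0 < C &
      forall t : R, 0 <= t ->
        ((C * expR (lambda * t))%:E <= Lp_norm 2%:E (ideal_solution u B0 t))%E].

(* |s - pi| on [0, 2 pi), extended 2 pi-periodically. *)
Definition hat (R : realType) (s : R) : R :=
  `|s - (Num.floor (s / (2 * pi)))%:~R * (2 * pi) - pi|.

Definition velocity (R : realType) (alpha t : R) (x : R3 R) : R3 R :=
  let tau := t - (Num.floor t)%:~R in
  if tau < 1 / 3 then vec3 (3 * alpha * hat x.1.2) 0 0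
  else if tau < 2 / 3 then vec3 0 (3 * alpha * hat x.2) 0
  else vec3 0 0 (3 * alpha * hat x.1.1).

(* Main.v *)
(* Up to cyclic permutations of the coordinates, each third of a period is the
   map K (x, y, z) = (y, z, x + a h y) with a = alpha, so that the time-one map is
   K^3.  At almost every point the slope of a h is a or - a along the whole orbit,
   and the cone |v_1| <= (a / 2) max(|v_2|, |v_3|) is invariant and expanded by the
   differentials.  Let b_k be the image of B_0 under D(K^k), viewed at the initial
   point.

   If b_k is non-zero and inside the cone on a set of positive measure for some k,
   then the L^1 norm of b_k grows exponentially.  Otherwise b_k stays outside the
   cone almost everywhere, for all k, and its L^1 norm is O((2 / a)^k).  In that
   case consider the fluxes, the integrals of F (B_0 . grad G) for test functions
   F and G.  Transporting F and G by K^k leaves a flux unchanged, while undoing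
   the last shear by a homotopy changes it, because the transported field is
   divergence-free, only by a term controlled by grad F x grad G and the L^1 norm
   of b_k.  As grad F x grad G is itself pushed forward by DK, in a suitably
   weighted norm it grows at most like (sqrt a + 1 / a)^k, which is beaten by
   (2 / a)^k: all fluxes vanish.  Testing with G the cosines and sines of a
   coordinate then gives B_0 = 0.  The homotopy needs smooth shears, hence the
   approximation of h (s) = pi / 2 + asin (cos s) by pi / 2 + asin (q cos s),
   q < 1.

   The L^1 bound is transferred to L^p by Hoelder's inequality on the torus, which
   has finite measure. *)
From HB Require Import structures.
Require Import Defs.
From mathcomp Require Import all_boot all_order all_algebra.
From mathcomp Require Import all_classical all_reals all_analysis.
From mathcomp Require Import measurable_realfun ess_sup_inf.
From mathcomp Require Import zify ring lra.
Set Implicit Arguments.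
Unset Strict Implicit.
Unset Printing Implicit Defensive.
Import Order.TTheory GRing.Theory Num.Theory.
Import numFieldNormedType.Exports.
Local Open Scope classical_set_scope.
Local Open Scope ring_scope.

(** * Trigonometric test functions on the torus *)

(** Where the slope of the shear is a or - a, the eigenvalues of DK solve l^3 = a l + 1 or l^3 = - a
    l + 1: two have modulus about sqrt a and one has modulus about 1 / a. A field that never enters
    the cone loses a factor of order a per step, while the two-form dF /\ dG, identified with grad F
    x grad G, gains only about sqrt a. This gap is what rules out decay.

    A flux pairs the field with the one-form F dG. By Cartan's formula, its derivative along a shear
    is an exact form, invisible to a divergence-free field, plus a contraction of dF /\ dG. Second
    derivatives are confined to the exact part, so the constants depend on the shear only through
    bounds on its values and slopes. They survive q -> 1, where the second derivative of the
    smoothed hat blows up.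

    All the b_k are functions of the initial point, so every flux is an integral against one fixed
    measure. Invariance of Lebesgue measure enters only to discard the irregular orbits and to
    return to the norm of the solution. *)

Section differentials.
Variable R : realType.

Lemma fst_is_diff (U V : normedModType R) (x : U * V) : is_diff x fst fst.
Proof.
pose L : {linear (U * V)%type -> U} := fst.
have c : continuous L by move=> y; exact: cvg_fst.
split; first exact: linear_differentiable.
exact: (@diff_lin _ _ _ L x c).
Qed.

Lemma snd_is_diff (U V : normedModType R) (x : U * V) : is_diff x snd snd.
Proof.
pose L : {linear (U * V)%type -> V} := snd.
have c : continuous L by move=> y; exact: cvg_snd.
split; first exact: linear_differentiable.
exact: (@diff_lin _ _ _ L x c).
Qed.

Lemma is_diff_derive (U V : normedModType R) (f df : U -> V) (x v : U) :
  is_diff x f df -> is_derive x v f (df v).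
Proof.
move=> [fx dfx]; split; first exact: diff_derivable.
by rewrite deriveE// dfx.
Qed.

Lemma is_derive_diff (f : R -> R) (s d : R) :
  is_derive s (1 : R) f d -> is_diff s f (fun v => v * d).
Proof.
move=> [fs fd]; have ds : differentiable f s by exact/derivable1_diffP.
split=> //; apply/funext => v.
by rewrite diff1E//= derive1E fd.
Qed.

End differentials.

Section torus_functions.
Variable R : realType.
Implicit Types (f g : R3 R -> R) (x v : R3 R) (i : 'I_3).

Definition coord (j : nat) (x : R3 R) : R :=
  if j == 0%N then x.1.1 else if j == 1%N then x.1.2 else x.2.

(** A smooth periodic function of one variable, given together with all its derivatives, so that
    derivation is a shift of the index. *)
Definition tower (g : nat -> R -> R) : Prop :=
  (forall k (s : R), is_derive s (1 : R) (g k) (g k.+1 s)) /\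
  (forall k s, g k (s + 2 * pi) = g k s).

(* A class of test functions that is closed under derivation and under composition
   with smooth shears, and still rich enough to separate integrable functions. *)
Inductive torus_fun : (R3 R -> R) -> Prop :=
| torus_fun_cst c : torus_fun (fun=> c)
| torus_funD f g : torus_fun f -> torus_fun g -> torus_fun (fun x => f x + g x)
| torus_funM f g : torus_fun f -> torus_fun g -> torus_fun (fun x => f x * g x)
| torus_fun_tower t j f : tower t -> torus_fun f ->
    torus_fun (fun x => t 0%N (coord j x + f x)).

Lemma towerS t : tower t -> tower (fun k => t k.+1).
Proof. by case=> td tp; split => k; [exact: td|exact: tp]. Qed.

Lemma tower_continuous t k : tower t -> continuous (t k).
Proof.
move=> [td _] s; apply: differentiable_continuous.
by apply/derivable1_diffP; have [] := td k s.
Qed.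

Lemma periodic_intZ (V : Type) (u : R -> V) (c : R) : (forall s, u (s + c) = u s) ->
  forall (n : int) s, u (s + n%:~R * c) = u s.
Proof.
move=> up; have upn (n : nat) s : u (s + n%:R * c) = u s.
  elim: n s => [|n IH] s; first by rewrite mul0r addr0.
  by rewrite -natr1 mulrDl mul1r addrA up IH.
case=> n s; first by rewrite -pmulrn upn.
by rewrite NegzE rmorphN/= -pmulrn -(upn n.+1) mulNr subrK.
Qed.

Lemma twopi_gt0 : 0 < 2 * pi :> R.
Proof. by rewrite mulr_gt0// pi_gt0. Qed.

Lemma floor_period_itv (s : R) :
  0 <= s - (Num.floor (s / (2 * pi)))%:~R * (2 * pi) < 2 * pi.
Proof.
have p0 := twopi_gt0.
have := floor_le_tmp (s / (2 * pi)); have := floorD1_gt (s / (2 * pi)).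
rewrite ltr_pdivrMr// ler_pdivlMr// intrD mulrDl mul1r => h1 h2.
by rewrite subr_ge0 h2 ltrBlDl.
Qed.

Lemma tower_bounded t k : tower t -> exists M : R, forall s, `|t k s| <= M.
Proof.
move=> tt; have ct := tower_continuous (k := k) tt; have [_ tp] := tt.
have p0 : 0 <= 2 * pi :> R by rewrite ltW// twopi_gt0.
have ct' : {within `[0, 2 * pi], continuous (fun s => `|t k s|)}.
  apply: continuous_subspaceT => s; apply: continuous_comp; first exact: ct.
  exact: norm_continuous.
have [c _ hc] := EVT_max p0 ct'.
exists `|t k c| => s.
pose n : int := - Num.floor (s / (2 * pi)).
rewrite -(periodic_intZ (tp k) n s); apply: hc.
have /andP[h1 h2] := floor_period_itv s.
by rewrite in_itv/= /n rmorphN/= mulNr h1 ltW.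
Qed.

Lemma coord_is_diff j x : is_diff x (coord j) (coord j).
Proof.
have d0 : is_diff x (fun x : R3 R => x.1.1) (fun x : R3 R => x.1.1).
  by apply: (@is_diff_comp _ _ _ _ fst fst fst fst); exact: fst_is_diff.
have d1 : is_diff x (fun x : R3 R => x.1.2) (fun x : R3 R => x.1.2).
  by apply: (@is_diff_comp _ _ _ _ fst fst snd snd);
    [exact: fst_is_diff|exact: snd_is_diff].
rewrite /coord; case: (j == 0%N) => //; case: (j == 1%N) => //.
exact: snd_is_diff.
Qed.

Lemma partial_cst i (c : R) : partial i (fun=> c) = fun=> 0.
Proof.
by apply/funext => x; exact: derive_cst.
Qed.

Lemma partialD i f g : (forall x, differentiable f x) ->
  (forall x, differentiable g x) ->
  partial i (fun x => f x + g x) = fun x => partial i f x + partial i g x.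
Proof.
move=> df dg; apply/funext => x.
by rewrite /partial deriveD//; exact: diff_derivable.
Qed.

Lemma partialM i f g : (forall x, differentiable f x) ->
  (forall x, differentiable g x) ->
  partial i (fun x => f x * g x) =
  fun x => f x * partial i g x + partial i f x * g x.
Proof.
move=> df dg; apply/funext => x.
rewrite /partial (@deriveM _ _ f g)/=; last exact: diff_derivable.
  by rewrite /GRing.scale/=; ring.
exact: diff_derivable.
Qed.

Lemma tower_is_diff t j f x (t_ : tower t) : differentiable f x ->
  is_diff x (fun x => t 0%N (coord j x + f x))
    (fun v => (coord j v + 'd f x v) * t 1%N (coord j x + f x)).
Proof.
move=> df; have [td _] := t_.
have A : is_diff x (fun x => coord j x + f x) (fun v => coord j v + 'd f x v).
  by apply: is_diffD; [exact: coord_is_diff|exact: differentiableP].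
exact: (is_diff_comp A (is_derive_diff (td 0%N _))).
Qed.

Lemma partial_tower i t j f : tower t -> (forall x, differentiable f x) ->
  partial i (fun x => t 0%N (coord j x + f x)) =
  fun x => (coord j (basis3 R i) + partial i f x) * t 1%N (coord j x + f x).
Proof.
move=> t_ df; apply/funext => x; rewrite /partial.
rewrite (derive_val (is_derive := is_diff_derive _ (tower_is_diff j t_ (df x)))).
by rewrite deriveE.
Qed.

Lemma torus_fun_diff f : torus_fun f ->
  (forall x, differentiable f x) /\ forall i, torus_fun (partial i f).
Proof.
elim=> {f} [c|f g tf [df pf] tg [dg pg]|f g tf [df pf] tg [dg pg]|
  t j f t_ tf [df pf]].
- split=> [x|i]; first exact: differentiable_cst.
  by rewrite partial_cst; exact: torus_fun_cst.
- split=> [x|i]; first exact: differentiableD.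
  by rewrite partialD//; exact: torus_funD.
- split=> [x|i]; first exact: differentiableM.
  by rewrite partialM//; apply: torus_funD; exact: torus_funM.
- split=> [x|i]; first by have [] := tower_is_diff j t_ (df x).
  rewrite partial_tower//; apply: torus_funM.
    by apply: torus_funD => //; exact: torus_fun_cst.
  by apply: (torus_fun_tower _ (towerS t_)).
Qed.

Lemma torus_fun_differentiable f x : torus_fun f -> differentiable f x.
Proof. by move=> /torus_fun_diff[+ _]; exact. Qed.

Lemma torus_fun_partial f i : torus_fun f -> torus_fun (partial i f).
Proof. by move=> /torus_fun_diff[_]; exact. Qed.

Lemma torus_fun_smooth f : torus_fun f -> smooth f.
Proof.
move=> tf0 s; have tf : torus_fun (iter_partial s f).
  by elim: s => //= i s IH; exact: torus_fun_partial.
split=> [x|i x].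
  by apply: differentiable_continuous; exact: torus_fun_differentiable.
by apply: diff_derivable; exact: torus_fun_differentiable.
Qed.

Lemma coord_periodic j x i :
  exists n : int, coord j (x + (2 * pi) *: basis3 R i) = coord j x + n%:~R * (2 * pi).
Proof.
rewrite /coord /basis3 /vec3; case: (j == 0%N); last case: (j == 1%N).
- by exists (i == 0%N :> nat)%:Z => /=; rewrite -pmulrn [in RHS]mulrC.
- by exists (i == 1%N :> nat)%:Z => /=; rewrite -pmulrn [in RHS]mulrC.
- by exists (i == 2%N :> nat)%:Z => /=; rewrite -pmulrn [in RHS]mulrC.
Qed.

Lemma torus_fun_periodic f : torus_fun f -> torus_periodic f.
Proof.
elim=> {f} [c|f g tf pf tg pg|f g tf pf tg pg|t j f t_ tf pf] x i //.
- by rewrite pf pg.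
- by rewrite pf pg.
- rewrite pf; have [n ->] := coord_periodic j x i; have [_ tp] := t_.
  by rewrite addrAC (periodic_intZ (tp 0%N)).
Qed.

Lemma torus_fun_bounded f : torus_fun f -> exists M : R, forall x, `|f x| <= M.
Proof.
elim=> {f} [c|f g tf [M hM] tg [N hN]|f g tf [M hM] tg [N hN]|t j f t_ tf _].
- by exists `|c|.
- by exists (M + N) => x; rewrite (le_trans (ler_normD _ _))// lerD.
- by exists (M * N) => x; rewrite normrM ler_pM.
- by have [M hM] := tower_bounded 0%N t_; exists M.
Qed.

Lemma measurable_coord j : measurable_fun setT (coord j).
Proof.
rewrite /coord; case: (j == 0%N); last case: (j == 1%N).
- exact: (measurableT_comp measurable_fst measurable_fst).
- exact: (measurableT_comp measurable_snd measurable_fst).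
- exact: measurable_snd.
Qed.

Lemma torus_fun_measurable f : torus_fun f -> measurable_fun setT f.
Proof.
elim=> {f} [c|f g tf mf tg mg|f g tf mf tg mg|t j f t_ tf mf].
- exact: measurable_cst.
- exact: measurable_funD.
- exact: measurable_funM.
- apply: (@measurableT_comp _ _ _ _ _ _ (t 0%N)).
    by apply: continuous_measurable_fun; exact: tower_continuous.
  by apply: measurable_funD => //; exact: measurable_coord.
Qed.

(** The inner function of [torus_fun_tower] is there for this: it absorbs the displacement [u] of
    each coordinate. *)
Lemma torus_fun_comp (M : R3 R -> R3 R) : (forall j, exists l u, torus_fun u /\ forall x, coord j (M x) = coord l x + u x) ->
  forall f, torus_fun f -> torus_fun (f \o M).
Proof.
move=> hM f; elim=> {f} [c|f g tf cf tg cg|f g tf cf tg cg|t j f t_ tf cf].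
- exact: torus_fun_cst.
- exact: (torus_funD cf cg).
- exact: (torus_funM cf cg).
- have [l [u [tu hu]]] := hM j.
  rewrite (_ : _ \o M = fun x => t 0%N (coord l x + (u x + f (M x)))).
    by apply: torus_fun_tower => //; exact: (torus_funD tu cf).
  by apply/funext => x /=; rewrite hu addrA.
Qed.

(** By induction on the construction of [f]: for products and towers the explicit second derivatives
    are symmetric as soon as those of the parts are. *)
Lemma torus_fun_schwarz f i k : torus_fun f ->
  partial i (partial k f) = partial k (partial i f).
Proof.
move=> tf0; elim: tf0 i k => {f} [c|f g tf cf tg cg|f g tf cf tg cg|t j f t_ tf cf] i k.
- by rewrite !partial_cst.
- have df x := torus_fun_differentiable x tf.
  have dg x := torus_fun_differentiable x tg.
  have pf l x := torus_fun_differentiable x (torus_fun_partial l tf).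
  have pg l x := torus_fun_differentiable x (torus_fun_partial l tg).
  rewrite (partialD k df dg) (partialD i df dg).
  by rewrite (partialD i (pf k) (pg k)) (partialD k (pf i) (pg i)) cf cg.
- have df x := torus_fun_differentiable x tf.
  have dg x := torus_fun_differentiable x tg.
  have tpf l := torus_fun_partial l tf; have tpg l := torus_fun_partial l tg.
  have pf l x := torus_fun_differentiable x (tpf l).
  have pg l x := torus_fun_differentiable x (tpg l).
  have E l m : partial l (partial m (fun x => f x * g x)) = fun x =>
      f x * partial l (partial m g) x + partial l f x * partial m g x +
      (partial m f x * partial l g x + partial l (partial m f) x * g x).
    rewrite (partialM m df dg) (@partialD l (fun x => f x * partial m g x)
      (fun x => partial m f x * g x)).
    + by rewrite (partialM l df (pg m)) (partialM l (pf m) dg).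
    + by move=> x; exact: (differentiableM (df x) (pg m x)).
    + by move=> x; exact: (differentiableM (pf m x) (dg x)).
  rewrite !E cf cg; apply/funext => x.
  move: (f x) (g x) (partial i f x) (partial k f x) (partial i g x) (partial k g x).
  by move: (partial k _ x) (partial k _ x) => *; ring.
- have df x := torus_fun_differentiable x tf.
  have tpf l := torus_fun_partial l tf.
  have pf l x := torus_fun_differentiable x (tpf l).
  have E l m : partial l (partial m (fun x => t 0%N (coord j x + f x))) = fun x =>
      (coord j (basis3 R m) + partial m f x) *
        ((coord j (basis3 R l) + partial l f x) * t 2%N (coord j x + f x)) +
      partial l (partial m f) x * t 1%N (coord j x + f x).
    rewrite (partial_tower m j t_ df).
    rewrite (@partialM l (fun x => coord j (basis3 R m) + partial m f x)
      (fun x => t 1%N (coord j x + f x))).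
    + rewrite (@partialD l (fun=> coord j (basis3 R m)) (partial m f)) ?partial_cst//.
      rewrite (partial_tower l j (towerS t_) df).
      by apply/funext => x; rewrite add0r.
    + by move=> x; apply: differentiableD.
    + by move=> x; have [] := tower_is_diff j (towerS t_) (df x).
  rewrite !E cf; apply/funext => x.
  move: (t 1%N _) (t 2%N _) (partial k (partial i f) x) (partial i f x) (partial k f x).
  by move: (coord j (basis3 R i)) (coord j (basis3 R k)) => *; ring.
Qed.

End torus_functions.

(** * Shear steps *)

Section step_maps.
Variable R : realType.
Implicit Types (x v X : R3 R) (a : R -> R).

(* A shear of the first coordinate followed by the cyclic permutation of the
   coordinates: the flow over a full period is the third power of such a map. *)
Definition step a x : R3 R := (x.1.2, x.2, x.1.1 + a x.1.2).
Definition stepV a x : R3 R := (x.2 - a x.1.1, x.1.1, x.1.2).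
Definition stepD (d : R) (v : R3 R) : R3 R := (v.1.2, v.2, v.1.1 + v.1.2 * d).
Definition stepVD (d : R) (v : R3 R) : R3 R := (v.2 - v.1.1 * d, v.1.1, v.1.2).

Lemma stepK a : cancel (step a) (stepV a).
Proof. by move=> [[x y] z]; rewrite /step /stepV /= addrK. Qed.

Lemma stepVK a : cancel (stepV a) (step a).
Proof. by move=> [[x y] z]; rewrite /step /stepV /= subrK. Qed.

Lemma coord0_is_diff x : is_diff x (fun x : R3 R => x.1.1) (fun v : R3 R => v.1.1).
Proof. exact: (coord_is_diff 0 x). Qed.
Lemma coord1_is_diff x : is_diff x (fun x : R3 R => x.1.2) (fun v : R3 R => v.1.2).
Proof. exact: (coord_is_diff 1 x). Qed.
Lemma coord2_is_diff x : is_diff x (fun x : R3 R => x.2) (fun v : R3 R => v.2).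
Proof. exact: (coord_is_diff 2 x). Qed.

Lemma step_is_diff a x (d : R) : is_derive (x.1.2 : R) (1 : R) a d ->
  is_diff x (step a) (stepD d).
Proof.
move=> ad; apply: is_diff_pair.
  by apply: is_diff_pair; [exact: coord1_is_diff|exact: coord2_is_diff].
apply: is_diffD; first exact: coord0_is_diff.
exact: (is_diff_comp (coord1_is_diff x) (is_derive_diff ad)).
Qed.

Lemma stepV_is_diff a x (d : R) : is_derive (x.1.1 : R) (1 : R) a d ->
  is_diff x (stepV a) (stepVD d).
Proof.
move=> ad; apply: is_diff_pair.
  apply: is_diff_pair; last exact: coord0_is_diff.
  apply: is_diffB; first exact: coord2_is_diff.
  exact: (is_diff_comp (coord0_is_diff x) (is_derive_diff ad)).
exact: coord1_is_diff.
Qed.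

Lemma basis3E v : v = v.1.1 *: basis3 R (inord 0) + v.1.2 *: basis3 R (inord 1)
  + v.2 *: basis3 R (inord 2).
Proof.
case: v => [[x y] z]; rewrite /basis3 !inordK//= /vec3.
by congr (_, _, _); rewrite /= /GRing.scale/= !(mulr0, mulr1, addr0, add0r).
Qed.

Lemma grad_is_diff f x : torus_fun f ->
  is_diff x f (fun v => dot3 v (grad f x)).
Proof.
move=> tf; have df := torus_fun_differentiable x tf; split=> //.
apply/funext => v; rewrite {1}(basis3E v) !linearD !linearZ/= -!deriveE//.
Qed.

Lemma partial_diff f df x i : is_diff x f df -> partial i f x = df (basis3 R i).
Proof. by move=> fd; have [_] := is_diff_derive (basis3 R i) fd. Qed.

Lemma grad_diff f (w : R3 R) x : is_diff x f (fun v => dot3 v w) -> grad f x = w.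
Proof.
move=> fw; rewrite /grad /vec3 !(partial_diff _ fw) /dot3 /basis3 !inordK//=.
by case: w fw => [[w0 w1] w2] _/=; congr (_, _, _);
  rewrite !(mul0r, mul1r, addr0, add0r).
Qed.

Lemma dot3_grad_comp f (M : R3 R -> R3 R) dM x v :
  is_diff x M dM -> torus_fun f -> torus_fun (f \o M) ->
  dot3 (dM v) (grad f (M x)) = dot3 v (grad (f \o M) x).
Proof.
move=> Md tf tfM.
have [_ E1] := is_diff_comp Md (grad_is_diff (M x) tf).
have [_ E2] := grad_is_diff x tfM.
by move: E1; rewrite E2 => /(congr1 (@^~ v)).
Qed.

Lemma tower_scale (t : nat -> R -> R) (c : R) : tower t ->
  tower (fun k s => c * t k s).
Proof.
move=> [td tp]; split=> k s; last by rewrite tp.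
exact: (is_deriveZ c).
Qed.

Lemma torus_fun_tower0 (t : nat -> R -> R) j : tower t ->
  torus_fun (fun x => t 0%N (coord j x)).
Proof.
move=> t_; rewrite (_ : (fun x => _) = fun x => t 0%N (coord j x + (cst 0) x)).
  by apply: torus_fun_tower => //; exact: torus_fun_cst.
by apply/funext => x /=; rewrite addr0.
Qed.

Lemma torus_fun_step (t : nat -> R -> R) f : tower t ->
  torus_fun f -> torus_fun (f \o step (t 0%N)).
Proof.
move=> t_ tf; apply: torus_fun_comp => // j.
have t0 : torus_fun (fun=> 0 : R) by exact: torus_fun_cst.
rewrite /step /coord; case: (j == 0%N); last case: (j == 1%N).
- by exists 1%N, (fun=> 0); split=> // x /=; rewrite addr0.
- by exists 2%N, (fun=> 0); split=> // x /=; rewrite addr0.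
- by exists 0%N, (fun x => t 0%N (coord 1 x)); split=> //;
    exact: torus_fun_tower0.
Qed.

Lemma torus_fun_stepV (t : nat -> R -> R) f : tower t ->
  torus_fun f -> torus_fun (f \o stepV (t 0%N)).
Proof.
move=> t_ tf; apply: torus_fun_comp => // j.
have t0 : torus_fun (fun=> 0 : R) by exact: torus_fun_cst.
rewrite /stepV /coord; case: (j == 0%N); last case: (j == 1%N).
- exists 2%N, (fun x => -1 * t 0%N (coord 0 x)); split=> [|x].
    exact: (torus_fun_tower0 0 (tower_scale (-1) t_)).
  by rewrite mulN1r.
- by exists 0%N, (fun=> 0); split=> // x /=; rewrite addr0.
- by exists 1%N, (fun=> 0); split=> // x /=; rewrite addr0.
Qed.

Lemma measurable_pair3 d (T : measurableType d) (f g h : T -> measurableTypeR R) :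
  measurable_fun setT f -> measurable_fun setT g -> measurable_fun setT h ->
  measurable_fun setT (fun t => (f t, g t, h t) : R3 R).
Proof.
by move=> mf mg mh; apply: measurable_fun_pair => //; exact: measurable_fun_pair.
Qed.

Lemma measurable_step a : measurable_fun setT a -> measurable_fun setT (step a).
Proof.
move=> ma; apply: measurable_pair3.
- exact: (measurable_coord 1).
- exact: (measurable_coord 2).
- apply: measurable_funD; first exact: (measurable_coord 0).
  exact: (measurableT_comp ma (measurable_coord 1)).
Qed.

Lemma measurable_stepV a : measurable_fun setT a -> measurable_fun setT (stepV a).
Proof.
move=> ma; apply: measurable_pair3.
- apply: measurable_funB; first exact: (measurable_coord 2).
  exact: (measurableT_comp ma (measurable_coord 0)).
- exact: (measurable_coord 0).
- exact: (measurable_coord 1).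
Qed.

End step_maps.

(** * Fluxes and shear homotopies *)

Section homotopy.
Variable R : realType.
Variable mu : {measure set (R3 R) -> \bar R}.
Implicit Types (x v X : R3 R) (b P : R3 R -> R3 R) (F G : R3 R -> R).

Definition l1norm (v : R3 R) : R := `|v.1.1| + `|v.1.2| + `|v.2|.

Lemma l1norm_ge0 v : 0 <= l1norm v.
Proof. by rewrite !addr_ge0. Qed.

Lemma l1norm_coord j v : `|coord j v| <= l1norm v.
Proof.
rewrite /coord /l1norm; case: (j == 0%N); last case: (j == 1%N).
- by rewrite -addrA lerDl addr_ge0.
- by rewrite addrAC lerDr addr_ge0.
- by rewrite lerDr addr_ge0.
Qed.

Lemma l1norm0 v : `|v.1.1| <= l1norm v. Proof. exact: (l1norm_coord 0). Qed.
Lemma l1norm1 v : `|v.1.2| <= l1norm v. Proof. exact: (l1norm_coord 1). Qed.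
Lemma l1norm2 v : `|v.2| <= l1norm v. Proof. exact: (l1norm_coord 2). Qed.

Lemma measurable_coordT d (T : measurableType d) j (b : T -> R3 R) :
  measurable_fun setT b -> measurable_fun setT (fun y => coord j (b y)).
Proof. by move=> mb; exact: (measurableT_comp (measurable_coord j) mb). Qed.

Lemma measurable_l1norm d (T : measurableType d) (b : T -> R3 R) :
  measurable_fun setT b -> measurable_fun setT (fun y => l1norm (b y)).
Proof.
move=> mb; have m j : measurable_fun setT (fun y => `|coord j (b y)|).
  by apply: measurableT_comp => //; exact: measurable_coordT.
by apply: measurable_funD; [apply: measurable_funD|];
  [exact: (m 0%N)|exact: (m 1%N)|exact: (m 2%N)].
Qed.

Definition integrable_field b := measurable_fun setT b /\
  mu.-integrable setT (EFin \o (l1norm \o b)).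

Lemma dominated_integrable b (u : R3 R -> R) (C : R) : integrable_field b ->
  measurable_fun setT u -> (forall y, `|u y| <= C * l1norm (b y)) ->
  mu.-integrable setT (EFin \o u).
Proof.
move=> [mb ib] mu_ uC.
apply: (le_integrable measurableT (g := EFin \o (fun y => C * l1norm (b y)))).
- exact/measurable_EFinP.
- by move=> y _ /=; rewrite lee_fin (le_trans (uC y))// ler_norm.
- exact: (integrableZl measurableT C ib).
Qed.

Lemma dominated_integrable_field b b' (C : R) : integrable_field b ->
  measurable_fun setT b' -> (forall y, l1norm (b' y) <= C * l1norm (b y)) ->
  integrable_field b'.
Proof.
move=> ib mb' bC; split=> //; apply: (dominated_integrable ib (C := C)).
  exact: measurable_l1norm.
by move=> y /=; rewrite ger0_norm ?l1norm_ge0.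
Qed.

(** The flux of a transported field, with [b y] regarded as a vector at [P y]. The integration
    variable stays the initial point, so [mu] is never transported. *)
Definition pairing b P F G := \int[mu]_y (F (P y) * dot3 (b y) (grad G (P y))).

(* The push-forward under [P] of the vector field with value [b y] at [P y] is
   divergence-free. *)
Definition closed_pair b P := forall psi, torus_fun psi ->
  \int[mu]_y (dot3 (b y) (grad psi (P y))) = 0.

Lemma stepV_time_derive F a X (r : R) : torus_fun F ->
  is_derive r (1 : R) (fun r => F (stepV (fun s => r * a s) X))
    (- a X.1.1 * partial (inord 0) F (stepV (fun s => r * a s) X)).
Proof.
move=> tF.
have d1 : is_diff r (fun r : R => stepV (fun s => r * a s) X)
    (fun h : R => (0 - h * a X.1.1, 0, 0) : R3 R).
  have cstd c : is_diff r (fun=> c : R) (fun=> 0 : R) by exact: is_diff_cst.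
  have timed : is_diff r (fun r : R => r * a X.1.1) (fun h : R => h * a X.1.1).
    apply: is_derive_diff.
    have := is_deriveM (is_derive_id r (1 : R)) (is_derive_cst (a X.1.1) r (1 : R)).
    by move=> /is_derive_eq; apply; rewrite scaler0 add0r /GRing.scale/= mulr1.
  exact: (is_diff_pair (is_diff_pair (is_diffB (cstd X.2) timed)
    (cstd X.1.1)) (cstd X.1.2)).
have := is_diff_derive (1 : R) (is_diff_comp d1 (grad_is_diff _ tF)).
by move=> /is_derive_eq; apply; rewrite /dot3/= !mul0r !addr0 mul1r add0r.
Qed.

Lemma dot3_gradM F G x v : torus_fun F -> torus_fun G ->
  dot3 v (grad (fun x => F x * G x) x) =
  F x * dot3 v (grad G x) + G x * dot3 v (grad F x).
Proof.
move=> tF tG; have dF y := torus_fun_differentiable y tF.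
have dG y := torus_fun_differentiable y tG.
rewrite /grad !(partialM _ dF dG) /dot3 /vec3 /=.
move: (partial (inord 0) F x) (partial (inord 1) F x) (partial (inord 2) F x).
move: (partial (inord 0) G x) (partial (inord 1) G x) (partial (inord 2) G x).
by move: (F x) (G x) v.1.1 v.1.2 v.2 => *; ring.
Qed.

Lemma dot3_le v w (M : R) : (forall j, `|coord j w| <= M) ->
  `|dot3 v w| <= M * l1norm v.
Proof.
move=> wM; have w0 := wM 0%N; have w1 := wM 1%N; have w2 := wM 2%N.
rewrite /dot3 /l1norm !mulrDr !(mulrC M).
rewrite (le_trans (ler_normD _ _))// lerD//; last by rewrite normrM ler_wpM2l.
by rewrite (le_trans (ler_normD _ _))// lerD// normrM ler_wpM2l.
Qed.

Lemma measurable_dot3 d (T : measurableType d) (V W : T -> R3 R) :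
  (forall j, measurable_fun setT (fun y => coord j (V y))) ->
  (forall j, measurable_fun setT (fun y => coord j (W y))) ->
  measurable_fun setT (fun y => dot3 (V y) (W y)).
Proof.
move=> mV mW; apply: measurable_funD; last by apply: measurable_funM;
  [exact: (mV 2%N)|exact: (mW 2%N)].
by apply: measurable_funD; apply: measurable_funM;
  [exact: (mV 0%N)|exact: (mW 0%N)|exact: (mV 1%N)|exact: (mW 1%N)].
Qed.

Lemma coord_grad F j x : coord j (grad F x) = partial (inord (minn j 2)) F x.
Proof. by move: j => [|[|[|j]]]//; rewrite /coord/= /minn ltnNge. Qed.

Lemma grad_bounded F : torus_fun F ->
  exists M : R, forall j x, `|coord j (grad F x)| <= M.
Proof.
move=> tF; have bd i := torus_fun_bounded (torus_fun_partial (inord i) tF).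
have [M0 h0] := bd 0%N; have [M1 h1] := bd 1%N; have [M2 h2] := bd 2%N.
exists (`|M0| + `|M1| + `|M2|) => j x; rewrite coord_grad.
have le3 (a c e : R) : [/\ `|a| <= `|a| + `|c| + `|e|, `|c| <= `|a| + `|c| + `|e| &
    `|e| <= `|a| + `|c| + `|e|].
  split; [by rewrite -addrA lerDl addr_ge0|by rewrite addrAC lerDr addr_ge0|].
  by rewrite lerDr addr_ge0.
have [e0 e1 e2] := le3 M0 M1 M2.
case: j => [|[|j]]; last have -> : minn j.+2 2 = 2%N by apply/minn_idPr.
- exact: (le_trans (le_trans (h0 x) (ler_norm _)) e0).
- exact: (le_trans (le_trans (h1 x) (ler_norm _)) e1).
- exact: (le_trans (le_trans (h2 x) (ler_norm _)) e2).
Qed.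

Lemma dot3_grad_integrable b P F : integrable_field b -> measurable_fun setT P ->
  torus_fun F -> mu.-integrable setT (EFin \o (fun y => dot3 (b y) (grad F (P y)))).
Proof.
move=> ib mP tF; have [M hM] := grad_bounded tF.
apply: (dominated_integrable (C := M) ib) => [|y]; last exact: dot3_le.
apply: measurable_dot3 => j; first by apply: measurable_coordT; have [] := ib.
under eq_fun do rewrite coord_grad.
exact: (measurableT_comp (torus_fun_measurable (torus_fun_partial _ tF)) mP).
Qed.

Lemma pairing_integrable b P F G : integrable_field b -> measurable_fun setT P ->
  torus_fun F -> torus_fun G ->
  mu.-integrable setT (EFin \o (fun y => F (P y) * dot3 (b y) (grad G (P y)))).
Proof.
move=> ib mP tF tG; have [M hM] := torus_fun_bounded tF.
apply: (integrableMr measurableT (h := F \o P)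
  (g := EFin \o (fun y => dot3 (b y) (grad G (P y))))).
- exact: (measurableT_comp (torus_fun_measurable tF) mP).
- exists M; split; first by rewrite num_real.
  by move=> N MN x _ /=; rewrite (le_trans (hM _))// ltW.
- exact: dot3_grad_integrable.
Qed.

Lemma homotopy_derive (c0 c1 c2 a a' e0 e1 e2 r : R) (f0 f1 f2 : R -> R) :
  is_derive r (1 : R) f0 (- a * e0) -> is_derive r (1 : R) f1 (- a * e1) ->
  is_derive r (1 : R) f2 (- a * e2) ->
  is_derive r (1 : R)
    (fun r => (c2 - c0 * (r * a')) * f0 r + c0 * f1 r + c1 * f2 r)
    (- (c0 * a') * f0 r -
      a * ((c2 - c0 * (r * a')) * e0 + c0 * e1 + c1 * e2)).
Proof.
move=> d0 d1 d2.
have dw := is_deriveB (is_derive_cst c2 r (1 : R))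
    (is_deriveM (is_derive_cst c0 r (1 : R))
     (is_deriveM (is_derive_id r (1 : R)) (is_derive_cst a' r (1 : R)))).
have := is_deriveD (is_deriveD (is_deriveM dw d0)
  (is_deriveM (is_derive_cst c0 r (1 : R)) d1))
  (is_deriveM (is_derive_cst c1 r (1 : R)) d2).
move=> /is_derive_eq; apply.
by rewrite !scaler0 /GRing.scale/= !fctE /cst; ring.
Qed.

(** Cartan's formula for the one-form F dG along the field - t0 d/dx_0, contracted with the
    transported vector. The left side is the Lie derivative; on the right come the differential of
    the contraction, then the contraction of dF /\ dG. The second derivatives [g10] and [g20] cancel
    outside the exact part. *)
Lemma homotopy_algebra (b0 b1 b2 t0 t1 P0 D00 w0 D10 D01 D20 D02 f : R)
    (f0 f1 f2 g0 g1 g2 g10 g20 : R) :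
  D10 = f * g10 + f0 * g1 -> D01 = f * g10 + f1 * g0 ->
  D20 = f * g20 + f0 * g2 -> D02 = f * g20 + f2 * g0 ->
  - (b0 * t1) * P0 - t0 * (w0 * D00 + b0 * D10 + b1 * D20) =
  (-1 * t0) * (w0 * D00 + b0 * D01 + b1 * D02) +
    P0 * (b0 * (-1 * t1) + b1 * 0 + b2 * 0) -
  t0 * (b0 * (f0 * g1 - f1 * g0) + b1 * (f0 * g2 - f2 * g0)).
Proof. by move=> -> -> -> ->; ring. Qed.

(** A crude bound, whose constants involve second derivatives of the test functions. It only
    supplies a dominating function for differentiation under the integral; the estimate that is
    iterated comes from [dq_exact]. *)
Lemma homotopy_bound (b0 b1 b2 t0 t1 r P0 D0 D1 D2 l K0 K1 M0 N0 N1 N2 : R) :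
  `|b0| <= l -> `|b1| <= l -> `|b2| <= l -> `|t0| <= K0 -> `|t1| <= K1 ->
  `|r| <= 2 -> `|P0| <= M0 -> `|D0| <= N0 -> `|D1| <= N1 -> `|D2| <= N2 ->
  `|- (b0 * t1) * P0 - t0 * ((b2 - b0 * (r * t1)) * D0 + b0 * D1 + b1 * D2)|
    <= (K1 * M0 + K0 * ((1 + 2 * K1) * N0 + N1 + N2)) * l.
Proof.
move=> hb0 hb1 hb2 ht0 ht1 hr hP hD0 hD1 hD2.
have m (a c A C : R) : `|a| <= A -> `|c| <= C -> `|a * c| <= A * C.
  by move=> aA cC; rewrite normrM ler_pM.
have p (a c A C : R) : `|a| <= A -> `|c| <= C -> `|a + c| <= A + C.
  by move=> aA cC; rewrite (le_trans (ler_normD _ _))// lerD.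
have n (a A : R) : `|a| <= A -> `|- a| <= A by rewrite normrN.
have -> : (K1 * M0 + K0 * ((1 + 2 * K1) * N0 + N1 + N2)) * l =
  l * K1 * M0 + K0 * ((l + l * (2 * K1)) * N0 + l * N1 + l * N2) by ring.
apply: (p); first by apply: (m) => //; apply: (n); exact: m.
apply: (n); apply: (m) => //; apply: (p); last exact: m.
apply: (p); last exact: m.
apply: (m) => //; apply: (p) => //; apply: (n); apply: (m) => //; exact: m.
Qed.

(** Differentiation under the integral sign takes place on an open interval of homotopy times; []-1,
    2[] contains the closed interval [[0, 1]]. *)
Lemma itv01_itvN12 (s : R) : s \in `[0, 1]%R -> `]-1, 2[%classic s.
Proof.
rewrite in_itv/= => /andP[s0 s1]; rewrite /= in_itv/=.
by rewrite (lt_le_trans _ s0) ?ltrN10// (le_lt_trans s1)// ltr1n.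
Qed.

Lemma MVT_le01 (f df : R -> R) (M : R) :
  (forall s : R, s \in `[0, 1]%R -> is_derive s (1 : R) f (df s)) ->
  (forall s, `|df s| <= M) -> `|f 1 - f 0| <= M.
Proof.
move=> fd dM.
have cf : {within `[0, 1], continuous f}.
  apply: continuous_in_subspaceT => s /set_mem sI.
  by apply/differentiable_continuous/derivable1_diffP; have [] := fd s sI.
have fd' (s : R) : s \in `]0, 1[%R -> is_derive s (1 : R) f (df s).
  by move=> sI; apply: fd; exact: subset_itv_oo_cc.
have l01 : (0 : R) <= 1 by exact: ler01.
have [c _ ->] := MVT_segment l01 fd' cf.
by rewrite subr0 mulr1.
Qed.

Section homotopy_step.
Variables (t : nat -> R -> R) (b P : R3 R -> R3 R) (F G : R3 R -> R) (Ma Mc : R).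
Hypotheses (t_ : tower t) (tM : forall s, `|t 0%N s| <= Ma).
Hypotheses (ib : integrable_field b) (mP : measurable_fun setT P).
Hypotheses (bP : closed_pair b P) (tF : torus_fun F) (tG : torus_fun G).
Let d i := @partial R (inord i).
Hypotheses (M1 : forall x, `|d 0 F x * d 1 G x - d 1 F x * d 0 G x| <= Mc).
Hypotheses (M2 : forall x, `|d 0 F x * d 2 G x - d 2 F x * d 0 G x| <= Mc).

Let Phi i x := F x * d i G x.
Let p (r : R) y := stepV (fun s => r * t 0%N s) (P y).
Let w (r : R) y := stepVD (r * t 1%N (P y).1.1) (b y).
Let q (r : R) y := (w r y).1.1 * Phi 0 (p r y) + (w r y).1.2 * Phi 1 (p r y)
  + (w r y).2 * Phi 2 (p r y).
Let dq (r : R) y := - ((b y).1.1 * t 1%N (P y).1.1) * Phi 0 (p r y) -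
  t 0%N (P y).1.1 * ((w r y).1.1 * d 0 (Phi 0) (p r y)
    + (w r y).1.2 * d 0 (Phi 1) (p r y) + (w r y).2 * d 0 (Phi 2) (p r y)).

Let rt (r : R) : tower (fun k s => r * t k s). Proof. exact: tower_scale. Qed.

Let tPhi i : torus_fun (Phi i).
Proof. by apply: torus_funM => //; exact: torus_fun_partial. Qed.

Let grad_stepV H r y : torus_fun H ->
  dot3 (b y) (grad (H \o stepV (fun s => r * t 0%N s)) (P y)) =
  dot3 (w r y) (grad H (p r y)).
Proof.
move=> tH; have Md : is_diff (P y) (stepV (fun s => r * t 0%N s))
    (stepVD (r * t 1%N (P y).1.1)).
  by apply: stepV_is_diff; have [td _] := rt r; exact: td.
by rewrite -(dot3_grad_comp (b y) Md tH (torus_fun_stepV (rt r) tH)).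
Qed.

Let qE r y : q r y = (F \o stepV (fun s => r * t 0%N s)) (P y) *
  dot3 (b y) (grad (G \o stepV (fun s => r * t 0%N s)) (P y)).
Proof.
rewrite grad_stepV//= /q /dot3/= /Phi -/(p r y) /d.
move: (partial (inord 0) G _) (partial (inord 1) G _) (partial (inord 2) G _).
by move: (F _) (w r y).1.1 (w r y).1.2 (w r y).2 => *; ring.
Qed.

Let q_derive r y : is_derive r (1 : R) (q^~ y) (dq r y).
Proof.
have dP i := stepV_time_derive (t 0%N) (P y) r (tPhi i).
exact: (homotopy_derive (b y).1.1 (b y).1.2 (b y).2 (t 1%N (P y).1.1)
  (dP 0%N) (dP 1%N) (dP 2%N)).
Qed.

Let dq_exact r y :
  dq r y = dot3 (b y) (grad (fun x => (-1 * t 0%N (coord 0 x)) *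
      (Phi 0 \o stepV (fun s => r * t 0%N s)) x) (P y))
   - t 0%N (P y).1.1 * ((b y).1.1 *
       (d 0 F (p r y) * d 1 G (p r y) - d 1 F (p r y) * d 0 G (p r y)) +
      (b y).1.2 *
       (d 0 F (p r y) * d 2 G (p r y) - d 2 F (p r y) * d 0 G (p r y))).
Proof.
set f0 := fun x => -1 * t 0%N (coord 0 x).
have tf0 : torus_fun f0 := torus_fun_tower0 0 (tower_scale (-1) t_).
have dPhi i k x : d k (Phi i) x = F x * d k (d i G) x + d k F x * d i G x.
  rewrite /d partialM// => {}x; first exact: torus_fun_differentiable.
  exact/torus_fun_differentiable/torus_fun_partial.
have gf0 : grad f0 (P y) = vec3 (-1 * t 1%N (P y).1.1) 0 0.
  apply: grad_diff; have [td _] := tower_scale (-1) t_.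
  have := is_diff_comp (coord0_is_diff (P y)) (is_derive_diff (td 0%N (P y).1.1)).
  congr is_diff_def; apply/funext => v /=.
  by rewrite /dot3 /= !mulr0 !addr0.
set g := _ \o _.
have tg : torus_fun g := torus_fun_stepV (rt r) (tPhi 0%N).
rewrite dot3_gradM// gf0 grad_stepV//.
have e10 := dPhi 1%N 0%N (p r y); have e01 := dPhi 0%N 1%N (p r y).
have e20 := dPhi 2%N 0%N (p r y); have e02 := dPhi 0%N 2%N (p r y).
rewrite {1}/d {1}/d torus_fun_schwarz -/(d 0 G) // in e10.
rewrite {1}/d {1}/d torus_fun_schwarz -/(d 0 G) // in e20.
exact: (homotopy_algebra (b y).1.1 (b y).1.2 (b y).2 (t 0%N (P y).1.1)
  (t 1%N (P y).1.1) (Phi 0 (p r y)) (d 0 (Phi 0) (p r y)) (w r y).1.1 e10 e01 e20 e02).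
Qed.

Let integrable_q r : mu.-integrable setT (EFin \o q r).
Proof.
rewrite (funext (qE r)).
by apply: pairing_integrable => //; exact: (torus_fun_stepV (rt r)).
Qed.

Let dq_bounded : exists2 C : R, 0 <= C &
  forall (r : R) y, `]-1, 2[%classic r -> `|dq r y| <= C * l1norm (b y).
Proof.
have [K0 h0] := tower_bounded 0%N t_; have [K1 h1] := tower_bounded 1%N t_.
have bP' i := torus_fun_bounded (tPhi i).
have bdP i := torus_fun_bounded (torus_fun_partial (inord 0) (tPhi i)).
have [M0 g0] := bP' 0%N.
have [N0 f0] := bdP 0%N; have [N1 f1] := bdP 1%N; have [N2 f2] := bdP 2%N.
have K00 := le_trans (normr_ge0 _) (h0 0); have K10 := le_trans (normr_ge0 _) (h1 0).
have M00 := le_trans (normr_ge0 _) (g0 0).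
have N00 := le_trans (normr_ge0 _) (f0 0); have N10 := le_trans (normr_ge0 _) (f1 0).
have N20 := le_trans (normr_ge0 _) (f2 0).
exists (K1 * M0 + K0 * ((1 + 2 * K1) * N0 + N1 + N2)).
  by rewrite !(addr_ge0, mulr_ge0)// addr_ge0// mulr_ge0.
move=> r y; rewrite /= in_itv/= => /andP[r1 r2].
have r3 : `|r| <= 2 by rewrite ler_norml; apply/andP; split; lra.
exact: (homotopy_bound (l1norm0 (b y)) (l1norm1 (b y)) (l1norm2 (b y)) (h0 _) (h1 _)
  r3 (g0 _) (f0 _) (f1 _) (f2 _)).
Qed.

Let Q r := \int[mu]_y q r y.

Let Q_derive (r : R) : `]-1, 2[%classic r ->
  is_derive r (1 : R) Q (\int[mu]_y dq r y).
Proof.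
move=> rI; have [C C0 dC] := dq_bounded.
have d1 (s : R) y : partial1of2 q s y = dq s y.
  by rewrite partial1of2E; have [_] := q_derive s y.
have der (s : R) y : `]-1, 2[%classic s -> setT y -> derivable (q^~ y) s (1 : R).
  by move=> _ _; have [] := q_derive s y.
have CC y : 0 <= C * l1norm (b y) by rewrite mulr_ge0// l1norm_ge0.
have iC : mu.-integrable setT (EFin \o (fun y => C * l1norm (b y))).
  by have [_ ib'] := ib; exact: (integrableZl measurableT C ib').
have le (s : R) y : `]-1, 2[%classic s -> setT y -> `|partial1of2 q s y| <= C * l1norm (b y).
  by move=> sI _; rewrite d1; exact: dC.
split.
  exact: (derivable_under_integral measurableT rI (fun s _ => integrable_q s) der CC iC le).
rewrite -derive1E.
rewrite (differentiation_under_integral measurableT rI (fun s _ => integrable_q s) der CC iC le).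
by apply: eq_Rintegral => y _; rewrite d1.
Qed.

Let dQ_le (r : R) : `|\int[mu]_y dq r y| <= Ma * Mc * \int[mu]_y l1norm (b y).
Proof.
set h1 := fun x => (-1 * t 0%N (coord 0 x)) * (Phi 0 \o stepV (fun s => r * t 0%N s)) x.
have th1 : torus_fun h1.
  apply: torus_funM; first exact: (torus_fun_tower0 0 (tower_scale (-1) t_)).
  exact: torus_fun_stepV (rt r) (tPhi 0%N).
pose e y := t 0%N (P y).1.1 * ((b y).1.1 *
       (d 0 F (p r y) * d 1 G (p r y) - d 1 F (p r y) * d 0 G (p r y)) +
      (b y).1.2 *
       (d 0 F (p r y) * d 2 G (p r y) - d 2 F (p r y) * d 0 G (p r y))).
have Ma0 := le_trans (normr_ge0 _) (tM 0).
have Mc0 := le_trans (normr_ge0 _) (M1 0).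
have mb : measurable_fun setT b by have [] := ib.
have mp : measurable_fun setT (p r).
  have mt : measurable_fun setT (fun s => r * t 0%N s).
    apply: measurable_funM; first exact: measurable_cst.
    by apply: continuous_measurable_fun; exact: tower_continuous.
  exact: (measurableT_comp (measurable_stepV mt) mP).
have md H k : torus_fun H -> measurable_fun setT (fun y => d k H (p r y)).
  move=> tH; exact: (measurableT_comp (torus_fun_measurable (torus_fun_partial _ tH)) mp).
have ele y : `|e y| <= Ma * Mc * l1norm (b y).
  rewrite /e normrM -mulrA ler_pM// (le_trans (ler_normD _ _))//.
  have -> : Mc * l1norm (b y) = Mc * `|(b y).1.1| + Mc * `|(b y).1.2| + Mc * `|(b y).2|.
    by rewrite /l1norm !mulrDr.
  by rewrite ler_wpDr ?mulr_ge0// lerD// normrM mulrC ler_pM.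
have ie : mu.-integrable setT (EFin \o e).
  apply: (dominated_integrable ib _ ele).
  apply: measurable_funM.
    apply: (measurableT_comp _ (measurable_coordT 0%N mP)).
    by apply: continuous_measurable_fun; exact: tower_continuous.
  apply: measurable_funD; apply: measurable_funM.
  - exact: (measurable_coordT 0%N mb).
  - by apply: measurable_funB; apply: measurable_funM; exact: md.
  - exact: (measurable_coordT 1%N mb).
  - by apply: measurable_funB; apply: measurable_funM; exact: md.
under eq_Rintegral do rewrite dq_exact -/h1 -/(e _).
rewrite RintegralB//; last exact: dot3_grad_integrable.
(* The exact part integrates to 0 because the transported field is divergence-free. *)
rewrite bP// sub0r normrN (le_trans (le_normr_Rintegral measurableT ie))//.
have [_ ib'] := ib.
rewrite -RintegralZl//; apply: le_Rintegral => //.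
- exact: integrable_norm.
- exact: (integrableZl measurableT (Ma * Mc) ib').
Qed.

(** The homotopy multiplies the shear by [r] and runs from the bare cyclic permutation, [r = 0], to
    the full inverse step, [r = 1]. As the shear moves points along coordinate 0, only the two
    components of grad F x grad G that contain a derivative in that direction are involved. *)
Lemma pairing_stepV_homotopy :
  `|pairing b P (F \o stepV (t 0%N)) (G \o stepV (t 0%N)) -
    pairing b P (F \o stepV (fun=> 0)) (G \o stepV (fun=> 0))|
  <= Ma * Mc * \int[mu]_y l1norm (b y).
Proof.
have QE (r : R) : Q r = pairing b P (F \o stepV (fun s => r * t 0%N s))
    (G \o stepV (fun s => r * t 0%N s)).
  by apply: eq_Rintegral => y _; exact: qE.
have E1 : (fun s => 1 * t 0%N s) = t 0%N by apply/funext => s; rewrite mul1r.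
have E0 : (fun s => 0 * t 0%N s) = fun=> 0 by apply/funext => s; rewrite mul0r.
have Q1 := QE 1; have Q0 := QE 0; rewrite E1 in Q1; rewrite E0 in Q0.
rewrite -Q1 -Q0.
exact: (MVT_le01 (fun s sI => Q_derive (itv01_itvN12 sI)) dQ_le).
Qed.

End homotopy_step.
End homotopy.

(** * Iterated homotopies and the growth of grad F x grad G *)

Section flux.
Variable R : realType.
Variable mu : {measure set (R3 R) -> \bar R}.
Implicit Types (x v X : R3 R) (b P : R3 R -> R3 R) (F G : R3 R -> R).

Definition cross_grad F G x : R3 R :=
  let d i := partial (inord i) in
  vec3 (d 1%N F x * d 2%N G x - d 2%N F x * d 1%N G x)
    (d 2%N F x * d 0%N G x - d 0%N F x * d 2%N G x)
    (d 0%N F x * d 1%N G x - d 1%N F x * d 0%N G x).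

(* Gradient pairs transform contravariantly, so their cross product is pushed
   forward like a vector field by these volume-preserving maps. *)
Lemma cross_grad_stepV t F G X : tower t -> torus_fun F -> torus_fun G ->
  cross_grad (F \o stepV (t 0%N)) (G \o stepV (t 0%N)) X =
  stepD (t 1%N X.1.1) (cross_grad F G (stepV (t 0%N) X)).
Proof.
move=> t_ tF tG; have [td _] := t_.
have dV := stepV_is_diff (td 0%N X.1.1).
have pF H i : torus_fun H -> partial i (H \o stepV (t 0%N)) X =
    dot3 (stepVD (t 1%N X.1.1) (basis3 R i)) (grad H (stepV (t 0%N) X)).
  move=> tH; exact: (partial_diff i (is_diff_comp dV (grad_is_diff _ tH))).
rewrite /cross_grad !pF// /dot3 /stepVD /basis3 !inordK//= /grad /vec3 /stepD /=.
move: (partial (inord 0) F _) (partial (inord 1) F _) (partial (inord 2) F _) => f0 f1 f2.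
move: (partial (inord 0) G _) (partial (inord 1) G _) (partial (inord 2) G _) => g0 g1 g2.
by congr (_, _, _); ring.
Qed.

(* With slopes bounded by [s ^+ 2], this weighted maximum norm grows by at most
   [s + s ^- 2] per step, slower than the rate [s ^+ 2 / 2] at which a field
   outside the cone is contracted. *)
Definition weighted (s M : R) v :=
  [/\ `|v.1.1| <= M, `|v.1.2| <= s * M & `|v.2| <= s ^+ 2 * M].

(** The matrix of [stepD d] has the eigenvectors (1, l, l^2) with l^3 = d l + 1. For [d = s ^+ 2]
    the largest root is close to [s], whence the weights 1, s, s^2; the entry 1 of the last row
    costs the extra [s ^- 2]. *)
Lemma weighted_stepD (s M d : R) v : 1 <= s -> `|d| <= s ^+ 2 -> weighted s M v ->
  weighted s ((s + s ^- 2) * M) (stepD d v).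
Proof.
move=> s1 ds [v0 v1 v2]; have s0 : 0 < s by rewrite (lt_le_trans ltr01).
have M0 : 0 <= M by rewrite (le_trans _ v0).
have sV : 0 <= s ^- 2 by rewrite invr_ge0 exprn_ge0// ltW.
split; rewrite /stepD /=.
- by rewrite (le_trans v1)// ler_wpM2r// lerDl.
- have -> : s * ((s + s ^- 2) * M) = s ^+ 2 * M + s * s ^- 2 * M by ring.
  by rewrite (le_trans v2)// lerDl !mulr_ge0// ltW.
- have -> : s ^+ 2 * ((s + s ^- 2) * M) = M + s * M * s ^+ 2.
    by field; rewrite gt_eqF.
  by rewrite (le_trans (ler_normD _ _))// lerD// normrM ler_pM.
Qed.

Lemma torus_fun_iter_stepV t k F : tower t -> torus_fun F ->
  torus_fun (F \o iter k (stepV (t 0%N))).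
Proof.
move=> t_ tF; elim: k => [//|k IH].
rewrite (_ : _ \o _ = (F \o iter k (stepV (t 0%N))) \o stepV (t 0%N)).
  exact: torus_fun_stepV.
by apply/funext => x; rewrite /= -iterSr.
Qed.

Lemma tower0 : tower (fun _ _ => 0 : R).
Proof. by split=> // k s; exact: is_derive_cst. Qed.

Lemma dot3_grad_stepV0 F v X : torus_fun F ->
  dot3 (stepVD 0 v) (grad F (stepV (fun=> 0) X)) =
  dot3 v (grad (F \o stepV (fun=> 0)) X).
Proof.
move=> tF; have dV := stepV_is_diff (is_derive_cst (0 : R) (X.1.1 : R) (1 : R)).
exact: (dot3_grad_comp v dV tF (torus_fun_stepV tower0 tF)).
Qed.

Lemma closed_pair_stepVD0 b P : closed_pair mu b P ->
  closed_pair mu (stepVD 0 \o b) (stepV (fun=> 0) \o P).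
Proof.
move=> cbP psi tpsi; rewrite -[RHS](cbP _ (torus_fun_stepV tower0 tpsi)).
apply: eq_Rintegral => y _ /=.
exact: dot3_grad_stepV0.
Qed.

Lemma pairing_stepVD0 b P F G : torus_fun G ->
  pairing mu (stepVD 0 \o b) (stepV (fun=> 0) \o P) F G =
  pairing mu b P (F \o stepV (fun=> 0)) (G \o stepV (fun=> 0)).
Proof.
by move=> tG; apply: eq_Rintegral => y _ /=; rewrite dot3_grad_stepV0.
Qed.

Lemma l1norm_stepVD0 v : l1norm (stepVD 0 v) = l1norm v.
Proof. by rewrite /l1norm /stepVD /= mulr0 subr0; ring. Qed.

Lemma measurable_stepVD0 b : measurable_fun setT b ->
  measurable_fun setT (stepVD 0 \o b).
Proof.
move=> mb; apply: measurable_pair3.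
- rewrite (_ : (fun t => _) = fun y => (b y).2); first exact: (measurable_coordT 2 mb).
  by apply/funext => y /=; rewrite mulr0 subr0.
- exact: (measurable_coordT 0 mb).
- exact: (measurable_coordT 1 mb).
Qed.

(** The [k] shears are removed one at a time. After each homotopy the remaining permutation is
    absorbed into [b] and [P], which preserves the L^1 norm and closedness, and the induction goes
    on with [k - 1] steps. The costs form a geometric sum of ratio [s + s ^- 2]. *)
Lemma pairing_iter_stepV (s Ma : R) (F G : R3 R -> R) : 2 <= s ->
  torus_fun F -> torus_fun G ->
  exists2 C, 0 <= C & forall t, tower t -> (forall u, `|t 0%N u| <= Ma) ->
    (forall u, `|t 1%N u| <= s ^+ 2) ->
    forall k b P, integrable_field mu b -> measurable_fun setT P ->
      closed_pair mu b P ->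
      `|pairing mu b P (F \o iter k (stepV (t 0%N))) (G \o iter k (stepV (t 0%N)))|
        <= C * (s + s ^- 2) ^+ k * \int[mu]_y l1norm (b y).
Proof.
move=> s2 tF tG; have s0 : 0 < s by rewrite (lt_le_trans _ s2).
have s1 : 1 <= s by rewrite (le_trans _ s2)// ler1n.
have [N hN] := torus_fun_bounded tF; have [N' hN'] := grad_bounded tG.
have [N'' hN''] := grad_bounded tF.
pose M0 := (N'' * N' + N'' * N').
have NN' x : 0 <= N' := le_trans (normr_ge0 _) (hN' 0%N x).
have N''0 x : 0 <= N'' := le_trans (normr_ge0 _) (hN'' 0%N x).
have N0 x : 0 <= N := le_trans (normr_ge0 _) (hN x).
have M00 : 0 <= M0 by rewrite addr_ge0// mulr_ge0// ?(NN' 0) ?(N''0 0).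
have w0 x : weighted s M0 (cross_grad F G x).
  have pp H K i j : (i < 3)%N -> (j < 3)%N -> torus_fun H -> torus_fun K ->
     (forall j x, `|coord j (grad H x)| <= N'') -> (forall j x, `|coord j (grad K x)| <= N') ->
     `|partial (inord i) H x * partial (inord j) K x| <= N'' * N'.
    move=> i3 j3 tH tK hH hK; rewrite normrM ler_pM//.
      have := hH i x; rewrite coord_grad.
      by have -> : minn i 2 = i by apply/minn_idPl; rewrite -ltnS.
    have := hK j x; rewrite coord_grad.
    by have -> : minn j 2 = j by apply/minn_idPl; rewrite -ltnS.
  have c0 i j k l : (i < 3)%N -> (j < 3)%N -> (k < 3)%N -> (l < 3)%N ->
     `|partial (inord i) F x * partial (inord j) G x -
       partial (inord k) F x * partial (inord l) G x| <= M0.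
    by move=> i3 j3 k3 l3; rewrite (le_trans (ler_normB _ _))// lerD//; exact: pp.
  split; rewrite /cross_grad /vec3/=.
  - exact: c0.
  - by rewrite (le_trans (c0 _ _ _ _ _ _ _ _))// ler_peMl.
  - by rewrite (le_trans (c0 _ _ _ _ _ _ _ _))// ler_peMl// exprn_ege1.
pose rho := s + s ^- 2.
have sV : 0 <= s ^- 2 by rewrite invr_ge0 exprn_ge0// ltW.
have rho2 : 2 <= rho by rewrite (le_trans s2)// lerDl.
have rho0 : 0 <= rho by rewrite (le_trans _ rho2).
pose C1 := `|Ma| * (s ^+ 2 * M0).
have C10 : 0 <= C1 by rewrite mulr_ge0// mulr_ge0// exprn_ge0// ltW.
have NN0 : 0 <= N * N' by rewrite mulr_ge0 ?(N0 0) ?(NN' 0).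
exists (N * N' + C1); first by rewrite addr_ge0.
move=> t t_ tM tM1 k.
have wk : forall x, weighted s (rho ^+ k * M0)
    (cross_grad (F \o iter k (stepV (t 0%N))) (G \o iter k (stepV (t 0%N))) x).
  elim: k => [x|k IH x]; first by rewrite expr0 mul1r; exact: w0.
  have E H : H \o iter k.+1 (stepV (t 0%N)) =
      (H \o iter k (stepV (t 0%N))) \o stepV (t 0%N).
    by apply/funext => y; rewrite /= -iterSr.
  rewrite !E cross_grad_stepV//; try exact: torus_fun_iter_stepV.
  by rewrite exprS -mulrA; apply: weighted_stepD.
suff : forall b P, integrable_field mu b -> measurable_fun setT P ->
      closed_pair mu b P ->
      `|pairing mu b P (F \o iter k (stepV (t 0%N))) (G \o iter k (stepV (t 0%N)))|
        <= (N * N' + C1 * rho ^+ k) * \int[mu]_y l1norm (b y).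
  move=> H b P ib mP cbP; rewrite (le_trans (H b P ib mP cbP))// ler_wpM2r//.
    by apply: Rintegral_ge0 => y _; exact: l1norm_ge0.
  by rewrite mulrDl lerD2r ler_peMr// exprn_ege1// (le_trans _ rho2)// ler1n.
elim: k wk => [|k IH] wk b P ib mP cbP.
  rewrite expr0 mulr1 (le_trans (le_normr_Rintegral measurableT _))//.
    exact: pairing_integrable.
  have [_ ib'] := ib.
  rewrite -RintegralZl//; apply: le_Rintegral => //.
  - by apply: integrable_norm; exact: pairing_integrable.
  - exact: (integrableZl measurableT (N * N' + C1) ib').
  - move=> y _ /=; rewrite normrM mulrDl ler_wpDr ?(mulr_ge0 C10 (l1norm_ge0 _))//.
    by rewrite -mulrA ler_pM//; exact: dot3_le.
have E H : H \o iter k.+1 (stepV (t 0%N)) =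
    (H \o iter k (stepV (t 0%N))) \o stepV (t 0%N).
  by apply/funext => y; rewrite /= -iterSr.
have [mb ib'] := ib.
pose b' := stepVD 0 \o b; pose P' := stepV (fun=> 0) \o P.
pose I := \int[mu]_y l1norm (b y).
have I0 : 0 <= I by apply: Rintegral_ge0 => y _; exact: l1norm_ge0.
have ib1 : integrable_field mu b'.
  apply: (dominated_integrable_field (C := 1) ib); first exact: measurable_stepVD0.
  by move=> y; rewrite mul1r /b' /= l1norm_stepVD0.
have mP' : measurable_fun setT P'.
  apply: measurableT_comp mP; apply: measurable_stepV; exact: measurable_cst.
have wk' x : weighted s (rho ^+ k * M0)
    (cross_grad (F \o iter k (stepV (t 0%N))) (G \o iter k (stepV (t 0%N))) x).
  elim: k {IH wk E} => [|k IH] in x *; first by rewrite expr0 mul1r; exact: w0.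
  have E H : H \o iter k.+1 (stepV (t 0%N)) =
      (H \o iter k (stepV (t 0%N))) \o stepV (t 0%N).
    by apply/funext => y; rewrite /= -iterSr.
  rewrite !E cross_grad_stepV//; try exact: torus_fun_iter_stepV.
  by rewrite exprS -mulrA; apply: weighted_stepD.
have := IH wk' b' P' ib1 mP' (closed_pair_stepVD0 cbP).
set Fk := F \o iter k _; set Gk := G \o iter k _.
have tFk : torus_fun Fk by exact: torus_fun_iter_stepV.
have tGk : torus_fun Gk by exact: torus_fun_iter_stepV.
rewrite !E -/Fk -/Gk.
have -> : \int[mu]_y l1norm (b' y) = I.
  by apply: eq_Rintegral => y _; rewrite /b' /= l1norm_stepVD0.
rewrite (pairing_stepVD0 _ _ _ tGk).
move=> h1.
pose Mc := s ^+ 2 * (rho ^+ k * M0).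
have c2 x : `|partial (inord 0) Fk x * partial (inord 1) Gk x -
    partial (inord 1) Fk x * partial (inord 0) Gk x| <= Mc.
  by have [_ _] := wk' x.
have c1 x : `|partial (inord 0) Fk x * partial (inord 2) Gk x -
    partial (inord 2) Fk x * partial (inord 0) Gk x| <= Mc.
  rewrite distrC; have [_ + _] := wk' x; move=> /le_trans; apply.
  by rewrite ler_wpM2r ?mulr_ge0 ?exprn_ge0// expr2 ler_peMl// ltW.
have h2 := pairing_stepV_homotopy t_ tM ib mP cbP tFk tGk c2 c1.
rewrite -/I in h2.
have h3 : Ma * Mc * I <= C1 * rho ^+ k * I.
  rewrite ler_wpM2r// /C1 /Mc (mulrC (rho ^+ k)) !mulrA ler_wpM2r ?exprn_ge0//.
  by rewrite !(ler_wpM2r, exprn_ge0, ler_norm)// ltW.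
(* Since [2 <= rho], the accumulated cost and the new one, each at most [C1 * rho ^+ k * I], fit
   together into [C1 * rho ^+ k.+1 * I]. *)
have h4 : (N * N' + C1 * rho ^+ k) * I + C1 * rho ^+ k * I <= (N * N' + C1 * rho ^+ k.+1) * I.
  rewrite -mulrDl ler_wpM2r// -addrA lerD2l exprS mulrCA -mulr2n -mulr_natl.
  by rewrite ler_wpM2r// mulr_ge0// exprn_ge0.
apply: le_trans h4; rewrite -[X in `|X|](subrK (pairing mu b P (Fk \o stepV (fun=> 0))
  (Gk \o stepV (fun=> 0)))) addrC.
by rewrite (le_trans (ler_normD _ _))// lerD// (le_trans h2).
Qed.

End flux.

(** * Transport of a field along an orbit *)

Section pushforward.
Variable R : realType.
Variable mu : {measure set (R3 R) -> \bar R}.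
Implicit Types (x v X : R3 R) (B P : R3 R -> R3 R) (F G : R3 R -> R) (a : R -> R).

(* The image of [B x] under the differential of [iter k (step a)] at [x], where
   [a'] stands for the derivative of [a]. *)
Fixpoint pushfield a (a' : R -> R) B (k : nat) (x : R3 R) : R3 R :=
  if k is k'.+1 then stepD (a' (iter k' (step a) x).1.2) (pushfield a a' B k' x)
  else B x.

Lemma measurable_iter_step a k : measurable_fun setT a ->
  measurable_fun setT (iter k (step a)).
Proof.
move=> ma; elim: k => [|k IH]; first exact: measurable_id.
exact: (measurableT_comp (measurable_step ma) IH).
Qed.

Lemma measurable_pushfield a a' B k : measurable_fun setT a ->
  measurable_fun setT a' -> measurable_fun setT B ->
  measurable_fun setT (pushfield a a' B k).
Proof.
move=> ma ma' mB; elim: k => [//|k IH]; apply: measurable_pair3.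
- exact: (measurable_coordT 1 IH).
- exact: (measurable_coordT 2 IH).
- apply: measurable_funD; first exact: (measurable_coordT 0 IH).
  apply: measurable_funM; first exact: (measurable_coordT 1 IH).
  exact: (measurableT_comp ma' (measurable_coordT 1 (measurable_iter_step k ma))).
Qed.

Lemma l1norm_stepD (d C : R) v : `|d| <= C ->
  l1norm (stepD d v) <= (1 + C) * l1norm v.
Proof.
move=> dC; rewrite /l1norm /stepD /=.
have h : `|v.1.1 + v.1.2 * d| <= `|v.1.1| + C * `|v.1.2|.
  by rewrite (le_trans (ler_normD _ _))// lerD// normrM mulrC ler_wpM2r.
have C0 : 0 <= C := le_trans (normr_ge0 _) dC.
have := mulr_ge0 C0 (normr_ge0 v.1.1); have := mulr_ge0 C0 (normr_ge0 v.2).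
move: h; move: `|v.1.1 + _| `|v.1.1| `|v.1.2| `|v.2| => *.
rewrite mulrDl mul1r !mulrDr; lra.
Qed.

Lemma l1norm_pushfield a a' B k (C : R) x : (forall s, `|a' s| <= C) ->
  l1norm (pushfield a a' B k x) <= (1 + C) ^+ k * l1norm (B x).
Proof.
move=> a'C; have C0 : 0 <= C := le_trans (normr_ge0 _) (a'C 0).
elim: k => [|k IH]; first by rewrite mul1r.
rewrite /= (le_trans (l1norm_stepD _ (a'C _)))// exprS -mulrA ler_wpM2l//.
by rewrite addr_ge0.
Qed.

Lemma integrable_pushfield a a' B k (C : R) : (forall s, `|a' s| <= C) ->
  measurable_fun setT a -> measurable_fun setT a' -> integrable_field mu B ->
  integrable_field mu (pushfield a a' B k).
Proof.
move=> a'C ma ma' iB; apply: (dominated_integrable_field (C := (1 + C) ^+ k) iB).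
  by have [mB _] := iB; exact: measurable_pushfield.
by move=> x; exact: l1norm_pushfield.
Qed.

Lemma dot3_grad_step t F v x : tower t -> torus_fun F ->
  dot3 (stepD (t 1%N x.1.2) v) (grad F (step (t 0%N) x)) =
  dot3 v (grad (F \o step (t 0%N)) x).
Proof.
move=> t_ tF; have [td _] := t_.
exact: (dot3_grad_comp v (step_is_diff (td 0%N x.1.2)) tF (torus_fun_step t_ tF)).
Qed.

Lemma closed_pair_pushfield t B k : tower t -> closed_pair mu B id ->
  closed_pair mu (pushfield (t 0%N) (t 1%N) B k) (iter k (step (t 0%N))).
Proof.
move=> t_ cB; elim: k => [//|k IH] psi tpsi.
rewrite -[RHS](IH _ (torus_fun_step t_ tpsi)).
by apply: eq_Rintegral => x _; exact: dot3_grad_step.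
Qed.

(** Pull-back of one-forms is dual to push-forward of vectors, so the two integrands agree
    pointwise. *)
Lemma pairing_pushfield t B k F G : tower t -> torus_fun G ->
  pairing mu (pushfield (t 0%N) (t 1%N) B k) (iter k (step (t 0%N)))
    (F \o iter k (stepV (t 0%N))) (G \o iter k (stepV (t 0%N))) =
  pairing mu B id F G.
Proof.
move=> t_; elim: k F G => [//|k IH] F G tG; rewrite -(IH F G tG).
apply: eq_Rintegral => x _.
have E (H : R3 R -> R) : (H \o iter k.+1 (stepV (t 0%N))) \o step (t 0%N) =
    H \o iter k (stepV (t 0%N)).
  by apply/funext => y; rewrite /= -iterS iterSr /= stepK.
rewrite [pushfield _ _ _ _ _]/= [iter k.+1 (step _) _]/= dot3_grad_step//.
  rewrite E; congr (_ * _).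
  by have /(congr1 (fun f => f (iter k (step (t 0%N)) x))) := E F.
exact: torus_fun_iter_stepV.
Qed.

(** The constant is chosen before the tower, the number of steps and the field. This uniformity
    permits the passage to the piecewise linear shear. *)
Lemma flux_le (s Ma : R) F G : 2 <= s -> torus_fun F -> torus_fun G ->
  exists2 C, 0 <= C & forall t, tower t -> (forall u, `|t 0%N u| <= Ma) ->
    (forall u, `|t 1%N u| <= s ^+ 2) ->
    forall k B, integrable_field mu B -> closed_pair mu B id ->
      `|\int[mu]_x (F x * dot3 (B x) (grad G x))|
        <= C * (s + s ^- 2) ^+ k *
           \int[mu]_x l1norm (pushfield (t 0%N) (t 1%N) B k x).
Proof.
move=> s2 tF tG; have [C C0 CP] := pairing_iter_stepV mu Ma s2 tF tG.
exists C => // t t_ tM tM1 k B iB cB.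
have mt j : measurable_fun setT (t j).
  by apply: continuous_measurable_fun; exact: tower_continuous.
have := CP t t_ tM tM1 k _ _ (integrable_pushfield k tM1 (mt 0%N) (mt 1%N) iB)
  (measurable_iter_step k (mt 0%N)) (closed_pair_pushfield k t_ cB).
by rewrite pairing_pushfield.
Qed.

End pushforward.

(** * Smooth approximations of the hat function *)

Section hat_approximation.
Variable R : realType.
Implicit Types (q s : R).

(* For [q = 1] this is [hat]; for [q < 1] it is smooth. *)
Definition soft_hat q s := pi / 2 + asin (q * cos s).
Definition soft_hatD q s := - (q * sin s) / Num.sqrt (1 - (q * cos s) ^+ 2).

Lemma cos_periodic s : cos (s + 2 * pi) = cos s.
Proof. by rewrite -[in RHS](cosD2pi s) mulr_natl. Qed.

Lemma sin_periodic s : sin (s + 2 * pi) = sin s.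
Proof. by rewrite -[in RHS](sinD2pi s) mulr_natl. Qed.

Lemma sqr_lt1P (u : R) : u ^+ 2 < 1 -> -1 < u < 1.
Proof. by move=> u1; rewrite -ltr_norml -(@expr_lt1 _ 2)// real_normK ?num_real. Qed.

Lemma soft_hat_derive q s : (q * cos s) ^+ 2 < 1 ->
  is_derive s (1 : R) (soft_hat q) (soft_hatD q s).
Proof.
move=> u1.
have dc : is_derive s (1 : R) (fun s => q * cos s) (- (q * sin s)).
  have := is_deriveM (is_derive_cst q s (1 : R)) (is_derive_cos s).
  by move=> /is_derive_eq; apply; rewrite scaler0 addr0 /GRing.scale/= mulrN.
have := is_deriveD (is_derive_cst (pi / 2 : R) s (1 : R))
  (@is_derive1_comp R asin (fun s => q * cos s) s _ _
    (is_derive1_asin (sqr_lt1P u1)) dc).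
by move=> /is_derive_eq; apply; rewrite add0r mulrC.
Qed.

Lemma qcos_lt1 q s : 0 < q < 1 -> (q * cos s) ^+ 2 < 1.
Proof.
move=> /andP[q0 q1]; rewrite exprMn.
have c1 : cos s ^+ 2 <= 1 by rewrite -(cos2Dsin2 s) lerDl sqr_ge0.
rewrite (le_lt_trans (_ : _ <= q ^+ 2 * 1))// ?ler_wpM2l ?sqr_ge0// mulr1.
by rewrite expr_lt1// ltW.
Qed.

(* An algebra closed under derivation that contains the derivative of [soft_hat q]. *)
Inductive soft_alg q : (R -> R) -> Prop :=
| soft_alg_cst c : soft_alg q (fun=> c)
| soft_alg_sin : soft_alg q (@sin R)
| soft_alg_cos : soft_alg q (@cos R)
| soft_alg_inv : soft_alg q (fun s => (Num.sqrt (1 - (q * cos s) ^+ 2))^-1)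
| soft_algD f g : soft_alg q f -> soft_alg q g -> soft_alg q (fun s => f s + g s)
| soft_algM f g : soft_alg q f -> soft_alg q g -> soft_alg q (fun s => f s * g s).

Lemma soft_alg_derive q f : 0 < q < 1 -> soft_alg q f ->
  exists2 g, soft_alg q g & forall s, is_derive s (1 : R) f (g s).
Proof.
move=> q01; elim=> {f} [c||||f g _ [f' af' df] _ [g' ag' dg]|
  f g af [f' af' df] ag [g' ag' dg]].
- by exists (fun=> 0) => [|s]; [exact: soft_alg_cst|exact: is_derive_cst].
- by exists (@cos R) => [|s]; [exact: soft_alg_cos|exact: is_derive_sin].
- exists (fun s => -1 * sin s) => [|s]; last by rewrite mulN1r; exact: is_derive_cos.
  by apply: soft_algM; [exact: soft_alg_cst|exact: soft_alg_sin].
- set w := fun s => _.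
  have aw : soft_alg q w by exact: soft_alg_inv.
  exists (fun s => - q ^+ 2 * (cos s * sin s) * (w s * (w s * w s))) => [|s].
    apply: soft_algM; last by do 2 apply: soft_algM => //.
    apply: soft_algM; first exact: soft_alg_cst.
    by apply: soft_algM; [exact: soft_alg_cos|exact: soft_alg_sin].
  have u1 := qcos_lt1 s q01.
  have dc : is_derive s (1 : R) (fun s => q * cos s) (- (q * sin s)).
    have := is_deriveM (is_derive_cst q s (1 : R)) (is_derive_cos s).
    by move=> /is_derive_eq; apply; rewrite scaler0 addr0 /GRing.scale/= mulrN.
  have v0 : 0 < 1 - (q * cos s) ^+ 2 by rewrite subr_gt0.
  have dv : is_derive s (1 : R) (fun s => 1 - (q * cos s) ^+ 2)
      (2 * (q * cos s) * (q * sin s)).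
    have := is_deriveB (is_derive_cst (1 : R) s (1 : R)) (is_deriveM dc dc).
    move=> /is_derive_eq; apply.
    by rewrite /GRing.scale/=; ring.
  have sv0 : Num.sqrt (1 - (q * cos s) ^+ 2) != 0 by rewrite gt_eqF// sqrtr_gt0.
  have dsv := @is_derive1_comp R Num.sqrt (fun s => 1 - (q * cos s) ^+ 2) s _ _
    (is_derive1_sqrt v0) dv.
  have := @is_deriveV R (Num.sqrt \o (fun s => 1 - (q * cos s) ^+ 2)) s _ 1 sv0 dsv.
  move=> /is_derive_eq; apply; rewrite /w /GRing.scale/=.
  by field.
- by exists (fun s => f' s + g' s) => [|s]; [exact: soft_algD|exact: is_deriveD].
- exists (fun s => f s * g' s + g s * f' s) => [|s]; last exact: is_deriveM.
  by apply: soft_algD; exact: soft_algM.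
Qed.

Lemma soft_alg_periodic q f : soft_alg q f -> forall s, f (s + 2 * pi) = f s.
Proof.
elim=> {f} [c||||f g _ fp _ gp|f g _ fp _ gp] s //.
- exact: sin_periodic.
- exact: cos_periodic.
- by rewrite cos_periodic.
- by rewrite fp gp.
- by rewrite fp gp.
Qed.

(** Choice turns closure of [soft_alg] under derivation into an operator [D]; its iterates on
    [soft_hatD q] list the higher derivatives. *)
Lemma soft_hat_tower q : 0 < q < 1 -> exists t, [/\ tower t,
  t 0%N = soft_hat q & t 1%N = soft_hatD q].
Proof.
move=> q01; pose Q := {f : R -> R | soft_alg q f}.
have a1 : soft_alg q (soft_hatD q).
  rewrite (_ : soft_hatD q = fun s => -q * sin s * (Num.sqrt (1 - (q * cos s) ^+ 2))^-1).
    apply: soft_algM; last exact: soft_alg_inv.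
    by apply: soft_algM; [exact: soft_alg_cst|exact: soft_alg_sin].
  by apply/funext => s; rewrite /soft_hatD !mulNr.
have /choice[D DP] : forall f : Q, exists g : Q,
    forall s : R, is_derive s (1 : R) (sval f) (sval g s).
  by move=> [f af]; have [g ag fg] := soft_alg_derive q01 af; exists (exist _ g ag).
pose f1 : Q := exist _ (soft_hatD q) a1.
exists (fun k => if k is k'.+1 then sval (iter k' D f1) else soft_hat q).
split=> //; split=> [[|k] s|[|k] s].
- exact/soft_hat_derive/qcos_lt1.
- exact: DP.
- by rewrite /soft_hat cos_periodic.
- exact: (soft_alg_periodic (svalP (iter k D f1))).
Qed.

End hat_approximation.

Section hat_limit.
Variable R : realType.
Implicit Types (q s : R) (x : R3 R).

Lemma hat_soft s : hat s = soft_hat 1 s.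
Proof.
rewrite /hat /soft_hat mul1r; have /andP[] := floor_period_itv s.
set n := Num.floor _; set r := s - _ => r0 r2.
have -> : cos s = cos r.
  rewrite /r -(periodic_intZ (@cos_periodic R) n (s - _)) subrK//.
have p0 := pi_gt0 R; have [rp|rp] := leP r pi.
  have -> : cos r = sin (- r + pi / 2) by rewrite sinDpihalf cosN.
  rewrite sinK; last by rewrite in_itv/=; apply/andP; split; lra.
  by rewrite ler0_norm; lra.
have -> : cos r = sin (r - 2 * pi + pi / 2).
  by rewrite sinDpihalf -[in RHS]cos_periodic subrK.
rewrite sinK; last by rewrite in_itv/=; apply/andP; split; lra.
by rewrite ger0_norm; lra.
Qed.

(** [hat s] is pi minus the distance from [s] to the multiples of 2 pi. With [hat_eq] this presents
    it as a maximum of tents of slope 1, so that it is 1-Lipschitz. *)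
Lemma hat_ge s (m : int) : pi - `|s - m%:~R * (2 * pi)| <= hat s.
Proof.
rewrite /hat; have /andP[] := floor_period_itv s.
set n := Num.floor _; set r := s - _ => r0 r2; have p0 := pi_gt0 R.
have -> : s - m%:~R * (2 * pi) = r - (m - n)%:~R * (2 * pi).
  by rewrite /r rmorphB/=; ring.
have [j0|j0] := leP (m - n) 0.
  have : (m - n)%:~R * (2 * pi) <= 0 :> R.
    by rewrite mulr_le0_ge0 ?lerz0// mulr_ge0// ltW.
  set u := _ * (2 * pi); move=> u0.
  have := ler_norm (r - u); have := ler_normr (pi - r) (r - pi); rewrite distrC => h1 h2.
  have : pi - r <= `|pi - r| by exact: ler_norm.
  by rewrite (distrC pi r); lra.
have : 2 * pi <= (m - n)%:~R * (2 * pi) :> R.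
  by rewrite ler_peMl ?(ltW (twopi_gt0 R))// ler1z -gtz0_ge1.
set u := (m - n)%:~R * _; move=> u0.
have := ler_norm (u - r); rewrite distrC => h1.
have := ler_norm (r - pi); lra.
Qed.

Lemma hat_eq s : exists m : int, hat s = pi - `|s - m%:~R * (2 * pi)|.
Proof.
rewrite /hat; have /andP[] := floor_period_itv s.
set n := Num.floor _; set r := s - _ => r0 r2; have p0 := pi_gt0 R.
have [rp|rp] := leP r pi.
  by exists n; rewrite -/r (ger0_norm r0) ler0_norm; lra.
exists (n + 1); have -> : s - (n + 1)%:~R * (2 * pi) = r - 2 * pi.
  by rewrite /r rmorphD/=; ring.
by rewrite ger0_norm ?(ler0_norm (_ : r - 2 * pi <= 0)); lra.
Qed.

Lemma hat_lipschitz s s' : `|hat s - hat s'| <= `|s - s'|.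
Proof.
suff h (u v : R) : hat u - hat v <= `|u - v|.
  by rewrite ler_norml lerNl opprB h distrC h.
have [m ->] := hat_eq u; have := hat_ge v m.
have := ler_distD (u - m%:~R * (2 * pi)) (v - m%:~R * (2 * pi)) 0.
rewrite !subr0 opprB addrA subrK (distrC v u) => h1 h2.
by lra.
Qed.

Lemma hat_continuous : continuous (@hat R).
Proof.
move=> s; apply/cvgrPdist_le => e e0; near=> u.
rewrite (le_trans (hat_lipschitz _ _))//.
Unshelve. all: by end_near. Qed.

Lemma soft_hat_norm q s : 0 <= q <= 1 -> `|soft_hat q s| <= pi.
Proof.
move=> /andP[q0 q1].
have c1 : -1 <= q * cos s <= 1.
  rewrite -ler_norml normrM ger0_norm// mulr_ile1//.
  by rewrite ler_norml cos_geN1 cos_le1.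
have := asin_geNpi2 c1; have := asin_lepi2 c1; have p0 := pi_gt0 R.
by rewrite /soft_hat => h1 h2; rewrite ger0_norm; lra.
Qed.

Lemma soft_hatD_norm q s : 0 <= q <= 1 -> `|soft_hatD q s| <= 1.
Proof.
move=> /andP[q0 q1]; rewrite /soft_hatD mulNr normrN normrM normfV.
rewrite [X in _ / X]ger0_norm ?sqrtr_ge0//.
(* A kink, possible only for [q = 1]: the quotient by zero is 0, so the bound persists there. *)
have [u0|u0] := leP (1 - (q * cos s) ^+ 2) 0; first by rewrite ler0_sqrtr// invr0 mulr0.
rewrite ler_pdivrMr ?sqrtr_gt0// mul1r -sqrtr_sqr ler_sqrt ?(ltW u0)//.
rewrite -subr_ge0 !exprMn sin2cos2.
have -> : 1 - q ^+ 2 * cos s ^+ 2 - q ^+ 2 * (1 - cos s ^+ 2) = 1 - q ^+ 2 by ring.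
by rewrite subr_ge0 expr_le1.
Qed.

Lemma sin_neq0_cos2 s : sin s != 0 -> (1 * cos s) ^+ 2 < 1.
Proof.
move=> s0; rewrite mul1r -(cos2Dsin2 s) ltrDl lt0r sqr_ge0 andbT.
by rewrite expf_neq0.
Qed.

(** The point varies together with the parameter because the orbits of the smoothed steps also
    depend on [q]. *)
Lemma soft_hat_cvg (qn sn : R^nat) s : sin s != 0 ->
  qn @ \oo --> (1 : R) -> sn @ \oo --> s ->
  soft_hat (qn n) (sn n) @[n --> \oo] --> soft_hat 1 s.
Proof.
move=> s0 qn1 sns.
have u1 := sin_neq0_cos2 s0.
have cu : qn n * cos (sn n) @[n --> \oo] --> 1 * cos s.
  by apply: cvgM => //; apply: continuous_cvg => //; exact: continuous_cos.
apply: cvgD; first exact: cvg_cst.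
by apply: continuous_cvg cu; apply: continuous_asin; exact: sqr_lt1P.
Qed.

Lemma soft_hatD_cvg (qn sn : R^nat) s : sin s != 0 ->
  qn @ \oo --> (1 : R) -> sn @ \oo --> s ->
  soft_hatD (qn n) (sn n) @[n --> \oo] --> soft_hatD 1 s.
Proof.
move=> s0 qn1 sns.
have u1 := sin_neq0_cos2 s0.
have cu : qn n * cos (sn n) @[n --> \oo] --> 1 * cos s.
  by apply: cvgM => //; apply: continuous_cvg => //; exact: continuous_cos.
have cs : qn n * sin (sn n) @[n --> \oo] --> 1 * sin s.
  by apply: cvgM => //; apply: continuous_cvg => //; exact: continuous_sin.
apply: cvgM; first exact: cvgN.
apply: cvgV; first by rewrite gt_eqF// sqrtr_gt0 subr_gt0.
apply: continuous_cvg; first exact: sqrt_continuous.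
by apply: cvgB; [exact: cvg_cst|exact: cvgM].
Qed.

End hat_limit.

(** * The flux estimate for the piecewise linear shear *)

Section flux_limit.
Variable R : realType.
Variable mu : {measure set (R3 R) -> \bar R}.
Implicit Types (x v : R3 R) (B : R3 R -> R3 R) (F G : R3 R -> R) (a : R).

Definition hatD : R -> R := soft_hatD 1.

Definition cat_step a : R3 R -> R3 R := step (fun u => a * hat u).
Definition cat_push a := pushfield (fun u => a * hat u) (fun u => a * hatD u).

(* [hat] is differentiable exactly where [sin] does not vanish. *)
Definition regular a x := forall k, sin (iter k (cat_step a) x).1.2 != 0.

Definition soft_param (n : nat) : R := 1 - n.+2%:R^-1.
Notation q := soft_param.

Lemma soft_param01 n : 0 < q n < 1.
Proof.
rewrite /soft_param subr_gt0 invf_lt1 ?ltr1n//= ?ltr0n// ltrBlDr ltrDl invr_gt0.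
Qed.

Lemma soft_param_cvg : q @ \oo --> (1 : R).
Proof.
rewrite -[X in _ --> X]subr0; apply: cvgB; first exact: cvg_cst.
by have := @cvg_harmonic R; rewrite -cvg_shiftS.
Qed.

Definition coordwise_cvg (u : nat -> R3 R) x :=
  [/\ (u n).1.1 @[n --> \oo] --> (x.1.1 : R), (u n).1.2 @[n --> \oo] --> (x.1.2 : R) &
      (u n).2 @[n --> \oo] --> (x.2 : R)].

Lemma soft_orbit_cvg a x k : regular a x ->
  coordwise_cvg (fun n => iter k (step (fun u => a * soft_hat (q n) u)) x)
    (iter k (cat_step a) x).
Proof.
move=> rx; elim: k => [|k [c0 c1 c2]]; first by split; exact: cvg_cst.
split => //=; apply: cvgD => //; apply: cvgM; first exact: cvg_cst.
by rewrite hat_soft; exact: (soft_hat_cvg _ soft_param_cvg).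
Qed.

Lemma soft_push_cvg a B x k : regular a x ->
  coordwise_cvg (fun n => pushfield (fun u => a * soft_hat (q n) u)
    (fun u => a * soft_hatD (q n) u) B k x) (cat_push a B k x).
Proof.
move=> rx; elim: k => [|k [c0 c1 c2]]; first by split; exact: cvg_cst.
split => //=; apply: cvgD => //; apply: cvgM => //; apply: cvgM; first exact: cvg_cst.
by have [_ d1 _] := soft_orbit_cvg k rx; exact: (soft_hatD_cvg _ soft_param_cvg).
Qed.

Lemma measurable_soft_hat r : 0 < r < 1 -> measurable_fun setT (soft_hat r : R -> R).
Proof.
move=> r01; apply: continuous_measurable_fun => u.
apply/differentiable_continuous/derivable1_diffP.
by have [] := soft_hat_derive (qcos_lt1 u r01).
Qed.

Lemma measurable_hat : measurable_fun setT (@hat R).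
Proof. by apply: continuous_measurable_fun; exact: hat_continuous. Qed.

Lemma measurable_soft_hatD r : measurable_fun setT (soft_hatD r : R -> R).
Proof.
have mc : measurable_fun setT (fun u : R => r * cos u).
  apply: measurable_funM => //.
  by apply: continuous_measurable_fun; exact: continuous_cos.
apply: measurable_funM.
  apply: measurable_funN; apply: measurable_funM => //.
  by apply: continuous_measurable_fun; exact: continuous_sin.
pose v (u : R) := Num.sqrt (1 - (r * cos u) ^+ 2).
rewrite (_ : (fun u => _) = fun u => powR (v u) (-1)); last first.
  by apply/funext => u; rewrite powR_inv1// sqrtr_ge0.
apply: (@measurableT_comp _ _ _ _ _ _ (fun u : R => powR u (-1)) _ v) => //.
apply: (@measurableT_comp _ _ _ _ _ _ (@Num.sqrt R)).
  by apply: continuous_measurable_fun; exact: sqrt_continuous.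
by apply: measurable_funB => //; exact: measurable_funX.
Qed.

(** Dominated convergence in [flux_le]: at regular points the smoothed push-forwards converge, and
    slopes bounded by [s ^+ 2] give the common majorant [(1 + s ^+ 2) ^+ k * l1norm (B x)]. *)
Lemma cat_flux_le (s : R) F G : 2 <= s -> torus_fun F -> torus_fun G ->
  exists2 C, 0 <= C & forall k B, integrable_field mu B -> closed_pair mu B id ->
    {ae mu, forall x, regular (s ^+ 2) x} ->
      `|\int[mu]_x (F x * dot3 (B x) (grad G x))|
        <= C * (s + s ^- 2) ^+ k * \int[mu]_x l1norm (cat_push (s ^+ 2) B k x).
Proof.
move=> s2 tF tG; have [C C0 CP] := flux_le mu (s ^+ 2 * pi) s2 tF tG.
exists C => // k B iB cB reg.
have a0 : 0 <= s ^+ 2 by exact: sqr_ge0.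
have q1 n : 0 <= q n <= 1 by have /andP[u v] := soft_param01 n; rewrite (ltW u) (ltW v).
pose Bn n := pushfield (fun u => s ^+ 2 * soft_hat (q n) u)
    (fun u => s ^+ 2 * soft_hatD (q n) u) B k.
have bn n : `|\int[mu]_x (F x * dot3 (B x) (grad G x))|
        <= C * (s + s ^- 2) ^+ k * \int[mu]_x l1norm (Bn n x).
  have [t [t_ t0 t1]] := soft_hat_tower (soft_param01 n).
  have := CP _ (tower_scale (s ^+ 2) t_) _ _ k B iB cB; rewrite t0 t1; apply => u.
    by rewrite normrM ger0_norm// ler_wpM2l// soft_hat_norm.
  by rewrite normrM ger0_norm// -[leRHS]mulr1 ler_wpM2l// soft_hatD_norm.
have b'n n u : `|s ^+ 2 * soft_hatD (q n) u| <= s ^+ 2.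
  by rewrite normrM ger0_norm// -[leRHS]mulr1 ler_wpM2l// soft_hatD_norm.
have [mB iB'] := iB.
have mBn n : measurable_fun setT (fun x => l1norm (Bn n x)).
  apply: measurable_l1norm; apply: measurable_pushfield => //.
    by apply: measurable_funM => //; exact: (measurable_soft_hat (soft_param01 n)).
  by apply: measurable_funM => //; exact: measurable_soft_hatD.
have mBl : measurable_fun setT (fun x => l1norm (cat_push (s ^+ 2) B k x)).
  apply: measurable_l1norm; apply: measurable_pushfield => //.
    by apply: measurable_funM => //; exact: measurable_hat.
  by apply: measurable_funM => //; exact: measurable_soft_hatD.
have [il _ lim] : [/\ mu.-integrable setT (EFin \o (fun x => l1norm (cat_push (s ^+ 2) B k x))),
    [sequence \int[mu]_x `|(l1norm (Bn n x))%:E - (l1norm (cat_push (s ^+ 2) B k x))%:E|]_n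
       @ \oo --> 0 &
    [sequence \int[mu]_x (l1norm (Bn n x))%:E]_n @ \oo -->
      \int[mu]_x (l1norm (cat_push (s ^+ 2) B k x))%:E]%E.
  apply: (@dominated_convergence _ _ _ mu setT measurableT
    (fun n x => (l1norm (Bn n x))%:E) _
    (EFin \o (fun x => (1 + s ^+ 2) ^+ k * l1norm (B x)))).
  - by move=> n; exact/measurable_EFinP.
  - exact/measurable_EFinP.
  - apply: filterS reg => x rx _; apply: cvg_EFin; first exact: nearW.
    have [c0 c1 c2] := soft_push_cvg B k rx.
    by apply: cvgD; [apply: cvgD|]; exact: cvg_norm.
  - exact: (integrableZl measurableT ((1 + s ^+ 2) ^+ k) iB').
  - apply: aeW => x n _ /=; rewrite lee_fin ger0_norm ?l1norm_ge0//.
    exact: l1norm_pushfield.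
have lim' : \int[mu]_x l1norm (Bn n x) @[n --> \oo] -->
    \int[mu]_x l1norm (cat_push (s ^+ 2) B k x).
  apply: fine_cvg; rewrite fineK//.
  by apply: integrable_fin_num.
have lim'' : C * (s + s ^- 2) ^+ k * \int[mu]_x l1norm (Bn n x) @[n --> \oo] -->
    C * (s + s ^- 2) ^+ k * \int[mu]_x l1norm (cat_push (s ^+ 2) B k x).
  by apply: cvgM lim'; exact: cvg_cst.
rewrite -(cvg_lim _ lim'')//; apply: limr_ge; first by apply/cvg_ex; eexists; exact: lim''.
exact: nearW.
Qed.

End flux_limit.

(** * Fields without fluxes vanish *)

Section vanishing.
Variable R : realType.
Implicit Types (s c : R) (x : R3 R) (F G : R3 R -> R).
Notation mu := (@torus_measure R).

Lemma floor_mul_itv c s : 0 < c -> 0 <= s - (Num.floor (s / c))%:~R * c < c.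
Proof.
move=> c0; have := floor_le_tmp (s / c); have := floorD1_gt (s / c).
rewrite ltr_pdivrMr// ler_pdivlMr// intrD mulrDl mul1r => h1 h2.
by rewrite subr_ge0 h2 ltrBlDl.
Qed.

Lemma sin_eq0_mulpi s : sin s = 0 -> exists n : int, s = n%:~R * pi.
Proof.
move=> s0; have /andP[] := floor_mul_itv s (pi_gt0 R).
set n := Num.floor _ => r0 rpi; exists n; apply/eqP; rewrite -subr_eq0.
move: r0; rewrite le_eqVlt => /predU1P[<-//|r0].
have sp (u : R) : sin (u + pi) ^+ 2 = sin u ^+ 2 by rewrite sinDpi sqrrN.
have := periodic_intZ sp n (s - n%:~R * pi); rewrite subrK s0 expr0n/= => /esym/eqP.
by rewrite sqrf_eq0 gt_eqF// sin_gt0_pi// r0.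
Qed.

Lemma sin_zeros_countable c : countable [set s | sin (s - c) = 0].
Proof.
have h : [set s | sin (s - c) = 0] `<=` range (fun n : int => n%:~R * pi + c).
  by move=> s /= /sin_eq0_mulpi[n sn]; exists n => //; rewrite -sn subrK.
exact: (sub_countable (subset_card_le h) (sub_countable (card_image_le _ _) (countableP _))).
Qed.

Lemma measurable_sin_zeros c : measurable [set s : measurableTypeR R | sin (s - c) = 0].
Proof. exact: countable_measurable (sin_zeros_countable c). Qed.

Lemma volume3E (A1 A2 A3 : set (measurableTypeR R)) :
  measurable A1 -> measurable A2 -> measurable A3 ->
  (((@lebesgue_measure R \x @lebesgue_measure R) \x @lebesgue_measure R)
     ((A1 `*` A2) `*` A3) =
   (@lebesgue_measure R A1 * @lebesgue_measure R A2) * @lebesgue_measure R A3)%E.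
Proof.
move=> m1 m2 m3.
transitivity ((@lebesgue_measure R \x @lebesgue_measure R) (A1 `*` A2) *
    @lebesgue_measure R A3)%E.
  by apply: product_measure1E => //; exact: measurableX.
by congr (_ * _)%E; exact: product_measure1E.
Qed.

Lemma coord_null j (Z : set (measurableTypeR R)) : measurable Z ->
  (@lebesgue_measure R Z = 0)%E -> mu [set x | Z (coord j x)] = 0%E.
Proof.
move=> mZ Z0.
have mA : measurable [set x : R3 R | Z (coord j x)].
  by rewrite -[X in measurable X]setTI; exact: (measurable_coord j).
pose m := ((@lebesgue_measure R \x @lebesgue_measure R) \x @lebesgue_measure R)%E.
set A := [set x : R3 R | Z (coord j x)] in mA *.
have mAC := measurableI _ _ mA (@measurable_cube R).
have leA : (m (A `&` @cube R) <= m A)%E.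
  exact: (le_measure m (mem_set mAC) (mem_set mA) (@subIsetl _ _ _)).
suff A0 : m A = 0%E.
  by apply/eqP; rewrite eq_le measure_ge0 andbT -A0.
have mT : measurable [set: measurableTypeR R] by exact: measurableT.
rewrite /A /coord; case: (j == 0%N); last case: (j == 1%N).
- rewrite (_ : [set x | _] = (Z `*` setT) `*` setT); last first.
    by apply/seteqP; split=> x /=; tauto.
  by rewrite /m volume3E// Z0 !mul0e.
- rewrite (_ : [set x | _] = (setT `*` Z) `*` setT); last first.
    by apply/seteqP; split=> x /=; tauto.
  by rewrite /m volume3E// Z0 mule0 mul0e.
- rewrite (_ : [set x | _] = (setT `*` setT) `*` Z); last first.
    by apply/seteqP; split=> x /=; tauto.
  by rewrite /m volume3E// Z0 mule0.
Qed.

Lemma sin_coord_neq0_ae j c : {ae mu, forall x, sin (coord j x - c) != 0}.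
Proof.
exists [set x | [set s : measurableTypeR R | sin (s - c) = 0] (coord j x)]; split.
- rewrite -[X in measurable X]setTI; apply: (measurable_coord j) => //.
  exact: measurable_sin_zeros.
- apply: coord_null; first exact: measurable_sin_zeros.
  exact/countable_lebesgue_measure0/sin_zeros_countable.
- by move=> x /= /negP; rewrite negbK => /eqP.
Qed.

(** The derivative of the hat is minus the sign of the sine. Hence these functions tend to the
    indicator of the half circle from [c] to [c + pi] in the coordinate [j]. *)
Definition soft_arc n c j x : R :=
  (1 - soft_hatD (soft_param R n) (coord j x - c)) / 2.

Lemma torus_fun_soft_arc n c j : torus_fun (soft_arc n c j).
Proof.
have [t [t_ _ t1]] := soft_hat_tower (soft_param01 R n).
rewrite (_ : soft_arc n c j =
    fun x => (1 + (-1) * t 1%N (coord j x + (fun=> - c) x)) * 2^-1).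
  apply: torus_funM; last exact: torus_fun_cst.
  apply: torus_funD; first exact: torus_fun_cst.
  apply: torus_funM; first exact: torus_fun_cst.
  by apply: (torus_fun_tower j (towerS t_)); exact: torus_fun_cst.
by apply/funext => x; rewrite /soft_arc t1 mulN1r.
Qed.

Lemma soft_arc_itv n c j x : 0 <= soft_arc n c j x <= 1.
Proof.
have q1 : 0 <= soft_param R n <= 1.
  by have /andP[u v] := soft_param01 R n; rewrite (ltW u) (ltW v).
have := soft_hatD_norm (coord j x - c) q1; rewrite ler_norml /soft_arc.
by move=> /andP[h1 h2]; apply/andP; split; lra.
Qed.

Lemma soft_hatD1E s : sin s != 0 -> soft_hatD 1 s = - (sin s / `|sin s|).
Proof.
move=> s0; rewrite /soft_hatD !mul1r mulNr -sqrtr_sqr.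
by congr (- (_ / Num.sqrt _)); rewrite sin2cos2.
Qed.

Lemma soft_arc_cvg c j x : sin (coord j x - c) != 0 ->
  soft_arc n c j x @[n --> \oo] --> (((0 < sin (coord j x - c))%R)%:R : R).
Proof.
move=> s0; have -> : ((0 < sin (coord j x - c))%R)%:R =
    (1 - soft_hatD 1 (coord j x - c)) / 2.
  rewrite soft_hatD1E//; move: s0; rewrite neq_lt => /orP[] s0.
    rewrite ltr0_norm// ltNge (ltW s0)/= invrN mulrN mulfV ?lt_eqF//.
    by rewrite !opprK subrr mul0r.
  by rewrite gtr0_norm// s0 mulfV ?gt_eqF//=; lra.
apply: cvgM; last exact: cvg_cst.
apply: cvgB; first exact: cvg_cst.
apply: (@soft_hatD_cvg R (soft_param R) (fun=> coord j x - c)) => //.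
  exact: soft_param_cvg.
exact: cvg_cst.
Qed.

Lemma sin_lt0_Npi s : - pi < s < 0 -> sin s < 0.
Proof.
move=> /andP[s1 s2]; rewrite -oppr_gt0 -sinN; apply: sin_gt0_pi.
by apply/andP; split; lra.
Qed.

Lemma soft_halfspace b j : exists f : nat -> R3 R -> R,
  [/\ forall n, torus_fun (f n), forall n x, `|f n x| <= 1 &
    forall x, 0 <= coord j x < 2 * pi -> sin (coord j x) != 0 -> sin (coord j x - b) != 0 ->
      f n x @[n --> \oo] --> (((coord j x < b)%R)%:R : R)].
Proof.
have [b0|b0] := leP b 0.
  exists (fun _ _ => 0); split=> [n|n x|x /andP[x0 _] _ _].
  - exact: torus_fun_cst.
  - by rewrite normr0.
  - by rewrite ltNge (le_trans b0 x0)/=; exact: cvg_cst.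
have [b2|b2] := leP (2 * pi) b.
  exists (fun _ _ => 1); split=> [n|n x|x /andP[_ x2] _ _].
  - exact: torus_fun_cst.
  - by rewrite normr1.
  - by rewrite (lt_le_trans x2 b2)/=; exact: cvg_cst.
have arc n c x := soft_arc_itv n c j x.
have one n c x : 0 <= 1 + (-1) * soft_arc n c j x <= 1.
  by have /andP[u v] := arc n c x; apply/andP; split; lra.
have prod (u v : R) : 0 <= u <= 1 -> 0 <= v <= 1 -> 0 <= u * v <= 1.
  by move=> /andP[u0 u1] /andP[v0 v1]; rewrite mulr_ge0//= mulr_ile1.
have nrm (u : R) : 0 <= u <= 1 -> `|u| <= 1 by move=> /andP[u0 u1]; rewrite ger0_norm.
have t1 n c : torus_fun (fun x => 1 + (-1) * soft_arc n c j x).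
  apply: torus_funD; first exact: torus_fun_cst.
  by apply: torus_funM; [exact: torus_fun_cst|exact: torus_fun_soft_arc].
have cvg1 c x : sin (coord j x - c) != 0 ->
    1 + (-1) * soft_arc n c j x @[n --> \oo] --> (1 + (-1) * (0 < sin (coord j x - c))%R%:R : R).
  move=> s0; apply: cvgD; first exact: cvg_cst.
  by apply: cvgM; [exact: cvg_cst|exact: soft_arc_cvg].
have sub0E x : coord j x - 0 = coord j x by rewrite subr0.
have p0 := pi_gt0 R.
have cases x : 0 <= coord j x < 2 * pi -> sin (coord j x) != 0 -> sin (coord j x - b) != 0 ->
   ((coord j x < b) \/ (b < coord j x)) /\
   ((0 < coord j x < pi /\ 0 < sin (coord j x)) \/
    (pi < coord j x < 2 * pi /\ (0 < sin (coord j x)) = false)).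
  move=> /andP[x0 x2] s0 sb; split.
    by apply/orP; rewrite -neq_lt; apply: contraNneq sb => ->; rewrite subrr sin0.
  have [xp|xp|xp] := ltgtP (coord j x) pi; last by rewrite xp sinpi eqxx in s0.
    left; have xp0 : 0 < coord j x.
      by rewrite lt_neqAle x0 andbT; apply: contraNneq s0 => <-; rewrite sin0.
    by split; [rewrite xp0|apply: sin_gt0_pi; rewrite xp0].
  right; split; first by rewrite x2.
  apply/negbTE; rewrite -leNgt ltW// -(subrK (2 * pi) (coord j x)) sin_periodic.
  by apply: sin_lt0_Npi; apply/andP; split; lra.
(* Up to finitely many points, for [b <= pi] the interval [0, b) is the half circle (0, pi) without
   (b, b + pi). For [b > pi] it is the complement of the intersection of (pi, 2 pi) with (b, b +
   pi). *)
have [bp|bp] := leP b pi.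
  exists (fun n x => soft_arc n 0 j x * (1 + (-1) * soft_arc n b j x)); split.
  - by move=> n; apply: torus_funM => //; exact: torus_fun_soft_arc.
  - by move=> n x; apply: nrm; exact: prod.
  move=> x xI s0 sb; have [lt pp] := cases x xI s0 sb.
  have s0' : sin (coord j x - 0) != 0 by rewrite sub0E.
  have := cvgM (soft_arc_cvg s0') (cvg1 _ _ sb); rewrite sub0E.
  suff -> : (0 < sin (coord j x))%R%:R * (1 + -1 * (0 < sin (coord j x - b))%R%:R) =
      (coord j x < b)%R%:R :> R by apply.
  case: lt => xb.
    have /andP[xI0 xI2] := xI.
    case: pp => [[/andP[x0 xp] ->]|[/andP[xp x2] _]]; last by lra.
    rewrite xb ltNge ltW; first by rewrite /=; lra.
    by apply: sin_lt0_Npi; apply/andP; split; lra.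
  rewrite [coord j x < b]ltNge (ltW xb)/=; case: pp => [[/andP[x0 xp] ->]|[_ ->]]; last by rewrite mul0r.
  by rewrite sin_gt0_pi/=; [lra|apply/andP; split; lra].
exists (fun n x => 1 + (-1) * ((1 + (-1) * soft_arc n 0 j x) * soft_arc n b j x)); split.
- move=> n; apply: torus_funD; first exact: torus_fun_cst.
  apply: torus_funM; first exact: torus_fun_cst.
  by apply: torus_funM => //; exact: torus_fun_soft_arc.
- move=> n x; apply: nrm.
  by have /andP[u v] := prod _ _ (one n 0 x) (arc n b x); apply/andP; split; lra.
move=> x xI s0 sb; have [lt pp] := cases x xI s0 sb.
have s0' : sin (coord j x - 0) != 0 by rewrite sub0E.
have : 1 + (-1) * ((1 + (-1) * soft_arc n 0 j x) * soft_arc n b j x) @[n --> \oo] -->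
    (1 + (-1) * ((1 + (-1) * (0 < sin (coord j x))%R%:R) *
       (0 < sin (coord j x - b))%R%:R) : R).
  apply: cvgD; first exact: cvg_cst.
  apply: cvgM; first exact: cvg_cst.
  apply: cvgM; last exact: soft_arc_cvg.
  by have := cvg1 _ _ s0'; rewrite sub0E.
suff -> : 1 + -1 * ((1 + -1 * (0 < sin (coord j x))%R%:R) * (0 < sin (coord j x - b))%R%:R) =
    (coord j x < b)%R%:R :> R by apply.
case: lt => xb.
  rewrite xb; case: pp => [[_ ->]|[/andP[xp x2] _]]; first by rewrite /=; lra.
  rewrite [0 < sin (_ - b)]ltNge ltW; first by rewrite /=; lra.
  by apply: sin_lt0_Npi; apply/andP; split; lra.
rewrite [coord j x < b]ltNge (ltW xb)/=.
case: pp => [[/andP[x0 xp] _]|[/andP[xp x2] ->]]; first by lra.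
by rewrite sin_gt0_pi/=; [lra|apply/andP; split; lra].
Qed.

End vanishing.

(** * Test functions separate integrable functions *)

Section zero_field.
Variable R : realType.
Implicit Types (s c : R) (x : R3 R) (F G : R3 R -> R).
Notation mu := (@torus_measure R).

(** [None] stands for an absent bound, so that the boxes include the whole space and the half-spaces
    in a single coordinate, which generate the sigma-algebra. *)
Definition below (b : option R) s := if b is Some b then s < b else true.

Definition box_below (b : option R * option R * option R) : set (R3 R) :=
  [set x | [&& below b.1.1 x.1.1, below b.1.2 x.1.2 & below b.2 x.2]].

Lemma below_min b b' : exists b'', forall s, below b'' s = below b s && below b' s.
Proof.
case: b b' => [b|] [b'|]; [|by exists (Some b) => s; rewrite andbT|
  by exists (Some b')|by exists None].
by exists (Some (Order.min b b')) => s; rewrite /= lt_min.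
Qed.

Lemma setI_closed_box_below : setI_closed (range box_below).
Proof.
move=> _ _ [[[b0 b1] b2] _ <-] [[[c0 c1] c2] _ <-].
have [d0 h0] := below_min b0 c0; have [d1 h1] := below_min b1 c1.
have [d2 h2] := below_min b2 c2; exists (d0, d1, d2) => //.
apply/seteqP; split=> x; rewrite /box_below /= h0 h1 h2.
  by move=> /and3P[/andP[-> ->] /andP[-> ->] /andP[-> ->]].
by move=> [/and3P[-> -> ->] /and3P[-> -> ->]].
Qed.

Lemma measurable_box_below b : measurable (box_below b).
Proof.
have mi h : measurable [set s : measurableTypeR R | below h s].
  case: h => [c|].
    rewrite (_ : [set s | _] = [set` `]-oo, c[]); first exact: measurable_itv.
    by apply/seteqP; split=> s /=; rewrite in_itv.
  by rewrite (_ : [set s | _] = setT); [exact: measurableT|apply/seteqP; split].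
rewrite (_ : box_below b = ([set s | below b.1.1 s] `*` [set s | below b.1.2 s]) `*`
  [set s | below b.2 s]); first by do 2 (apply: measurableX => //).
by apply/seteqP; split=> x; rewrite /box_below /=; [move=> /and3P[-> -> ->]|
  move=> [[-> ->] ->]].
Qed.

Lemma measurable_box_below_gen : measurable `<=` <<s range box_below >>.
Proof.
pose T := g_sigma_algebraType (range box_below).
have mc j : measurable_fun setT (coord j : T -> measurableTypeR R).
  apply: (measurability _ (RGenInftyO.measurableE R)) => _ [_ [b ->]] <-.
  rewrite setTI; apply: sub_sigma_algebra; rewrite /coord.
  case: (j == 0%N); last case: (j == 1%N).
  - exists (Some b, None, None) => //; apply/seteqP; split=> x; rewrite /box_below /= !in_itv/= ?andbT//.
  - exists (None, Some b, None) => //; apply/seteqP; split=> x; rewrite /box_below /= !in_itv/= ?andbT//.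
  - exists (None, None, Some b) => //; apply/seteqP; split=> x; rewrite /box_below /= !in_itv/= ?andbT//.
have mid : measurable_fun setT (idfun : T -> R3 R).
  rewrite (_ : idfun = fun x : T => (coord 0 x, coord 1 x, coord 2 x)).
    by apply: measurable_fun_pair; [apply: measurable_fun_pair|]; exact: mc.
  by apply/funext => -[[]].
by move=> A mA; have := mid measurableT A mA; rewrite setTI.
Qed.

Lemma cube_ae : {ae mu, forall x, @cube R x}.
Proof.
exists (~` @cube R); split=> //; first exact: measurableC (@measurable_cube R).
by rewrite /torus_measure /= /mrestr setICl measure0.
Qed.

Lemma soft_box b : exists f : nat -> R3 R -> R,
  [/\ forall n, torus_fun (f n), forall n x, `|f n x| <= 1 &
    {ae mu, forall x, f n x @[n --> \oo] --> ((x \in box_below b)%:R : R)}].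
Proof.
have one j (o : option R) : exists f : nat -> R3 R -> R,
  [/\ forall n, torus_fun (f n), forall n x, `|f n x| <= 1 &
    {ae mu, forall x, 0 <= coord j x < 2 * pi ->
      f n x @[n --> \oo] --> ((below o (coord j x))%:R : R)}].
  case: o => [c|]; last first.
    exists (fun _ _ => 1); split=> [n|n x|].
    - exact: torus_fun_cst.
    - by rewrite normr1.
    - by apply: aeW => x _; exact: cvg_cst.
  have [f [tf f1 fc]] := soft_halfspace c j.
  exists f; split=> //.
  apply: filterS2 (sin_coord_neq0_ae j 0) (sin_coord_neq0_ae j c) => x.
  by rewrite subr0 => s0 so xI; exact: fc.
have [f0 [t0 n0 c0]] := one 0%N b.1.1.
have [f1 [t1 n1 c1]] := one 1%N b.1.2.
have [f2 [t2 n2 c2]] := one 2%N b.2.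
exists (fun n x => f0 n x * f1 n x * f2 n x); split.
- by move=> n; apply: torus_funM => //; exact: torus_funM.
- by move=> n x; rewrite !normrM mulr_ile1 ?mulr_ge0// mulr_ile1.
have c01 : {ae mu, forall x, f0 n x @[n --> \oo] --> ((below b.1.1 x.1.1)%:R : R) /\
    f1 n x @[n --> \oo] --> ((below b.1.2 x.1.2)%:R : R)}.
  apply: filterS3 cube_ae c0 c1 => x [[]]; rewrite /= !in_itv/= => x0 x1 x2.
  by move=> /(_ x0) ? /(_ x1).
apply: filterS3 cube_ae c01 c2 => x [[]]; rewrite /= !in_itv/= => x0 x1 x2 [l0 l1].
move=> /(_ x2) l2.
have -> : (x \in box_below b)%:R = (below b.1.1 x.1.1)%:R * (below b.1.2 x.1.2)%:R *
    (below b.2 x.2)%:R :> R.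
  rewrite -!natrM !mulnb; congr (nat_of_bool _)%:R.
  by apply/idP/idP; rewrite inE /box_below /= andbA.
by apply: cvgM => //; exact: cvgM.
Qed.

(** Indicators of boxes are almost everywhere limits of bounded test functions, so [u] integrates to
    0 over every box. The boxes form a pi-system, and the sets over which the integral vanishes form
    a Dynkin class, hence contain all measurable sets. *)
Lemma torus_fun_separating (u : R3 R -> R) : mu.-integrable setT (EFin \o u) ->
  (forall F, torus_fun F -> \int[mu]_x (F x * u x) = 0) ->
  {ae mu, forall x, u x = 0}.
Proof.
move=> iu uF; have mu_u : measurable_fun setT u.
  by apply/measurable_EFinP; exact: measurable_int iu.
have box0 b : (\int[mu]_(x in box_below b) (u x)%:E = 0)%E.
  have [f [tf f1 fc]] := soft_box b.
  have mb := measurable_box_below b.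
  rewrite integral_mkcond.
  have mf n : measurable_fun setT (fun x => f n x * u x).
    by apply: measurable_funM => //; exact: torus_fun_measurable.
  have [_ _ lim] : [/\ mu.-integrable setT ((fun x => (u x)%:E) \_ (box_below b)),
     [sequence \int[mu]_x `|(f n x * u x)%:E - ((fun x => (u x)%:E) \_ (box_below b)) x|]_n
       @ \oo --> 0 &
     [sequence \int[mu]_x (f n x * u x)%:E]_n @ \oo -->
       \int[mu]_x ((fun x => (u x)%:E) \_ (box_below b)) x]%E.
    apply: (dominated_convergence measurableT (g := abse \o (EFin \o u))).
    - by move=> n; exact/measurable_EFinP.
    - apply/(measurable_restrictT _ mb)/measurable_funTS.
      exact/measurable_EFinP.
    - apply: filterS fc => x fx _; rewrite patchE.
      have -> : (if x \in box_below b then (u x)%:E else 0%E) =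
          ((x \in box_below b)%:R * u x)%:E.
        by case: ifP => _; rewrite ?mul1r ?mul0r.
      apply: cvg_EFin; first exact: nearW.
      by apply: cvgM => //; exact: cvg_cst.
    - exact: integrable_abse.
    - apply: aeW => x n _ /=; rewrite lee_fin normrM.
      by rewrite ler_piMl.
  have z n : (\int[mu]_x (f n x * u x)%:E = 0)%E.
    have ifu : mu.-integrable setT (EFin \o (fun x => f n x * u x)).
      apply: le_integrable iu => //; first exact/measurable_EFinP.
      by move=> x _ /=; rewrite lee_fin normrM ler_piMl.
    rewrite -[LHS]fineK; last exact: integrable_fin_num.
    by have := uF _ (tf n); rewrite /Rintegral => ->.
  apply/esym; have := lim; rewrite (_ : [sequence _]_n = cst 0%E); last first.
    by apply/funext => n; exact: z.
  by move=> /(cvg_lim (@ereal_hausdorff R)); rewrite lim_cst.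
have dynkinH : dynkin [set A | measurable A /\ (\int[mu]_(x in A) (u x)%:E = 0)%E].
  split.
  - split; first exact: measurableT.
    by rewrite -(box0 (None, None, None)); congr integral; apply/seteqP; split.
  - move=> A [mA A0]; split; first exact: measurableC.
    have := box0 (None, None, None).
    have -> : box_below (None, None, None) = A `|` ~` A.
      by rewrite setUv; apply/seteqP; split.
    rewrite integral_setU ?A0 ?add0e//; first exact: measurableC.
    + by apply: measurable_funTS; exact/measurable_EFinP.
    + by apply/disj_setPS; rewrite setICr.
  - move=> A tA AH; have mA n : measurable (A n) by have [] := AH n.
    split; first exact: bigcup_measurable.
    rewrite integral_bigcup//; last first.
      by apply: (integrableS measurableT) iu => //; exact: bigcup_measurable.
    by apply: eseries0 => n _ _; have [_] := AH n.
have all0 A : measurable A -> (\int[mu]_(x in A) (u x)%:E = 0)%E.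
  move=> mA; have := measurable_box_below_gen mA => gA.
  have [] // := lambda_system_subset setI_closed_box_below
    (proj1 (dynkin_lambda_system _) dynkinH) _ _ gA.
  move=> _ [b _ <-]; split; last exact: box0.
  exact: measurable_box_below.
have h : ae_eq mu setT (EFin \o u) (cst 0%E).
  have eq0 E : E `<=` setT -> measurable E ->
      (\int[mu]_(x in E) (EFin \o u) x = \int[mu]_(x in E) cst 0 x)%E.
    by move=> _ mE; rewrite integral0; exact: all0.
  exact: (integral_ae_eq measurableT iu (measurable_cst _) eq0).
by apply: filterS h => x /(_ I) [].
Qed.

Lemma cos_tower c : tower (fun k s => cos (s + c + k%:R * (pi / 2))) .
Proof.
split=> k s; last first.
  by rewrite -[in RHS](cos_periodic) ; congr cos; ring.
have d1 : is_derive s (1 : R) (fun s => s + c + k%:R * (pi / 2)) 1.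
  have := is_deriveD (is_deriveD (is_derive_id s (1 : R)) (is_derive_cst c s (1 : R)))
    (is_derive_cst (k%:R * (pi / 2) : R) s (1 : R)).
  by move=> /is_derive_eq; apply; rewrite !addr0.
have := @is_derive1_comp R cos (fun s => s + c + k%:R * (pi / 2)) s _ _ (is_derive_cos _) d1.
move=> /is_derive_eq; apply; rewrite mulr1 -cosDpihalf; congr cos.
by rewrite -[in RHS](natr1 k); ring.
Qed.

(** For [G] a cosine of the coordinate [j] with phase [c], the gradient is [w c] times the basis
    vector. Multiplying [F] by the same [w c] gives integrals of F B_j (w c)^2, and for two phases a
    quarter turn apart the squares add up to 1. *)
Lemma fluxes_eq0 (B : R3 R -> R3 R) : integrable_field mu B ->
  (forall F G, torus_fun F -> torus_fun G ->
    \int[mu]_x (F x * dot3 (B x) (grad G x)) = 0) ->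
  {ae mu, forall x, B x = 0}.
Proof.
move=> iB flux; have [mB iB'] := iB.
have B0 j : (j < 3)%N -> {ae mu, forall x, coord j (B x) = 0}.
  move=> j3; apply: torus_fun_separating.
    apply: (dominated_integrable (C := 1) iB); first exact: measurable_coordT.
    by move=> y; rewrite mul1r; exact: l1norm_coord.
  move=> F tF.
  pose w c x := cos (coord j x + c + 1%:R * (pi / 2)).
  pose G c x := cos (coord j x + c + 0%:R * (pi / 2)).
  have tG c : torus_fun (G c) := torus_fun_tower0 j (cos_tower c).
  have tw c : torus_fun (w c) := torus_fun_tower0 j (towerS (cos_tower c)).
  have dG c x v : dot3 v (grad (G c) x) = coord j v * w c x.
    have [_ E1] := grad_is_diff x (tG c).
    have [_ E2] := is_diff_comp (coord_is_diff j x)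
      (is_derive_diff (proj1 (cos_tower c) 0%N (coord j x))).
    by move: E1; rewrite E2 => /(congr1 (@^~ v)) /= <-.
  have z c : \int[mu]_x (F x * w c x * (coord j (B x) * w c x)) = 0.
    rewrite -[RHS](flux _ _ (torus_funM tF (tw c)) (tG c)).
    by apply: eq_Rintegral => x _; rewrite dG.
  have ii c : mu.-integrable setT (EFin \o (fun x => F x * w c x * (coord j (B x) * w c x))).
    have := pairing_integrable iB (@measurable_id _ _ setT) (torus_funM tF (tw c)) (tG c).
    by apply: eq_integrable => // x _ /=; rewrite dG.
  have wE x : w 0 x ^+ 2 + w (- (pi / 2)) x ^+ 2 = 1.
    rewrite /w mul1r addr0 cosDpihalf sqrrN subrK addrC.
    exact: cos2Dsin2.
  have zz : \int[mu]_x (F x * w 0 x * (coord j (B x) * w 0 x)) +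
      \int[mu]_x (F x * w (- (pi / 2)) x * (coord j (B x) * w (- (pi / 2)) x)) = 0.
    by rewrite !z addr0.
  rewrite -[RHS]zz -RintegralD//.
  apply: eq_Rintegral => x _.
  transitivity (F x * coord j (B x) * (w 0 x ^+ 2 + w (- (pi / 2)) x ^+ 2)).
    by rewrite wE mulr1.
  move: (F x) (coord j (B x)) (w 0 x) (w _ x) => *; ring.
have [h0 h1 h2] := And3 (B0 0%N isT) (B0 1%N isT) (B0 2%N isT).
apply: filterS3 h0 h1 h2 => x; rewrite /coord /=.
by case: (B x) => [[b0 b1] b2] /= -> -> ->.
Qed.

End zero_field.

(** * Invariance of Lebesgue measure *)

Section circle.
Variable R : realType.
Implicit Types (s c : R).
Notation leb := (@lebesgue_measure R).

Definition translate c : measurableTypeR R -> measurableTypeR R :=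
  fun s => ((s : R) + c)%R.

Lemma measurable_translate c : measurable_fun setT (translate c).
Proof.
apply: (@measurable_funD _ _ R setT (@id R) (cst c)); first exact: measurable_id.
exact: measurable_cst.
Qed.

HB.instance Definition _ c :=
  isMeasurableFun.Build _ _ _ _ (translate c) (measurable_translate c).

Lemma lebesgue_translate c (A : set (measurableTypeR R)) : measurable A ->
  (leb (translate c @^-1` A) = leb A)%E.
Proof.
move=> mA; rewrite -[LHS]/(pushforward leb (translate c) A).
apply/esym/lebesgue_measure_unique => //= _ [[a b]] _ <-; rewrite /pushforward.
have -> : translate c @^-1` `]a, b] = [set` `]a - c, b - c]].
  by apply/seteqP; split=> s /=; rewrite /translate !in_itv/= ltrBlDr lerBrDr.
rewrite !lebesgue_measure_itv/= !lte_fin ltrD2r.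
by case: ifP => // _; congr (_%:E); ring.
Qed.

Lemma lebesgue_circle_lty : (leb [set` `[0%R, (2 * pi : R)%R[] < +oo)%E.
Proof. by rewrite lebesgue_measure_itv/= lte_fin twopi_gt0 -EFinB ltry. Qed.

Lemma measurable_circle : measurable ([set` `[0%R, (2 * pi : R)%R[] : set (measurableTypeR R)).
Proof. exact: measurable_itv. Qed.

Definition circle_measure : set (measurableTypeR R) -> \bar R :=
  mfrestr measurable_circle lebesgue_circle_lty.
HB.instance Definition _ := Measure.on circle_measure.
HB.instance Definition _ := FiniteMeasure.on circle_measure.

Notation lI := circle_measure.

Definition wrap s : measurableTypeR R :=
  s - (Num.floor (s / (2 * pi)))%:~R * (2 * pi).

Lemma wrap_periodic (V : Type) (g : R -> V) s :
  (forall s, g (s + 2 * pi) = g s) -> g (wrap s) = g s.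
Proof.
move=> gp; by rewrite /wrap -mulNr -rmorphN (periodic_intZ gp).
Qed.

Lemma wrapE (n : int) s : 0 <= s - n%:~R * (2 * pi) < 2 * pi ->
  wrap s = s - n%:~R * (2 * pi).
Proof.
move=> /andP[s0 s2]; have p0 := twopi_gt0 R.
rewrite /wrap (_ : Num.floor _ = n)//; apply: floor_def.
rewrite intrD; apply/andP; split.
  by rewrite ler_pdivlMr// -subr_ge0.
by rewrite ltr_pdivrMr// mulrDl mul1r -ltrBlDl.
Qed.

Lemma wrap_itv s : 0 <= wrap s < 2 * pi.
Proof. exact: floor_period_itv. Qed.

Lemma wrapD2pi s : wrap (s + 2 * pi) = wrap s.
Proof.
rewrite (@wrapE (Num.floor (s / (2 * pi)) + 1)).
  by rewrite /wrap intrD; ring.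
rewrite (_ : s + 2 * pi - _ = wrap s); first exact: wrap_itv.
by rewrite /wrap intrD; ring.
Qed.

Definition rotate c : measurableTypeR R -> measurableTypeR R :=
  fun s => wrap ((s : R) + c)%R.

Lemma measurable_wrap : measurable_fun setT (wrap : R -> R).
Proof.
rewrite /wrap; apply: measurable_funB => //; apply: measurable_funM => //.
apply: (@measurableT_comp _ _ _ _ _ _ (fun s : R => (Num.floor s)%:~R : R)).
  apply: (measurability _ (RGenInftyO.measurableE R)) => _ [_ [b ->]] <-.
  rewrite setTI (_ : _ @^-1` _ = [set` `]-oo, (Num.ceil b)%:~R[]).
    exact: measurable_itv.
  by apply/seteqP; split=> s /=; rewrite !in_itv/= -ceil_gt_int -floor_lt_int.
by apply: measurable_funM.
Qed.

Lemma measurable_rotate c : measurable_fun setT (rotate c).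
Proof. exact: (measurableT_comp measurable_wrap (measurable_translate c)). Qed.

HB.instance Definition _ c :=
  isMeasurableFun.Build _ _ _ _ (rotate c) (measurable_rotate c).

Lemma circle_rotate c (A : set (measurableTypeR R)) : measurable A ->
  (lI (rotate c @^-1` A) = lI A)%E.
Proof.
move=> mA; have E : rotate c = rotate (wrap c).
  apply/funext => s; rewrite /rotate.
  have h u : wrap (s + (u + 2 * pi)) = wrap (s + u) by rewrite addrA wrapD2pi.
  by rewrite (wrap_periodic (g := fun u => wrap (s + u)) c h).
rewrite {}E; have /andP[] := wrap_itv c; move: (wrap c) => {}c c0 c2.
rewrite /circle_measure /= /mfrestr /mrestr.
have mI (a b : R) : measurable (A `&` [set` `[a, b[]).
  by apply: measurableI => //; exact: measurable_itv.
(* With [c] reduced to one period, the rotation is the translation by [c] where [s + c] stays below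
   2 pi and the translation by [c - 2 * pi] elsewhere. *)
have -> : rotate c @^-1` A `&` [set` `[0, 2 * pi[] =
   (translate c @^-1` (A `&` [set` `[c, 2 * pi[])) `|`
   (translate (c - 2 * pi) @^-1` (A `&` [set` `[0, c[])).
  apply/seteqP; split=> s; rewrite /rotate /translate /= !in_itv/=.
    move=> [As /andP[s0 s2]]; have [sc|sc] := ltP (s + c) (2 * pi).
      left; move: As; rewrite (@wrapE 0) mul0r subr0; first by rewrite lerDr s0.
      by rewrite sc addr_ge0.
    right; move: As; rewrite (@wrapE 1) mul1r.
      by rewrite addrA => ?; split=> //; apply/andP; split; lra.
    by apply/andP; split; lra.
  case=> -[As /andP[s0 s2]]; split.
  - by rewrite (@wrapE 0) mul0r subr0//; apply/andP; split; lra.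
  - by apply/andP; split; lra.
  - by rewrite (@wrapE 1) mul1r -addrA//; apply/andP; split; lra.
  - by apply/andP; split; lra.
rewrite measureU.
- transitivity (leb (A `&` [set` `[c, (2 * pi)%R[]) + leb (A `&` [set` `[0%R, c[]))%E.
    by congr (_ + _)%E; apply: lebesgue_translate; exact: mI.
  rewrite -measureU.
  + rewrite -setIUr; congr (leb (A `&` _)); apply/seteqP; split=> s /=; rewrite !in_itv/=.
      by case=> /andP[h1 h2]; apply/andP; split; lra.
    by move=> /andP[h1 h2]; have [h|h] := ltP s c; [right; rewrite h1|left].
  + exact: mI.
  + exact: mI.
  + apply/seteqP; split=> // s [[_ h] [_ k]].
    have h1 : c <= (s : R) by move: h; rewrite /= in_itv/= => /andP[].
    have k1 : (s : R) < c by move: k; rewrite /= in_itv/= => /andP[].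
    by move: (le_lt_trans h1 k1); rewrite ltxx.
- by rewrite -[X in measurable X]setTI; apply: measurable_translate.
- by rewrite -[X in measurable X]setTI; apply: measurable_translate.
- apply/seteqP; split=> // s [[_ h] [_ k]].
  have h1 : (s : R) + c < 2 * pi by move: h; rewrite /= in_itv/= => /andP[].
  have k1 : 0 <= (s : R) + (c - 2 * pi) by move: k; rewrite /= in_itv/= => /andP[].
  by move: k1; rewrite addrA subr_ge0 leNgt h1.
Qed.

Lemma circle_integral_translate (g : R -> \bar R) c : measurable_fun setT g ->
  (forall s, (0 <= g s)%E) -> (forall s, g (s + 2 * pi) = g s) ->
  (\int[lI]_s g (s + c)%R = \int[lI]_s g s)%E.
Proof.
move=> mg g0 gp.
transitivity (\int[pushforward lI (rotate c)]_s g s)%E.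
  rewrite ge0_integral_pushforward//.
  by apply: eq_integral => s _; rewrite /rotate /= wrap_periodic.
by apply: eq_measure_integral => A mA _; exact: circle_rotate.
Qed.

End circle.

(** * Invariance of the torus measure under a step *)

Section invariance.
Variable R : realType.
Implicit Types (x : R3 R) (c : R -> R).
Notation leb := (@lebesgue_measure R).
Notation lI := (@circle_measure R).
Notation mu := (@torus_measure R).

(* A named constant, so that canonical structure inference does not unfold the
   nested product measure. *)
Definition square_measure : set (measurableTypeR R * measurableTypeR R) -> \bar R :=
  (lI \x lI)%E.
HB.instance Definition _ := Measure.on square_measure.

Let square_measure_fin : fin_num_fun square_measure.
Proof.
move=> U mU; rewrite ge0_fin_numE ?measure_ge0//.
have : (square_measure U <= square_measure (setT `*` setT))%E.
  by apply: le_measure; rewrite ?inE//; exact: measurableX.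
move=> /le_lt_trans; apply; rewrite /square_measure product_measure1E//.
by rewrite lte_mul_pinfty// ?fin_num_measure// ltey_eq fin_num_measure.
Qed.

HB.instance Definition _ :=
  Measure_isFinite.Build _ _ _ square_measure square_measure_fin.

Lemma square_measureE (A : set (measurableTypeR R * measurableTypeR R)) : measurable A ->
  (square_measure A = (leb \x leb) (A `&` ([set` `[0%R, (2 * pi : R)%R[] `*` [set` `[0%R, (2 * pi : R)%R[])))%E.
Proof.
have mI := @measurable_circle R; have mII := measurableX mI mI.
move=> mA; rewrite -[RHS]/(mrestr (leb \x leb)%E mII A).
apply: product_measure_unique => // B C mB mC.
rewrite /= /mrestr -setXI product_measure1E//; exact: measurableI.
Qed.

(** Presents the restricted product as a product of finite measures, the form in which Tonelli's
    theorem allows either order of integration. *)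
Lemma torus_measureE (A : set (R3 R)) : measurable A ->
  (mu A = (square_measure \x lI) A)%E.
Proof.
have mI := @measurable_circle R; have mII := measurableX mI mI.
have muX (B : set (measurableTypeR R * measurableTypeR R)) (C : set (measurableTypeR R)) :
    measurable B -> measurable C -> (mu (B `*` C) = square_measure B * lI C)%E.
  move=> mB mC; have mBI := measurableI _ _ mB mII; have mCI := measurableI _ _ mC mI.
  rewrite square_measureE//.
  rewrite -(product_measure1E (leb \x leb)%E leb mBI mCI).
  by rewrite setXI.
move=> mA; apply/esym; apply: product_measure_unique; last exact: mA.
exact: muX.
Qed.

Lemma torus_integralE (f : R3 R -> \bar R) :
  (\int[mu]_x f x = \int[square_measure \x lI]_x f x)%E.
Proof. by apply: eq_measure_integral => A mA _; exact: torus_measureE. Qed.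

Lemma square_integralE (g : measurableTypeR R * measurableTypeR R -> \bar R) :
  measurable_fun setT g -> (forall p, (0 <= g p)%E) ->
  (\int[square_measure]_p g p = \int[lI]_y \int[lI]_x g (x, y))%E.
Proof. by move=> mg g0; exact: (@fubini_tonelli2 _ _ _ _ _ lI lI g mg g0). Qed.

Lemma torus_integral1E (f : R3 R -> \bar R) :
  measurable_fun setT f -> (forall p, (0 <= f p)%E) ->
  (\int[mu]_p f p = \int[square_measure]_p \int[lI]_w f (p, w))%E.
Proof.
move=> mf f0; transitivity (\int[square_measure \x lI]_x f x)%E.
  exact: torus_integralE.
exact: (@fubini_tonelli1 _ _ _ _ _ square_measure lI f mf f0).
Qed.

Lemma torus_integral2E (f : R3 R -> \bar R) :
  measurable_fun setT f -> (forall p, (0 <= f p)%E) ->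
  (\int[mu]_p f p = \int[lI]_w \int[square_measure]_p f (p, w))%E.
Proof.
move=> mf f0; transitivity (\int[square_measure \x lI]_x f x)%E.
  exact: torus_integralE.
exact: (@fubini_tonelli2 _ _ _ _ _ square_measure lI f mf f0).
Qed.

(** The step does not map the cube to itself, hence the periodicity of [f]. For fixed [y] and [z]
    the first coordinate enters only through [x + c y], a rotation of the circle; Tonelli then deals
    with the permutation. *)
Lemma torus_integral_step c (f : R3 R -> \bar R) : measurable_fun setT c ->
  measurable_fun setT f -> (forall x, (0 <= f x)%E) -> torus_periodic f ->
  (\int[mu]_x f (step c x) = \int[mu]_x f x)%E.
Proof.
move=> mc mf f0 fp.
have mfs : measurable_fun setT (f \o step c).
  exact: (measurableT_comp mf (measurable_step mc)).
pose h p := (\int[lI]_w f (p, w))%E.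
have mh : measurable_fun setT h.
  exact: (@measurable_fun_fubini_tonelli_F _ _ _ _ _ lI f mf).
have h0 p : (0 <= h p)%E by apply: integral_ge0 => w _; exact: f0.
transitivity (\int[lI]_z \int[lI]_y h (y, z))%E; last first.
  by rewrite torus_integral1E// -square_integralE.
transitivity (\int[lI]_z \int[square_measure]_p f (step c (p, z)))%E.
  by apply: (torus_integral2E mfs) => p; exact: f0.
apply: eq_integral => z _.
transitivity (\int[lI]_y \int[lI]_x f (step c ((x, y), z)))%E.
  apply: (@square_integralE (fun p => f (step c (p, z)))) => //.
  have mpz : measurable_fun setT (fun p : measurableTypeR R * measurableTypeR R => (p, z)).
    by apply: measurable_fun_pair; [exact: measurable_id|exact: measurable_cst].
  exact: (measurableT_comp mfs mpz).
apply: eq_integral => y _; rewrite /h.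
apply: (@circle_integral_translate _ (fun w => f (y, z, w)) (c y)).
- have mpz : measurable_fun setT (fun w : measurableTypeR R => ((y, z), w)).
    by apply: measurable_fun_pair; [exact: measurable_cst|exact: measurable_id].
  exact: (measurableT_comp mf mpz).
- by move=> w; exact: f0.
- move=> w; rewrite -[RHS](fp _ (inord 2)) /basis3 !inordK//=; congr f.
  rewrite /vec3; congr (_, _, _); rewrite /= ?scaler0 ?addr0//.
  by rewrite /GRing.scale/= mulr1.
Qed.

Lemma torus_periodic_step (V : Type) c (f : R3 R -> V) : (forall s, c (s + 2 * pi) = c s) ->
  torus_periodic f -> torus_periodic (f \o step c).
Proof.
move=> cp fp x i.
have fe j y : f (y + (2 * pi) *: basis3 R (inord j)) = f y by exact: fp.
case: i => [[|[|[|//]]] i3] /=.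
- rewrite -[RHS](fe 2%N); congr f; rewrite /basis3 !inordK//= /step /vec3 /=.
  by congr (_, _, _); rewrite /= ?scaler0 ?addr0//; rewrite addrAC.
- rewrite -[RHS](fe 0%N); congr f; rewrite /basis3 !inordK//= /step /vec3 /=.
  by congr (_, _, _); rewrite /= ?scaler0 ?addr0//; rewrite /GRing.scale/= mulr1 cp.
- rewrite -[RHS](fe 1%N); congr f; rewrite /basis3 !inordK//= /step /vec3 /=.
  by congr (_, _, _); rewrite /= ?scaler0 ?addr0.
Qed.

Lemma hat_periodic s : hat (s + 2 * pi) = hat s :> R.
Proof. by rewrite !hat_soft /soft_hat cos_periodic. Qed.

Lemma torus_periodic_orbit (V : Type) a k (g : R -> V) : (forall s, g (s + 2 * pi) = g s) ->
  torus_periodic (fun x => g (iter k (cat_step a) x).1.2).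
Proof.
move=> gp; elim: k => [|k IH].
  move=> x i; have [n] := coord_periodic 1 x i; rewrite /coord /= => ->.
  exact: periodic_intZ.
have hp s : a * hat (s + 2 * pi) = a * hat s by rewrite hat_periodic.
move=> x i; have := torus_periodic_step (c := fun u => a * hat u) hp IH x i.
by rewrite /= -!/(cat_step a _) -!iterSr.
Qed.

Lemma measurable_orbit_zeros (a : R) k :
  measurable [set x : R3 R | sin (iter k (cat_step a) x).1.2 = 0].
Proof.
have mc : measurable_fun setT (fun u : R => a * hat u).
  by apply: measurable_funM => //; exact: measurable_hat.
have mZ := @measurable_sin_zeros R 0.
rewrite (_ : [set _ | _] = (fun x : R3 R => (iter k (cat_step a) x).1.2) @^-1`
  [set s | sin (s - 0) = 0]); last by apply/seteqP; split=> x /=; rewrite subr0.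
rewrite -[X in measurable X]setTI.
exact: (measurableT_comp (measurable_coord 1) (measurable_iter_step k mc)).
Qed.

Lemma measurable_regular a : measurable [set x : R3 R | regular a x].
Proof.
rewrite (_ : [set _ | _] =
  \bigcap_k ~` [set x : R3 R | sin (iter k (cat_step a) x).1.2 = 0]).
  by apply: bigcap_measurable => // k _; apply: measurableC; exact: measurable_orbit_zeros.
apply/seteqP; split=> x /= rx k; last by apply/eqP; exact: (rx k I).
by move=> _; apply/eqP; exact: rx.
Qed.

Lemma torus_periodic_regular a : torus_periodic (fun x : R3 R => regular a x).
Proof.
move=> x i; rewrite /regular; apply: eq_forall => k.
rewrite (torus_periodic_orbit a k (g := fun s => sin s != 0))// => s.
by rewrite sin_periodic.
Qed.

(** By invariance, the set where the orbit meets a zero of the sine at time [k] has the measure of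
    the same set at time 0, which is a countable union of null planes. Invariance is known for
    integrals of periodic functions, so it is applied to indicators. *)
Lemma regular_ae (a : R) : {ae mu, forall x, regular a x}.
Proof.
have mc : measurable_fun setT (fun u : R => a * hat u).
  by apply: measurable_funM => //; exact: measurable_hat.
apply: ae_foralln => k.
pose Z j := [set x : R3 R | sin (iter j (cat_step a) x).1.2 = 0].
exists (Z k); split; first exact: measurable_orbit_zeros; last first.
  by move=> x /= /negP; rewrite negbK => /eqP.
pose g (x : R3 R) : \bar R := (\1_(Z 0%N) x)%:E.
have gE m x : g (iter m (cat_step a) x) = (\1_(Z m) x)%:E.
  by rewrite /g !indicE.
have mg m : measurable_fun setT (fun x => g (iter m (cat_step a) x)).
  rewrite (eq_fun (gE m)); apply/measurable_EFinP; apply: measurable_indic.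
  exact: measurable_orbit_zeros.
have gp m : torus_periodic (fun x => g (iter m (cat_step a) x)).
  apply: (torus_periodic_orbit a m (g := fun s => (\1_[set s | sin s = 0] s : R)%:E)) => s.
  by rewrite !indicE; congr (_%:R)%:E; congr nat_of_bool; apply/idP/idP; rewrite !inE /= sin_periodic.
have inv m : (\int[mu]_x g (iter m (cat_step a) x) = \int[mu]_x g x)%E.
  elim: m => [//|m IH]; rewrite -IH -[RHS](torus_integral_step mc (mg m) _ (gp m)).
    by apply: eq_integral => x _; rewrite -/(cat_step a x) /= -iterSr.
  by move=> x; rewrite gE lee_fin indicE ler0n.
have := inv k; rewrite (eq_integral _ _ (fun x _ => gE k x)).
rewrite !integral_indic ?setIT//; try exact: measurable_orbit_zeros.
move=> ->; have mZ := @measurable_sin_zeros R 0.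
have -> : Z 0%N = [set x | [set s : measurableTypeR R | sin (s - 0) = 0] (coord 1 x)].
  by apply/seteqP; split=> x; rewrite /Z /= subr0.
apply: (coord_null 1) => //.
exact/countable_lebesgue_measure0/sin_zeros_countable.
Qed.

End invariance.

(** * Cone dichotomy and growth *)

Section cone.
Variable R : realType.
Implicit Types (a d : R) (v : R3 R).
Local Notation mu := (@torus_measure R).

Definition tail_norm v : R := Num.max `|v.1.2| `|v.2|.

(* Inside this invariant cone the tail norm is expanded; a vector whose images all
   stay outside it has a dominant first coordinate, which one step replaces by a
   second coordinate smaller by a factor [2 / a], so that it decays. *)
Definition in_cone a v : bool := `|v.1.1| <= a / 2 * tail_norm v.

Lemma tail_norm_ge0 v : 0 <= tail_norm v.
Proof. by rewrite /tail_norm le_max normr_ge0. Qed.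

Lemma tail_norm_l1norm v : tail_norm v <= l1norm v.
Proof. by rewrite /tail_norm ge_max l1norm1 l1norm2. Qed.

Lemma shear_norm_ge (v1 v2 d c : R) : `|d| = c -> c * `|v2| - `|v1| <= `|v1 + v2 * d|.
Proof.
move=> dc; have := lerB_normD (v2 * d) v1.
by rewrite normrM dc (mulrC `|v2|) (addrC (v2 * d)).
Qed.

Lemma cone_step a d v : 4 <= a -> `|d| = a -> in_cone a v ->
  in_cone a (stepD d v) /\ tail_norm v <= tail_norm (stepD d v).
Proof.
move=> a4 /(shear_norm_ge v.1.1 v.1.2); rewrite /in_cone /tail_norm /stepD /vec3 /=.
move: (normr_ge0 v.1.1) (normr_ge0 v.1.2) (normr_ge0 v.2) => h1 h2 h3.
move: `|v.1.1| `|v.1.2| `|v.2| `|_ + _| h1 h2 h3 => n1 n2 n3 n4 h1 h2 h3 h4.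
rewrite /Num.max; do 2 case: ltP => ?; move=> ?; split; nra.
Qed.

(** One step need not expand: if the third coordinate dominates, the shear acts on a smaller one.
    After two steps both have been multiplied, and the larger gains at least [a / 2] or [a - 1]; the
    factor 8 is half of 16. *)
Lemma cone_step2 a d d' v : 16 <= a -> `|d| = a -> `|d'| = a -> in_cone a v ->
  8 * tail_norm v <= tail_norm (stepD d' (stepD d v)).
Proof.
move=> a16 /(shear_norm_ge v.1.1 v.1.2) + /(shear_norm_ge v.1.2 v.2).
rewrite /in_cone /tail_norm /stepD /vec3 /=.
move: (normr_ge0 v.1.1) (normr_ge0 v.1.2) (normr_ge0 v.2) => h1 h2 h3.
move: `|v.1.1| `|v.1.2| `|v.2| `|v.1.1 + _| `|v.1.2 + _| h1 h2 h3 => n1 n2 n3 n4 n5 h1 h2 h3 h4 h5.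
rewrite /Num.max; do 2 case: ltP => ?; move=> ?; nra.
Qed.

Lemma off_cone a v : 4 <= a -> in_cone a v -> tail_norm v = 0 -> v = 0.
Proof.
move=> a4; rewrite /in_cone => + t0; rewrite t0 mulr0 normr_le0 => /eqP v1.
move: t0 v1; rewrite /tail_norm; case: v => [[v1 v2] v3] /= t0 ->.
have : `|v2| <= 0 by rewrite -t0 le_max lexx.
have : `|v3| <= 0 by rewrite -t0 le_max lexx orbT.
by rewrite !normr_le0 => /eqP -> /eqP ->.
Qed.

Lemma off_cone_le a v : 4 <= a -> ~~ in_cone a v || (v == 0) ->
  `|v.1.2| <= 2 / a * `|v.1.1| /\ l1norm v <= 2 * `|v.1.1|.
Proof.
move=> a4 /orP[|/eqP ->]; last first.
  by rewrite /l1norm /= !normr0 !mulr0 !addr0.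
rewrite /in_cone -ltNge /l1norm => h.
have t1 : `|v.1.2| <= tail_norm v by rewrite /tail_norm le_max lexx.
have t2 : `|v.2| <= tail_norm v by rewrite /tail_norm le_max lexx orbT.
have a0 : 0 < a by lra.
rewrite mulrAC ler_pdivlMr//.
move: (normr_ge0 v.1.1) (normr_ge0 v.1.2) (normr_ge0 v.2) (tail_norm_ge0 v) h t1 t2.
move: `|v.1.1| `|v.1.2| `|v.2| (tail_norm v) => n1 n2 n3 n4 ? ? ? ? ? ? ?; split; nra.
Qed.

End cone.

(** * Exponential growth of the L^1 norm *)

Section growth.
Variable R : realType.
Implicit Types (a d : R) (v : R3 R).
Local Notation mu := (@torus_measure R).

Lemma hatD_norm s : sin s != 0 -> `|hatD s| = 1 :> R.
Proof.
move=> s0; rewrite /hatD soft_hatD1E// normrN normrM normfV normr_id.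
by rewrite divff// normr_eq0.
Qed.

Lemma hatD_le1 s : `|hatD s| <= 1 :> R.
Proof. by apply: soft_hatD_norm; rewrite ler01 lexx. Qed.

Lemma measurable_cat_push a B k : measurable_fun setT B ->
  measurable_fun setT (@cat_push R a B k).
Proof.
move=> mB; apply: measurable_pushfield => //.
  by apply: measurable_funM => //; exact: measurable_hat.
by apply: measurable_funM => //; exact: measurable_soft_hatD.
Qed.

Section orbit.
Variables (a : R) (B : R3 R -> R3 R) (x : R3 R).
Hypotheses (a16 : 16 <= a) (rx : regular a x).

Let slope k : R := a * hatD (iter k (cat_step a) x).1.2.

Let slope_norm k : `|slope k| = a.
Proof.
by rewrite /slope normrM hatD_norm ?rx// mulr1 ger0_norm// (le_trans _ a16).
Qed.

Let pushS k : cat_push a B k.+1 x = stepD (slope k) (cat_push a B k x).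
Proof. by []. Qed.

Let a4 : 4 <= a. Proof. by move: a16; lra. Qed.

Lemma cat_push_in_cone k : in_cone a (cat_push a B k x) -> forall j,
  in_cone a (cat_push a B (k + j) x) /\
  2 ^+ j * tail_norm (cat_push a B k x) <= 2 * tail_norm (cat_push a B (k + j) x).
Proof.
move=> ck; have inc j : in_cone a (cat_push a B (k + j) x).
  elim: j => [|j IH]; first by rewrite addn0.
  by rewrite addnS pushS; have [] := cone_step a4 (slope_norm (k + j)) IH.
(* Expansion is known over pairs of steps, so the induction carries two consecutive exponents; the
   factor 2 on the right covers an odd number of steps. *)
suff H j : 2 ^+ j * tail_norm (cat_push a B k x) <= 2 * tail_norm (cat_push a B (k + j) x) /\
  2 ^+ j.+1 * tail_norm (cat_push a B k x) <= 2 * tail_norm (cat_push a B (k + j.+1) x).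
  by move=> j; split => //; have [] := H j.
elim: j => [|j [IH IH1]].
  have [_] := cone_step a4 (slope_norm k) ck; rewrite addn0 addnS addn0 -pushS expr1 expr0.
  move: (tail_norm_ge0 (cat_push a B k x)); move: (tail_norm _) (tail_norm _) => u w.
  by move=> ? ?; split; lra.
split=> //; have := cone_step2 a16 (slope_norm (k + j)) (slope_norm (k + j).+1) (inc j).
rewrite -!pushS !addnS !exprS.
move: IH (tail_norm_ge0 (cat_push a B (k + j).+2 x)).
move: (2 ^+ j) (tail_norm _) (tail_norm _) (tail_norm _) => p u w z.
by rewrite -!mulrA; move: (p * _) => *; lra.
Qed.

Lemma cat_push_off_cone :
  (forall k, in_cone a (cat_push a B k x) -> tail_norm (cat_push a B k x) = 0) ->
  forall k, l1norm (cat_push a B k x) <= 2 * (2 / a) ^+ k * l1norm (B x).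
Proof.
move=> h; have off k : ~~ in_cone a (cat_push a B k x) || (cat_push a B k x == 0).
  case: (boolP (in_cone _ _)) => //= c; apply/eqP; apply: (off_cone a4 c).
  exact: h.
have r0 : 0 <= 2 / a by rewrite divr_ge0// (le_trans _ a16).
have H k : `|(cat_push a B k x).1.1| <= (2 / a) ^+ k * `|(B x).1.1|.
  elim: k => [|k IH]; first by rewrite expr0 mul1r.
  rewrite pushS /= exprS -mulrA; have [h1 _] := off_cone_le a4 (off k).
  by apply: (le_trans h1); rewrite ler_wpM2l.
move=> k; have [_ h2] := off_cone_le a4 (off k); apply: (le_trans h2).
rewrite -mulrA ler_wpM2l//; apply: (le_trans (H k)).
by rewrite ler_wpM2l ?exprn_ge0// l1norm0.
Qed.

End orbit.

Lemma geometric_le0 (r M c : R) : 0 <= r < 1 -> (forall k, c <= M * r ^+ k) -> c <= 0.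
Proof.
move=> /andP[r0 r1] h.
have cv : (fun k => M * r ^+ k) @ \oo --> (M * 0 : R).
  by apply: cvgMr; apply: cvg_expr; rewrite ger0_norm.
rewrite mulr0 in cv; rewrite -(cvg_lim (@Rhausdorff R) cv).
by apply: limr_ge; [exact: cvgP cv|exact: nearW].
Qed.

Lemma ae_le_Rintegral (f g : R3 R -> R) : mu.-integrable setT (EFin \o f) ->
  mu.-integrable setT (EFin \o g) -> (forall x, 0 <= f x) -> (forall x, 0 <= g x) ->
  {ae mu, forall x, f x <= g x} -> \int[mu]_x f x <= \int[mu]_x g x.
Proof.
move=> fi gi f0 g0 fg; apply: fine_le.
- exact: integrable_fin_num.
- exact: integrable_fin_num.
- apply: ae_ge0_le_integral => //.
  + by move=> x _ /=; rewrite lee_fin.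
  + exact: measurable_int fi.
  + by move=> x _ /=; rewrite lee_fin.
  + exact: measurable_int gi.
  + by apply: filterS fg => x h _ /=; rewrite lee_fin.
Qed.

(** For [4 <= a] a vector of the cone with zero tail norm is zero. A positive integral therefore
    means that the field is non-zero and inside the cone on a set of positive measure. *)
Definition cone_part a (B : R3 R -> R3 R) k x : R :=
  tail_norm (cat_push a B k x) * (in_cone a (cat_push a B k x))%:R.

Lemma cone_part_ge0 a B k x : 0 <= cone_part a B k x.
Proof. by rewrite /cone_part mulr_ge0 ?tail_norm_ge0 ?ler0n. Qed.

Lemma measurable_tail_norm (disp : measure_display) (T : measurableType disp) (b : T -> R3 R) :
  measurable_fun setT b -> measurable_fun setT (fun y => tail_norm (b y)).
Proof.
move=> mb; apply: measurable_maxr.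
  exact: (measurableT_comp (@normr_measurable R setT) (measurable_coordT 1 mb)).
exact: (measurableT_comp (@normr_measurable R setT) (measurable_coordT 2 mb)).
Qed.

Lemma measurable_cone_part a B k : measurable_fun setT B ->
  measurable_fun setT (cone_part a B k).
Proof.
move=> mB; have mb := measurable_cat_push a k mB.
apply: measurable_funM; first exact: measurable_tail_norm.
have mi : measurable_fun setT (fun x => in_cone a (cat_push a B k x)).
  apply: measurable_fun_ler.
    exact: (measurableT_comp (@normr_measurable R setT) (measurable_coordT 0 mb)).
  by apply: measurable_funM => //; exact: measurable_tail_norm.
rewrite (_ : (fun x => _) = fun x => if in_cone a (cat_push a B k x) then 1 else 0).
  exact: (measurable_fun_ifT mi).
by apply/funext => x; case: (in_cone _ _).
Qed.

Lemma integrable_cat_push a B k : 0 <= a -> integrable_field mu B ->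
  integrable_field mu (cat_push a B k).
Proof.
move=> a0 iB; have [mB _] := iB.
apply: (dominated_integrable_field (C := (1 + a) ^+ k) iB).
  exact: measurable_cat_push.
move=> x; apply: l1norm_pushfield => s.
by rewrite normrM (ger0_norm a0) -[leRHS]mulr1 ler_wpM2l// hatD_le1.
Qed.

Lemma cone_part_le a B k x : cone_part a B k x <= l1norm (cat_push a B k x).
Proof.
rewrite /cone_part -[leRHS]mulr1 ler_pM ?tail_norm_ge0 ?ler0n ?tail_norm_l1norm//.
by case: (in_cone _ _); rewrite ?ler01.
Qed.

Lemma integrable_cone_part a B k : 0 <= a -> integrable_field mu B ->
  mu.-integrable setT (EFin \o cone_part a B k).
Proof.
move=> a0 iB; have [mB _] := iB.
apply: (dominated_integrable (C := 1) (integrable_cat_push k a0 iB)).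
  exact: measurable_cone_part.
by move=> x; rewrite mul1r ger0_norm ?cone_part_ge0// cone_part_le.
Qed.

Lemma ae_le_scaled_Rintegral (f g : R3 R -> R) (c c' : R) : 0 <= c -> 0 <= c' ->
  mu.-integrable setT (EFin \o f) -> mu.-integrable setT (EFin \o g) ->
  (forall x, 0 <= f x) -> (forall x, 0 <= g x) ->
  {ae mu, forall x, c * f x <= c' * g x} -> c * \int[mu]_x f x <= c' * \int[mu]_x g x.
Proof.
move=> c0 c'0 fi gi f0 g0 h; rewrite -!RintegralZl//.
apply: ae_le_Rintegral h.
- exact: (integrableZl measurableT c fi).
- exact: (integrableZl measurableT c' gi).
- by move=> x; rewrite mulr_ge0.
- by move=> x; rewrite mulr_ge0.
Qed.

Lemma l1norm_cat_pushD a B k j x : 0 <= a ->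
  l1norm (cat_push a B (k + j) x) <= (1 + a) ^+ j * l1norm (cat_push a B k x).
Proof.
move=> a0; elim: j => [|j IH]; first by rewrite addn0 expr0 mul1r.
rewrite addnS exprS -mulrA; apply: le_trans (_ : (1 + a) * l1norm (cat_push a B (k + j) x) <= _).
  apply: l1norm_stepD.
  by rewrite normrM (ger0_norm a0) -[leRHS]mulr1 ler_wpM2l// hatD_le1.
by rewrite ler_wpM2l// addr_ge0.
Qed.

(** The same constant must also serve the times before [k], treated in [growth_const_early]: the
    factor [A ^+ k] accounts for the largest possible growth up to time [k], and [2 ^+ k.+1] for the
    exponential. *)
Lemma growth_const (e A I : R) (k i m : nat) : 0 < e -> 1 <= A -> i = (m + k)%N ->
  2 ^+ m * e <= 2 * I -> e / (A ^+ k * 2 ^+ k.+1) * 2 ^+ i <= I.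
Proof.
move=> e0 A1 -> h.
have Ak : 1 <= A ^+ k by rewrite exprn_ege1.
have p : 0 < 2 ^+ k :> R by rewrite exprn_gt0.
rewrite mulrAC ler_pdivrMr; last by rewrite mulr_gt0 ?exprn_gt0// (lt_le_trans ltr01).
rewrite exprD exprS mulrA; move: h p Ak; have : 0 < 2 ^+ m :> R by rewrite exprn_gt0.
move: (2 ^+ m) (2 ^+ k) (A ^+ k) => q p B q0 h p0 B1.
have I0 : 0 <= I by move: h; have := mulr_gt0 q0 e0; move: (q * e) => *; lra.
have : q * e * p <= 2 * I * p by rewrite ler_wpM2r// ltW.
have : 2 * p * I <= 2 * p * (I * B) by apply: ler_wpM2l; [rewrite mulr_ge0 1?ltW|rewrite ler_peMr].
lra.
Qed.

Lemma growth_const_early (e A I : R) (k i : nat) : 0 < e -> 1 <= A -> (i < k)%N ->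
  e <= A ^+ k * I -> e / (A ^+ k * 2 ^+ k.+1) * 2 ^+ i <= I.
Proof.
move=> e0 A1 ik h.
have Ak : 0 < A ^+ k by rewrite exprn_gt0// (lt_le_trans ltr01).
have p : 0 < 2 ^+ k.+1 :> R by rewrite exprn_gt0.
have ip : 2 ^+ i <= 2 ^+ k.+1 :> R by rewrite ler_eXn2l ?ltr1n// (leq_trans (ltnW ik)).
rewrite mulrAC ler_pdivrMr; last by rewrite mulr_gt0.
rewrite mulrA [I * _]mulrC; apply: ler_pM => //; exact: ltW.
Qed.

(** Growth of the test functions against decay of the field: the product is 2 / s + 2 / s^4. *)
Lemma flux_rate_lt1 (s : R) : 4 <= s -> 0 <= (s + s ^- 2) * (2 / s ^+ 2) < 1.
Proof.
move=> s4; have s0 : 0 < s by lra.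
have v0 : 0 < s^-1 by rewrite invr_gt0.
have v1 : s^-1 <= 1 / 4 by rewrite div1r lef_pV2 ?posrE//; lra.
have E : (s + s ^- 2) * (2 / s ^+ 2) = 2 * s^-1 + 2 * s^-1 ^+ 4.
  by field; rewrite gt_eqF.
have v4 : s^-1 ^+ 4 <= 1 / 16.
  rewrite (_ : s^-1 ^+ 4 = (s^-1 ^+ 2) ^+ 2); last by rewrite -exprM.
  have : s^-1 ^+ 2 <= 1 / 16 by nra.
  have : 0 <= s^-1 ^+ 2 by exact: sqr_ge0.
  move: (s^-1 ^+ 2) => t *; nra.
have : 0 <= s^-1 ^+ 4 by rewrite exprn_ge0// ltW.
rewrite {}E; move: v0 v1 v4; move: (s^-1) (s^-1 ^+ 4) => u w *.
by apply/andP; split; lra.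
Qed.

Lemma rate_rearrange (C u v w : R) : C * u * (2 * v * w) = C * 2 * w * (u * v).
Proof. by ring. Qed.

Lemma cat_push_growth (s : R) (B : R3 R -> R3 R) : 4 <= s -> integrable_field mu B ->
  closed_pair mu B id -> ~ {ae mu, forall x, B x = 0} ->
  exists2 d : R, 0 < d & forall k, d * 2 ^+ k <= \int[mu]_x l1norm (cat_push (s ^+ 2) B k x).
Proof.
move=> s4 iB cB B0; set a := s ^+ 2.
have a16 : 16 <= a by rewrite /a; nra.
have a0 : 0 <= a by lra.
have reg := regular_ae a.
have ib k : mu.-integrable setT (EFin \o fun x => l1norm (cat_push a B k x)).
  by have [_] := integrable_cat_push k a0 iB.
have ic k := integrable_cone_part k a0 iB.
have c0 k x := cone_part_ge0 a B k x.
have b0 k x := l1norm_ge0 (cat_push a B k x).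
have [[k ck]|nc] := pselect (exists k, 0 < \int[mu]_x cone_part a B k x).
  have A1 : 1 <= 1 + a by lra.
  exists ((\int[mu]_x cone_part a B k x) / ((1 + a) ^+ k * 2 ^+ k.+1)).
    by rewrite divr_gt0// mulr_gt0 ?exprn_gt0// (lt_le_trans ltr01).
  move=> i; have [ki|ik] := leqP k i.
    apply: (growth_const (m := (i - k)%N)) => //; first by rewrite subnK.
    apply: ae_le_scaled_Rintegral => //.
    apply: filterS reg => x rx; rewrite /cone_part.
    case: (boolP (in_cone _ _)) => cx; last by rewrite !mulr0 mulr_ge0.
    have [_] := cat_push_in_cone a16 rx cx (i - k).
    rewrite subnKC// mulr1 => /le_trans; apply.
    by rewrite ler_wpM2l// tail_norm_l1norm.
  apply: growth_const_early => //; rewrite -[leLHS]mul1r.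
  apply: ae_le_scaled_Rintegral => //; first by rewrite exprn_ge0// (le_trans ler01).
  apply: filterS reg => x _; rewrite mul1r; apply: (le_trans (cone_part_le _ _ _ _)).
  rewrite -(subnKC (ltnW ik)); apply: (le_trans (l1norm_cat_pushD B i (k - i) x a0)).
  by rewrite ler_wpM2r// ler_eXn2l; rewrite ?leq_addl//; lra.
exfalso; apply: B0; apply: fluxes_eq0 => // F G tF tG.
apply/eqP; rewrite -normr_le0.
have s2 : 2 <= s by lra.
have [C C0 CP] := cat_flux_le mu s2 tF tG.
(* The vanishing holds for all times at once outside one null set, as the decay of an individual
   vector depends on its whole orbit. *)
have off : {ae mu, forall x, forall k, cone_part a B k x = 0}.
  apply: ae_foralln => k.
  have I0 : \int[mu]_x cone_part a B k x = 0.
    apply/eqP; rewrite eq_le; apply/andP; split; last first.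
      by apply: Rintegral_ge0 => x _.
    by rewrite leNgt; apply/negP => h; apply: nc; exists k.
  have : (\int[mu]_x `|(cone_part a B k x)%:E| = 0)%E.
    have /fineK E := integrable_fin_num measurableT (ic k).
    transitivity (\int[mu]_x (EFin \o cone_part a B k) x)%E.
      by apply: eq_integral => x _ /=; rewrite ger0_norm.
    rewrite -E; congr (_%:E); exact: I0.
  move/(ae_eq_integral_abs mu measurableT (measurable_int _ (ic k))).
  by apply: filterS => x h; have [] := h I.
have I0 : 0 <= \int[mu]_x l1norm (B x).
  by apply: Rintegral_ge0 => x _; exact: l1norm_ge0.
apply: (@geometric_le0 ((s + s ^- 2) * (2 / a)) (C * 2 * \int[mu]_x l1norm (B x))).
  exact: flux_rate_lt1.
move=> k; apply: (le_trans (CP k B iB cB reg)).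
have r0 : 0 <= 2 * (2 / a) ^+ k by rewrite mulr_ge0// exprn_ge0// divr_ge0.
have : 1 * \int[mu]_x l1norm (cat_push a B k x) <= 2 * (2 / a) ^+ k * \int[mu]_x l1norm (B x).
  apply: ae_le_scaled_Rintegral => //.
  - by have [] := iB.
  - by move=> x; exact: l1norm_ge0.
  apply: filterS2 reg off => x rx ox; rewrite mul1r.
  have tx j : in_cone a (cat_push a B j x) -> tail_norm (cat_push a B j x) = 0.
    by move=> cx; have := ox j; rewrite /cone_part cx mulr1.
  exact: (cat_push_off_cone a16 tx k).
rewrite mul1r (exprMn _ (s + s ^- 2)) => h.
have rho : 0 <= C * (s + s ^- 2) ^+ k.
  have s0 : 0 <= s by lra.
  by apply: mulr_ge0 => //; apply: exprn_ge0; rewrite addr_ge0// invr_ge0 exprn_ge0.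
apply: (le_trans (ler_wpM2l rho h)).
rewrite le_eqVlt; apply/orP; left; apply/eqP.
exact: rate_rearrange.
Qed.

End growth.

(** * The flow map *)

Section off_finite.
Variable R : realType.

(** The interval is split at each exceptional time, and continuity glues the pieces. *)
Lemma const_off_finite (f : R -> R) (s : seq R) : continuous f ->
  forall p q, p <= q ->
  (forall t, p < t < q -> t \notin s -> is_derive (t : R) (1 : R) f 0) -> f q = f p.
Proof.
move=> fc; elim: s => [|a s IH] p q pq h.
  have f1 (x : R) : x \in `]p, q[%R -> is_derive x 1 f ((cst 0 : R -> R) x).
    by rewrite in_itv /= => xpq; exact: h.
  have f2 : {within `[p, q], continuous f} by exact: continuous_subspaceT.
  have [c _ E] := MVT_segment pq f1 f2.
  by apply/eqP; rewrite -subr_eq0 E mul0r.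
have [/andP[pa aq]|apq] := boolP (p < a < q).
  transitivity (f a).
    apply: IH; first exact: ltW.
    move=> t /andP[at_ tq] ts; apply: h; first by rewrite tq (lt_trans pa).
    by rewrite inE (negbTE ts) orbF gt_eqF.
  apply: IH; first exact: ltW.
  move=> t /andP[pt ta] ts; apply: h; first by rewrite pt (lt_trans ta).
  by rewrite inE (negbTE ts) orbF lt_eqF.
apply: IH => // t tpq ts; apply: h => //; rewrite inE (negbTE ts) orbF.
by apply: contraNneq apq => <-.
Qed.

Lemma affine_off_finite (f : R -> R) (S : set R) (c p q : R) : continuous f ->
  finite_set (S `&` `[p, q]) ->
  (forall t, p < t < q -> ~ S t -> is_derive (t : R) (1 : R) f c) ->
  forall t, p <= t <= q -> f t = f p + (t - p) * c.
Proof.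
move=> fc /finite_seqP[s sE] h t /andP[pt tq].
pose g u := f u - u * c.
have gc : continuous g.
  move=> u; apply: cvgB; first exact: fc.
  by apply: cvgM; [exact: cvg_id|exact: cvg_cst].
suff : g t = g p by rewrite /g => E; lra.
apply: (const_off_finite (s := s) gc pt) => u /andP[pu ut] us.
have uS : ~ S u.
  move=> Su; move: us; have : [set` s] u.
    by rewrite -sE; split=> //=; rewrite in_itv/= !ltW// (lt_le_trans ut).
  by move=> /= ->.
have fu : is_derive (u : R) (1 : R) f c.
  by apply: h => //; rewrite pu (lt_le_trans ut).
have mu_ : is_derive (u : R) (1 : R) (fun u : R => u * c) c.
  have := is_deriveM (is_derive_id u (1 : R)) (is_derive_cst c u (1 : R)).
  by move=> /is_derive_eq; apply; rewrite scaler0 add0r /GRing.scale/= mulr1.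
by have := is_deriveB fu mu_; rewrite subrr.
Qed.

(** Explicit integration over a third of a period: two coordinates are frozen and the third is then
    affine in time. This is where uniqueness of the flow comes from. *)
Lemma shear_phase (f0 f1 f2 g : R -> R) (S : set R) (p q : R) :
  continuous f0 -> continuous f1 -> continuous f2 -> finite_set (S `&` `[p, q]) ->
  (forall t, p < t < q -> ~ S t -> [/\ is_derive (t : R) (1 : R) f0 (g (f1 t)),
     is_derive (t : R) (1 : R) f1 0 & is_derive (t : R) (1 : R) f2 0]) ->
  forall t, p <= t <= q ->
    [/\ f0 t = f0 p + (t - p) * g (f1 p), f1 t = f1 p & f2 t = f2 p].
Proof.
move=> c0 c1 c2 fS h.
have E1 t : p <= t <= q -> f1 t = f1 p.
  move=> tpq; rewrite (affine_off_finite c1 fS _ tpq (c := 0)) ?mulr0 ?addr0// => u upq uS.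
  by have [] := h u upq uS.
have E2 t : p <= t <= q -> f2 t = f2 p.
  move=> tpq; rewrite (affine_off_finite c2 fS _ tpq (c := 0)) ?mulr0 ?addr0// => u upq uS.
  by have [] := h u upq uS.
move=> t tpq; split; [|exact: E1|exact: E2].
apply: (affine_off_finite c0 fS _ tpq) => u upq uS.
have [h0 _ _] := h u upq uS; rewrite -(E1 u)//.
by case/andP: upq => /ltW -> /ltW ->.
Qed.

End off_finite.

(** * The flow over one period in closed form *)

Section turn.
Variable R : realType.
Variable a : R.
Implicit Types (x X : R3 R) (t c : R) (n : int).

Definition clamp c : R := Num.max 0 (Num.min 1 c).

Definition substep c : R3 R -> R3 R := step (fun u => c * (a * hat u)).
Definition substepV c : R3 R -> R3 R := stepV (fun u => c * (a * hat u)).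

(** All three substeps are present at every time. One that has not started is a bare cyclic
    permutation, and three permutations compose to the identity; clamping thus yields the identity
    for [t <= 0] and the time-one map for [t >= 1]. *)
Definition turn t x : R3 R :=
  substep (clamp (3 * t - 2)) (substep (clamp (3 * t - 1)) (substep (clamp (3 * t)) x)).
Definition turnV t x : R3 R :=
  substepV (clamp (3 * t)) (substepV (clamp (3 * t - 1)) (substepV (clamp (3 * t - 2)) x)).

Lemma substepVK c : cancel (substepV c) (substep c). Proof. exact: stepVK. Qed.

Lemma turnVK t : cancel (turnV t) (turn t).
Proof. by move=> x; rewrite /turn /turnV !substepVK. Qed.

Lemma clamp0 c : c <= 0 -> clamp c = 0.
Proof. by move=> c0; rewrite /clamp /Num.min; case: ltP => ?; rewrite /Num.max; case: ltP => ?; lra. Qed.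

Lemma clamp1 c : 1 <= c -> clamp c = 1.
Proof. by move=> c0; rewrite /clamp /Num.min; case: ltP => ?; rewrite /Num.max; case: ltP => ?; lra. Qed.

Lemma clamp_id c : 0 <= c <= 1 -> clamp c = c.
Proof. by move=> /andP[? ?]; rewrite /clamp /Num.min; case: ltP => ?; rewrite /Num.max; case: ltP => ?; lra. Qed.

Lemma clamp_itv c : 0 <= clamp c <= 1.
Proof. by apply/andP; rewrite /clamp /Num.min; case: ltP => ?; rewrite /Num.max; case: ltP => ?; lra. Qed.

Lemma clamp_continuous : continuous clamp.
Proof.
move=> c; apply: (@continuous_max _ _ (cst 0) (fun c => Num.min 1 c)); first exact: cvg_cst.
apply: (@continuous_min _ _ (cst 1) id); [exact: cvg_cst|exact: cvg_id].
Qed.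

Lemma substep0 x : substep 0 x = (x.1.2, x.2, x.1.1).
Proof. by rewrite /substep /step mul0r addr0. Qed.

Lemma turn_0 x t : t <= 0 -> turn t x = x.
Proof.
move=> t0; rewrite /turn (@clamp0 (3 * t)); last by lra.
rewrite (@clamp0 (3 * t - 1)); last by lra.
rewrite (@clamp0 (3 * t - 2)); last by lra.
by rewrite !substep0; case: x => [[]].
Qed.

Lemma turn_first x t : 0 <= t <= 1 / 3 ->
  turn t x = vec3 (x.1.1 + t * (3 * a * hat x.1.2)) x.1.2 x.2.
Proof.
move=> /andP[t0 t1]; rewrite /turn (clamp_id (c := 3 * t)); last by apply/andP; split; lra.
rewrite (@clamp0 (3 * t - 1)); last by lra.
rewrite (@clamp0 (3 * t - 2)); last by lra.
rewrite !substep0 /substep /step /vec3 /=; congr (_ + _, _, _); ring.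
Qed.

Lemma turn_second x t : 1 / 3 <= t <= 2 / 3 ->
  turn t x = let y := turn (1 / 3) x in
    vec3 y.1.1 (y.1.2 + (t - 1 / 3) * (3 * a * hat y.2)) y.2.
Proof.
move=> /andP[t0 t1]; rewrite /turn (@clamp1 (3 * t)); last by lra.
rewrite (clamp_id (c := 3 * t - 1)); last by apply/andP; split; lra.
rewrite (@clamp0 (3 * t - 2)); last by lra.
rewrite (@clamp1 (3 * (1 / 3))); last by lra.
rewrite (@clamp0 (3 * (1 / 3) - 1)); last by lra.
rewrite (@clamp0 (3 * (1 / 3) - 2)); last by lra.
rewrite !substep0 /substep /step /vec3 /=; congr (_, _ + _, _); lra.
Qed.

Lemma turn_third x t : 2 / 3 <= t <= 1 ->
  turn t x = let y := turn (2 / 3) x in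
    vec3 y.1.1 y.1.2 (y.2 + (t - 2 / 3) * (3 * a * hat y.1.1)).
Proof.
move=> /andP[t0 t1]; rewrite /turn (@clamp1 (3 * t)); last by lra.
rewrite (@clamp1 (3 * t - 1)); last by lra.
rewrite (clamp_id (c := 3 * t - 2)); last by apply/andP; split; lra.
rewrite (@clamp1 (3 * (2 / 3))); last by lra.
rewrite (@clamp1 (3 * (2 / 3) - 1)); last by lra.
rewrite (@clamp0 (3 * (2 / 3) - 2)); last by lra.
rewrite !substep0 /substep /step /vec3 /=; congr (_, _, _ + _); lra.
Qed.

Lemma turn_1 x t : 1 <= t -> turn t x = iter 3 (cat_step a) x.
Proof.
move=> t1; rewrite /turn (@clamp1 (3 * t)); last by lra.
rewrite (@clamp1 (3 * t - 1)); last by lra.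
rewrite (@clamp1 (3 * t - 2)); last by lra.
have E y : substep 1 y = cat_step a y by rewrite /substep /cat_step /step mul1r.
by rewrite !E.
Qed.

End turn.

Section curves.
Variable R : realType.

Lemma is_derive_diffV (V : normedModType R) (f : R -> V) (s : R) (d : V) :
  is_derive s (1 : R) f d -> is_diff s f (fun v => v *: d).
Proof.
move=> [fs fd]; have ds : differentiable f s by exact/derivable1_diffP.
split=> //; apply/funext => v.
by rewrite diff1E//= derive1E fd.
Qed.

Lemma is_derive_coord (f : R -> R3 R) (s : R) (d : R3 R) j :
  is_derive s (1 : R) f d -> is_derive s (1 : R) (fun u => coord j (f u)) (coord j d).
Proof.
move=> /is_derive_diffV fd.
have := is_diff_derive (1 : R) (is_diff_comp fd (coord_is_diff j (f s))).
by rewrite /= scale1r.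
Qed.

Lemma is_derive_vec3 (f0 f1 f2 : R -> R) (s d0 d1 d2 : R) :
  is_derive s (1 : R) f0 d0 -> is_derive s (1 : R) f1 d1 -> is_derive s (1 : R) f2 d2 ->
  is_derive s (1 : R) (fun u => vec3 (f0 u) (f1 u) (f2 u)) (vec3 d0 d1 d2).
Proof.
move=> /is_derive_diff h0 /is_derive_diff h1 /is_derive_diff h2.
have := is_diff_derive (1 : R) (is_diff_pair (is_diff_pair h0 h1) h2).
by rewrite /= !mul1r.
Qed.

Lemma is_derive_affine (A B p s : R) : is_derive s (1 : R) (fun u => A + (u - p) * B) B.
Proof.
have h0 : is_derive s (1 : R) (fun u : R => u - p) 1.
  have := is_deriveB (is_derive_id s (1 : R)) (is_derive_cst p s (1 : R)).
  by move=> /is_derive_eq; apply; rewrite subr0.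
have h1 : is_derive s (1 : R) (fun u : R => (u - p) * B) B.
  have := is_deriveM h0 (is_derive_cst B s (1 : R)).
  by move=> /is_derive_eq; apply; rewrite scaler0 add0r /GRing.scale/= mulr1.
have := is_deriveD (is_derive_cst A s (1 : R)) h1.
by move=> /is_derive_eq; apply; rewrite add0r.
Qed.

Lemma coord_continuous j : continuous (@coord R j).
Proof.
move=> x; apply: differentiable_continuous; have [] := coord_is_diff j x; done.
Qed.

Lemma coord_curve_continuous (f : R -> R3 R) j : continuous f ->
  continuous (fun t => coord j (f t)).
Proof. by move=> fc t; apply: continuous_comp; [exact: fc|exact: coord_continuous]. Qed.

Lemma vec3_continuous (f0 f1 f2 : R -> R) : continuous f0 -> continuous f1 ->
  continuous f2 -> continuous (fun s => vec3 (f0 s) (f1 s) (f2 s)).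
Proof.
by move=> c0 c1 c2 s; exact: (cvg_pair (cvg_pair (c0 s) (c1 s)) (c2 s)).
Qed.

Lemma substep_continuous (a : R) (c : R -> R) (X : R -> R3 R) :
  continuous c -> continuous X -> continuous (fun s => substep a (c s) (X s)).
Proof.
move=> cc cX.
have c0 := coord_curve_continuous (j := 0%N) cX; have c1 := coord_curve_continuous (j := 1%N) cX.
have c2 := coord_curve_continuous (j := 2%N) cX.
apply: (vec3_continuous c1 c2) => s; apply: cvgD; first exact: c0.
apply: cvgM; first exact: cc.
apply: cvgM; first exact: cvg_cst.
exact: (continuous_comp (c1 s) (@hat_continuous R _)).
Qed.

Lemma turn_continuous (a : R) (c : R -> R) (X : R -> R3 R) :
  continuous c -> continuous X -> continuous (fun s => turn a (c s) (X s)).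
Proof.
move=> cc cX.
have k0 : continuous (fun s => 3 * c s).
  by move=> s; apply: cvgM; [exact: cvg_cst|exact: cc].
have k b : continuous (fun s => 3 * c s - b).
  by move=> s; apply: cvgB; [exact: k0|exact: cvg_cst].
have h0 : continuous (fun s => clamp (3 * c s)).
  by move=> s; exact: (continuous_comp (k0 s) (@clamp_continuous R _)).
have h b : continuous (fun s => clamp (3 * c s - b)).
  by move=> s; exact: (continuous_comp (k b s) (@clamp_continuous R _)).
apply: substep_continuous; first exact: h.
apply: substep_continuous; first exact: h.
exact: substep_continuous.
Qed.

End curves.

Section flow.
Variable R : realType.
Variable a : R.
Implicit Types (x X : R3 R) (t s : R) (n : int).

Lemma velocity_first n t x : n%:~R <= t < n%:~R + 1 / 3 ->
  velocity a t x = vec3 (3 * a * hat x.1.2) 0 0.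
Proof.
move=> /andP[h1 h2]; rewrite /velocity (@floor_def _ t n); last first.
  by rewrite intrD; apply/andP; split; lra.
by rewrite ifT//; lra.
Qed.

Lemma velocity_second n t x : n%:~R + 1 / 3 <= t < n%:~R + 2 / 3 ->
  velocity a t x = vec3 0 (3 * a * hat x.2) 0.
Proof.
move=> /andP[h1 h2]; rewrite /velocity (@floor_def _ t n); last first.
  by rewrite intrD; apply/andP; split; lra.
rewrite ifF; last by apply/negbTE; rewrite -leNgt; lra.
by rewrite ifT//; lra.
Qed.

Lemma velocity_third n t x : n%:~R + 2 / 3 <= t < n%:~R + 1 ->
  velocity a t x = vec3 0 0 (3 * a * hat x.1.1).
Proof.
move=> /andP[h1 h2]; rewrite /velocity (@floor_def _ t n); last first.
  by rewrite intrD; apply/andP; split; lra.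
rewrite ifF; last by apply/negbTE; rewrite -leNgt; lra.
by rewrite ifF//; apply/negbTE; rewrite -leNgt; lra.
Qed.

(** Stated for an arbitrary flow, because [flow_map] selects one by choice. Each third of the period
    is [shear_phase] with the coordinates permuted cyclically. *)
Lemma flow_turn psi : is_flow (velocity a) psi -> forall n t x,
  n%:~R <= t <= n%:~R + 1 -> psi t x = turn a (t - n%:~R) (psi n%:~R x).
Proof.
move=> [_ pc [S fS dS]] n t x.
have c j := coord_curve_continuous (j := j) (pc x).
have d j u (uS : ~ S u) := is_derive_coord j (dS u uS x).
have E u : psi u x = vec3 (coord 0 (psi u x)) (coord 1 (psi u x)) (coord 2 (psi u x)).
  by rewrite /vec3 /coord /=; case: (psi u x) => [[]].
pose g s := 3 * a * hat s.
have P1 u : n%:~R <= u <= n%:~R + 1 / 3 -> psi u x = turn a (u - n%:~R) (psi n%:~R x).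
  move=> un; have [] := shear_phase (g := g) (c 0%N) (c 1%N) (c 2%N) (fS _ _) _ un.
    move=> v vn vS; have V := @velocity_first n v (psi v x).
    have := (d 0%N v vS, d 1%N v vS, d 2%N v vS); rewrite V//.
      by move=> [[]].
    by case/andP: vn => /ltW -> ->.
  move=> e0 e1 e2; rewrite turn_first; last by case/andP: un => *; apply/andP; split; lra.
  by rewrite E e0 e1 e2.
have P2 u : n%:~R + 1 / 3 <= u <= n%:~R + 2 / 3 -> psi u x = turn a (u - n%:~R) (psi n%:~R x).
  move=> un; have [] := shear_phase (g := g) (c 1%N) (c 2%N) (c 0%N) (fS _ _) _ un.
    move=> v vn vS; have V := @velocity_second n v (psi v x).
    have := (d 0%N v vS, d 1%N v vS, d 2%N v vS); rewrite V//.
      by move=> [[]].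
    by case/andP: vn => /ltW -> ->.
  move=> e0 e1 e2; rewrite turn_second; last by case/andP: un => *; apply/andP; split; lra.
  have : psi (n%:~R + 1 / 3) x = turn a (1 / 3) (psi n%:~R x).
    by rewrite P1; [congr turn; lra|apply/andP; split; lra].
  move=> <-; rewrite E e0 e1 e2 /vec3 /=; congr (_, _ + _ * _, _); lra.
have P3 u : n%:~R + 2 / 3 <= u <= n%:~R + 1 -> psi u x = turn a (u - n%:~R) (psi n%:~R x).
  move=> un; have [] := shear_phase (g := g) (c 2%N) (c 0%N) (c 1%N) (fS _ _) _ un.
    move=> v vn vS; have V := @velocity_third n v (psi v x).
    have := (d 0%N v vS, d 1%N v vS, d 2%N v vS); rewrite V//.
      by move=> [[]].
    by case/andP: vn => /ltW -> ->.
  move=> e0 e1 e2; rewrite turn_third; last by case/andP: un => *; apply/andP; split; lra.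
  have : psi (n%:~R + 2 / 3) x = turn a (2 / 3) (psi n%:~R x).
    by rewrite P2; [congr turn; lra|apply/andP; split; lra].
  move=> <-; rewrite E e0 e1 e2 /vec3 /=; congr (_, _, _ + _ * _); lra.
move=> /andP[h1 h2]; have [h|h] := leP t (n%:~R + 1 / 3).
  by apply: P1; rewrite h1.
have [k|k] := leP t (n%:~R + 2 / 3).
  by apply: P2; rewrite k ltW.
by apply: P3; rewrite h2 ltW.
Qed.

End flow.

Section flow_existence.
Variable R : realType.
Variable a : R.
Implicit Types (x X : R3 R) (t s : R) (n m : int).

Definition iterz n x : R3 R :=
  match n with
  | Posz k => iter k (turn a 1) x
  | Negz k => iter k.+1 (turnV a 1) x
  end.

Lemma iterzS n x : iterz (n + 1) x = turn a 1 (iterz n x).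
Proof.
case: n => [k|k]; first by rewrite -PoszD addn1.
have -> : Negz k + 1 = - k%:Z by lia.
by case: k => [|k] /=; rewrite -?NegzE/= turnVK.
Qed.

(* The flow for all real times: [flow_map] is only determined once a flow on the
   whole real line is known to exist. *)
Definition turning_flow t x : R3 R :=
  turn a (t - (Num.floor t)%:~R) (iterz (Num.floor t) x).

Lemma turn_ge1 t x : 1 <= t -> turn a t x = turn a 1 x.
Proof. by move=> t1; rewrite !turn_1. Qed.

(** One expression covers two consecutive periods, since the first turn saturates at the time-one
    map before the second leaves the identity. Continuity at integer times follows from it. *)
Lemma turning_flowE m t x : m%:~R <= t < m%:~R + 2 ->
  turning_flow t x = turn a (t - (m + 1)%:~R) (turn a (t - m%:~R) (iterz m x)).
Proof.
move=> /andP[h1 h2]; rewrite /turning_flow; have [h|h] := ltP t (m%:~R + 1).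
  rewrite (@floor_def _ t m); last by rewrite intrD h1.
  by rewrite [RHS]turn_0// intrD; lra.
rewrite (@floor_def _ t (m + 1)); last first.
  by rewrite !intrD; apply/andP; split; lra.
by rewrite [turn a (t - m%:~R) _]turn_ge1 ?iterzS//; lra.
Qed.

Lemma turning_flow_local m t s x : m%:~R < t < m%:~R + 1 -> `|s - t| < t - m%:~R ->
  `|s - t| < m%:~R + 1 - t -> turning_flow s x = turn a (s - m%:~R) (iterz m x).
Proof.
move=> h h1 h2; rewrite /turning_flow (@floor_def _ s m)// intrD.
move: h1 h2; rewrite !ltr_norml => /andP[? ?] /andP[? ?].
by apply/andP; split; lra.
Qed.

Lemma near_ball t (d : R) (P : R -> Prop) : 0 < d ->
  (forall s, `|s - t| < d -> P s) -> \forall s \near t, P s.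
Proof.
move=> d0 h; near=> s; apply: h; rewrite distrC.
by near: s; apply/nbhs_ballP; exists d.
Unshelve. all: by end_near. Qed.

Lemma turning_flow_continuous x : continuous (fun t => turning_flow t x).
Proof.
(* With this shift [t] lies at distance at least 1/2 from both ends of the window [m, m + 2). *)
move=> t; pose m := Num.floor (t - 1 / 2).
have /andP[m1 m2] := floor_itv (t - 1 / 2); rewrite intrD -/m in m1 m2.
pose E s := turn a (s - (m + 1)%:~R) (turn a (s - m%:~R) (iterz m x)).
have cB (c : R) : continuous (fun s : R => s - c).
  by move=> s; apply: cvgB; [exact: cvg_id|exact: cvg_cst].
have cE : continuous E.
  apply: turn_continuous; first exact: cB.
  by apply: turn_continuous; [exact: cB|move=> s; exact: cvg_cst].
have nE s : `|s - t| < 1 / 2 -> E s = turning_flow s x.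
  rewrite ltr_norml => /andP[? ?]; rewrite (turning_flowE (m := m))//.
  by apply/andP; split; lra.
have Et : E t = turning_flow t x by rewrite nE// subrr normr0; lra.
rewrite /continuous_at -Et.
have := cE t; apply: cvg_trans; apply: near_eq_cvg.
by apply: (near_ball (d := 1 / 2)) => //; lra.
Qed.

Definition switching_times : set R := [set t | exists i : int, 3 * t = i%:~R].

Lemma switching_times_finite p q : finite_set (switching_times `&` `[p, q]).
Proof.
pose m := Num.floor (3 * p); pose N := `|Num.floor (3 * q) - m|%N.+1.
apply: (sub_finite_set (B := (fun k : nat => (m + k%:Z)%:~R / 3 : R) @` `I_N)); last first.
  by apply: finite_image; exact: finite_II.
move=> t [[i ti]] /=; rewrite in_itv/= => /andP[pt tq].
have mi : (m <= i)%R.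
  have : (m%:~R : R) <= 3 * p by exact: floor_le.
  by move=> h; rewrite -(ler_int R) -ti; lra.
have iq : (i <= Num.floor (3 * q))%R by rewrite floor_ge_int -ti; lra.
exists `|i - m|%N; first by rewrite /N /=; lia.
have -> : m + `|i - m|%N%:Z = i by lia.
by rewrite -ti; lra.
Qed.

Lemma turning_flow_is_flow : is_flow (velocity a) turning_flow.
Proof.
split.
- by move=> x; rewrite /turning_flow floor0 turn_0// subrr.
- exact: turning_flow_continuous.
exists switching_times; first exact: switching_times_finite.
move=> t tS x; pose n := Num.floor t; pose X := iterz n x.
have /andP[n1 n2] := floor_itv t; rewrite intrD -/n in n1 n2.
have tn i : t != n%:~R + i%:~R / 3.
  apply/eqP => E; apply: tS; exists (n * 3 + i).
  by rewrite intrD intrM E /=; lra.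
have t0 : n%:~R < t.
  by rewrite lt_neqAle n1 andbT eq_sym; have := tn 0; rewrite mul0r addr0.
have t1 : t != n%:~R + 1 / 3 by exact: (tn 1).
have t2 : t != n%:~R + 2 / 3 by exact: (tn 2).
have E s : `|s - t| < t - n%:~R -> `|s - t| < n%:~R + 1 - t ->
    turning_flow s x = turn a (s - n%:~R) X.
  by apply: turning_flow_local; apply/andP; split; lra.
have Et : turning_flow t x = turn a (t - n%:~R) X by apply: E; rewrite subrr normr0; lra.
have [h|h|/eqP] := ltgtP t (n%:~R + 1 / 3); last by rewrite (negbTE t1).
- rewrite (@velocity_first R a n); last by apply/andP; split; lra.
  rewrite Et turn_first; last by apply/andP; split; lra.
  pose B := 3 * a * hat X.1.2.
  apply: (near_eq_is_derive (f := fun s => vec3 (X.1.1 + (s - n%:~R) * B) X.1.2 X.2)).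
    apply: (near_ball (d := Num.min (t - n%:~R) (n%:~R + 1 / 3 - t))).
      by rewrite lt_min; apply/andP; split; lra.
    move=> s; rewrite lt_min => /andP[h1 h2].
    rewrite E//; last by lra.
    rewrite turn_first//; move: h1 h2; rewrite !ltr_norml => /andP[? ?] /andP[? ?].
    by apply/andP; split; lra.
  by apply: is_derive_vec3; first exact: is_derive_affine.
have [k|k|/eqP] := ltgtP t (n%:~R + 2 / 3); last by rewrite (negbTE t2).
- rewrite (@velocity_second R a n); last by apply/andP; split; lra.
  rewrite Et turn_second; last by apply/andP; split; lra.
  pose Y := turn a (1 / 3) X; pose B := 3 * a * hat Y.2.
  apply: (near_eq_is_derive (f := fun s => vec3 Y.1.1 (Y.1.2 + (s - (n%:~R + 1 / 3)) * B) Y.2)).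
    apply: (near_ball (d := Num.min (t - (n%:~R + 1 / 3)) (n%:~R + 2 / 3 - t))).
      by rewrite lt_min; apply/andP; split; lra.
    move=> s; rewrite lt_min => /andP[h1 h2].
    rewrite E; [|by lra|by lra].
    have sI : 1 / 3 <= s - n%:~R <= 2 / 3.
      by move: h1 h2; rewrite !ltr_norml => /andP[? ?] /andP[? ?]; apply/andP; split; lra.
    by rewrite (turn_second _ _ sI) -/Y opprD addrA.
  by apply: is_derive_vec3; first exact: is_derive_affine.
- rewrite (@velocity_third R a n); last by apply/andP; split; lra.
  rewrite Et turn_third; last by apply/andP; split; lra.
  pose Y := turn a (2 / 3) X; pose B := 3 * a * hat Y.1.1.
  apply: (near_eq_is_derive (f := fun s => vec3 Y.1.1 Y.1.2 (Y.2 + (s - (n%:~R + 2 / 3)) * B))).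
    apply: (near_ball (d := Num.min (t - (n%:~R + 2 / 3)) (n%:~R + 1 - t))).
      by rewrite lt_min; apply/andP; split; lra.
    move=> s; rewrite lt_min => /andP[h1 h2].
    rewrite E; [|by lra|by lra].
    have sI : 2 / 3 <= s - n%:~R <= 1.
      by move: h1 h2; rewrite !ltr_norml => /andP[? ?] /andP[? ?]; apply/andP; split; lra.
    by rewrite (turn_third _ _ sI) -/Y opprD addrA.
  by apply: is_derive_vec3; last exact: is_derive_affine.
Qed.

Lemma iter_turn1 k x : iter k (turn a 1) x = iter (3 * k) (cat_step a) x.
Proof.
elim: k => [//|k IH]; rewrite iterS IH turn_1// mulnS; by rewrite [RHS]iterD.
Qed.

(** [turning_flow] guarantees that the choice in [flow_map] returns a flow, and [flow_turn]
    determines the values of any flow. *)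
Lemma flow_mapE (k : nat) t x : k%:R <= t <= k%:R + 1 ->
  flow_map (velocity a) t x = turn a (t - k%:R) (iter (3 * k) (cat_step a) x).
Proof.
have fl : is_flow (velocity a) (flow_map (velocity a)).
  apply: getI; exact: turning_flow_is_flow.
have H j : flow_map (velocity a) j%:R x = iter j (turn a 1) x.
  elim: j => [|j IH]; first by have [] := fl.
  rewrite (flow_turn fl (n := j)); last by rewrite -natr1; apply/andP; split; lra.
  by rewrite -pmulrn IH iterS -natr1; congr (turn a _ _); lra.
move=> kt; rewrite (flow_turn fl (n := k))// -pmulrn H iter_turn1 //.
Qed.

End flow_existence.

(** * Lower bounds for Lebesgue norms *)

Section Lnorm_bounds.
Context (d : measure_display) (T : measurableType d) (R : realType).
Variable mu : {measure set T -> \bar R}.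
Local Open Scope ereal_scope.

(** The solution takes unspecified values where the flow is not differentiable, so its norm is
    compared without measurability: the integral of a non-negative function is a supremum over the
    simple functions below it. *)
Lemma ge0_le_integral_nonmeasurable (f g : T -> \bar R) : (forall x, 0 <= f x) ->
  (forall x, f x <= g x) -> \int[mu]_x f x <= \int[mu]_x g x.
Proof.
move=> f0 fg; rewrite !ge0_integralTE//; last by move=> x; exact: le_trans (fg x).
apply: le_ereal_sup => _ [h hf <-]; exists h => //= x.
exact: le_trans (hf x) (fg x).
Qed.

Lemma le_Lnorm (p : \bar R) (f g : T -> R) : 1 <= p -> (forall x, (0 <= f x)%R) ->
  (forall x, (f x <= g x)%R) -> 'N[mu]_p[EFin \o f] <= 'N[mu]_p[EFin \o g].
Proof.
move=> + f0 fg; have g0 x : (0 <= g x)%R by exact: le_trans (fg x).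
rewrite unlock /Lnorm; case: p => [r| |//].
- rewrite lee_fin => r1; have r0 : (0 <= r)%R by exact: le_trans r1.
  have I0 (h : T -> R) : (\int[mu]_x (`|(EFin \o h) x| `^ r))%E \in `[0%E, +oo%E].
    rewrite in_itv/= leey andbT; apply: integral_ge0 => x _.
    by rewrite lee_fin powR_ge0.
  apply: gt0_ler_poweR; [by rewrite invr_ge0|exact: I0|exact: I0|].
  apply: ge0_le_integral_nonmeasurable => x; first exact: poweR_ge0.
  by rewrite /= lee_fin !ger0_norm// ge0_ler_powR// nnegrE.
- move=> _; case: ifPn => // _; apply: le_ess_sup; apply: nearW => x /=.
  by rewrite lee_fin !ger0_norm.
Qed.

Lemma integral_le_Lnorm (p : \bar R) : mu setT < +oo -> 1 <= p ->
  exists2 K : R, (0 < K)%R & forall f : T -> R, measurable_fun setT f ->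
    (forall x, (0 <= f x)%R) -> \int[mu]_x (f x)%:E <= K%:E * 'N[mu]_p[EFin \o f].
Proof.
move=> muT; have mufin : mu setT \is a fin_num by rewrite ge0_fin_numE.
case: p => [p| |//].
- rewrite lee_fin le_eqVlt => /predU1P[<-|p1].
    exists 1%R => // f mf f0; rewrite mul1e Lnorm1.
    by rewrite le_eqVlt; apply/orP; left; apply/eqP; apply: eq_integral => x _ /=; rewrite ger0_norm.
  have p0 : (0 < p)%R by exact: lt_trans p1.
  pose q := ((1 - p^-1)^-1)%R.
  have q0 : (0 < q)%R by rewrite invr_gt0 subr_gt0 invf_lt1.
  have pq : (p^-1 + q^-1 = 1)%R by rewrite /q invrK subrKC.
  pose N : \bar R := 'N[mu]_q%:E[cst 1].
  have Nfin : N \is a fin_num by rewrite /N Lnorm_cst1 fin_num_poweR.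
  have N0 : (0 <= fine N)%R by rewrite fine_ge0// Lnorm_ge0.
  (* Adding 1 keeps the constant positive even if [mu] is zero. *)
  exists (fine N + 1)%R; first by rewrite ltr_wpDl.
  move=> f mf f0.
  have m1 : measurable_fun setT (cst 1 : T -> R)%R by exact: measurable_cst.
  have := hoelder mu mf m1 p0 q0 pq; rewrite Lnorm1 => H.
  apply: (@le_trans _ _ ('N[mu]_p%:E[EFin \o f] * N)).
    apply: le_trans H; rewrite le_eqVlt; apply/orP; left; apply/eqP.
    by apply: eq_integral => x _ /=; rewrite mulr1 ger0_norm.
  rewrite muleC lee_wpmul2r ?Lnorm_ge0//.
  by rewrite -[X in X <= _]fineK// lee_fin lerDl.
- move=> _; have m0 : (0 <= fine (mu setT))%R by rewrite fine_ge0.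
  exists (fine (mu setT) + 1)%R; first by rewrite ltr_wpDl.
  (* On a space of measure zero the norm of exponent [+oo] is 0 by convention; the integral vanishes
     as well. *)
  move=> f mf f0; rewrite unlock /Lnorm; case: ifPn => [mT|]; last first.
    rewrite -leNgt => mT; rewrite mule0.
    have mT0 : mu setT = 0 by apply/eqP; rewrite eq_le mT measure_ge0.
    apply: (@le_trans _ _ (\int[mu]_x (cst 0 x))); last by rewrite integral0.
    apply: ae_ge0_le_integral => //.
    + by move=> x _; rewrite lee_fin.
    + exact/measurable_EFinP.
    + by exists setT.
  have Mf := ess_sup_ge mu (abse \o (EFin \o f)).
  have M0 : 0 <= ess_sup mu (abse \o (EFin \o f)).
    by apply: ess_sup_gee => //; apply: nearW => x /=; rewrite lee_fin.
  move: Mf M0; case: (ess_sup _ _) => [r| |//] Mf; last first.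
    by move=> _; rewrite gt0_muley ?leey// lte_fin ltr_wpDl.
  rewrite lee_fin => r0; apply: (@le_trans _ _ (\int[mu]_x (cst r%:E) x)).
    apply: ae_ge0_le_integral => //.
    + by move=> x _; rewrite lee_fin.
    + exact/measurable_EFinP.
    + by move: Mf; apply: filterS => x /= h _; move: h; rewrite ger0_norm.
  rewrite integral_cst// muleC lee_wpmul2r ?lee_fin//.
  by rewrite -[X in X <= _]fineK// lee_fin lerDl.
Qed.

Lemma Lnorm_integrable (p : \bar R) (f : T -> R) : mu setT < +oo -> 1 <= p ->
  measurable_fun setT f -> 'N[mu]_p[EFin \o f] < +oo -> mu.-integrable setT (EFin \o f).
Proof.
move=> muT p1 mf fp; apply/Lfun1_integrable.
apply: (Lfun_subset (q := p)) => //; first by rewrite ge0_fin_numE.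
by rewrite inE; apply/andP; split; rewrite inE.
Qed.

End Lnorm_bounds.

(** * Differential of the flow at regular points *)

Section turn_differential.
Variable R : realType.
Variable a : R.
Implicit Types (x v : R3 R) (t c : R).

Lemma hat_is_derive (s : R) : sin s != 0 -> is_derive s (1 : R) (@hat R) (hatD s).
Proof.
move=> s0; rewrite (_ : @hat R = soft_hat 1); last by apply/funext => u; rewrite hat_soft.
by apply: soft_hat_derive; exact: sin_neq0_cos2.
Qed.

Lemma scaled_hat_is_derive c (s : R) : c = 0 \/ sin s != 0 ->
  is_derive s (1 : R) (fun u => c * (a * hat u)) (c * (a * hatD s)).
Proof.
case=> [->|s0].
  rewrite mul0r (_ : (fun _ => _) = cst 0); first exact: is_derive_cst.
  by apply/funext => u; rewrite mul0r.
have := is_deriveM (is_derive_cst (c * a) s (1 : R)) (hat_is_derive s0).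
rewrite scaler0 addr0 mulrA => h.
by rewrite (_ : (fun _ => _) = (fun=> c * a) * @hat R)//; apply/funext => u; rewrite mulrA.
Qed.

Lemma cat_step_is_diff x : sin x.1.2 != 0 ->
  is_diff x (cat_step a) (stepD (a * hatD x.1.2)).
Proof.
move=> sx; apply: step_is_diff.
have := scaled_hat_is_derive (c := 1) (or_intror sx); rewrite mul1r.
by rewrite (_ : (fun _ => _) = (fun u => a * hat u))//; apply/funext => u; rewrite mul1r.
Qed.

(** The transported vector depends on the field only through its value at [x]; as a function of that
    value it is the differential of the iterate. *)
Lemma cat_push_cst B k x : cat_push a B k x = cat_push a (fun=> B x) k x.
Proof. by elim: k => [//|k IH]; rewrite /cat_push /= -!/(cat_push _ _ _ _) IH. Qed.

Lemma iter_cat_step_is_diff k x : regular a x ->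
  is_diff x (iter k (cat_step a)) (fun v => cat_push a (fun=> v) k x).
Proof.
move=> rx; elim: k => [|k IH]; first exact: is_diff_id.
exact: (is_diff_comp IH (cat_step_is_diff (rx k))).
Qed.

Lemma substep_is_diff c x : c = 0 \/ sin x.1.2 != 0 ->
  is_diff x (substep a c) (stepD (c * (a * hatD x.1.2))).
Proof. by move=> h; apply: step_is_diff; exact: scaled_hat_is_derive. Qed.

Lemma l1norm_stepD_ge (d C : R) v : `|d| <= C -> l1norm v <= (1 + C) * l1norm (stepD d v).
Proof.
move=> dC; rewrite /l1norm /stepD /=.
have h : `|v.1.1| <= `|v.1.1 + v.1.2 * d| + C * `|v.1.2|.
  rewrite -{1}(addrK (v.1.2 * d) v.1.1); apply: (le_trans (ler_normB _ _)).
  by rewrite lerD2l normrM mulrC ler_wpM2r.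
move: h (normr_ge0 d) (normr_ge0 v.1.1) (normr_ge0 v.1.2) (normr_ge0 v.2)
  (normr_ge0 (v.1.1 + v.1.2 * d)) dC.
move: `|d| `|v.1.1| `|v.1.2| `|v.2| `|v.1.1 + _| => e n1 n2 n3 n4 *; nra.
Qed.

Lemma scaled_hatD_le c s : 0 <= a -> 0 <= c <= 1 -> `|c * (a * hatD s)| <= a.
Proof.
move=> a0 /andP[c0 c1]; rewrite normrM (normrM a) (ger0_norm a0) (ger0_norm c0).
have h : a * `|hatD s| <= a * 1 by rewrite ler_wpM2l// hatD_le1.
rewrite mulr1 in h; apply: (le_trans _ h).
by apply: ler_piMl => //; rewrite mulr_ge0.
Qed.

(* While a substep has not started its shear vanishes; once it has, the previous
   ones are complete, so that it acts at a point of the orbit of [cat_step]. *)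
Lemma turn_is_diff t x : 0 <= a -> regular a x -> exists2 L : R3 R -> R3 R,
  is_diff x (turn a t) L & forall v, l1norm v <= (1 + a) ^+ 3 * l1norm (L v).
Proof.
move=> a0 rx; rewrite /turn.
set c1 := clamp (3 * t); set c2 := clamp (3 * t - 1); set c3 := clamp (3 * t - 2).
have E y : substep a 1 y = cat_step a y by rewrite /substep /cat_step /step mul1r.
pose x1 := substep a c1 x; pose x2 := substep a c2 x1.
have h1 : c1 = 0 \/ sin x.1.2 != 0 by right; exact: (rx 0%N).
have h2 : c2 = 0 \/ sin x1.1.2 != 0.
  have [h|h] := leP (3 * t) 1; [left; apply: clamp0; lra|right].
  by rewrite /x1 /c1 (@clamp1 _ (3 * t)) ?ltW// E; exact: (rx 1%N).
have h3 : c3 = 0 \/ sin x2.1.2 != 0.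
  have [h|h] := leP (3 * t) 2; [left; apply: clamp0; lra|right].
  rewrite /x2 /x1 /c1 /c2 (@clamp1 _ (3 * t)); last by lra.
  rewrite (@clamp1 _ (3 * t - 1)); last by lra.
  by rewrite !E; exact: (rx 2%N).
exists (fun v => stepD (c3 * (a * hatD x2.1.2))
  (stepD (c2 * (a * hatD x1.1.2)) (stepD (c1 * (a * hatD x.1.2)) v))).
  have d1 := substep_is_diff h1; have d2 := substep_is_diff h2; have d3 := substep_is_diff h3.
  exact: (is_diff_comp (is_diff_comp d1 d2) d3).
move=> v; have bd c s := @scaled_hatD_le c s a0.
have p : 0 <= 1 + a by rewrite addr_ge0.
rewrite exprSr -mulrA exprSr expr1 -mulrA.
apply: (le_trans (l1norm_stepD_ge v (bd c1 x.1.2 (clamp_itv _)))).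
rewrite ler_wpM2l//; apply: (le_trans (l1norm_stepD_ge _ (bd c2 x1.1.2 (clamp_itv _)))).
by rewrite ler_wpM2l//; exact: (l1norm_stepD_ge _ (bd c3 x2.1.2 (clamp_itv _))).
Qed.

End turn_differential.

Section preserving.
Variable R : realType.
Local Notation mu := (@torus_measure R).

(** Measure preservation on the torus in terms of lifts: only integrals of periodic functions are
    compared. They are composed with the inverse [g], since the solution at [x] is computed at
    [g x]. *)
Definition preserving (f g : R3 R -> R3 R) : Prop :=
  [/\ cancel f g, cancel g f, measurable_fun setT g &
    forall H : R3 R -> \bar R, measurable_fun setT H -> (forall x, (0 <= H x)%E) ->
      torus_periodic H -> torus_periodic (H \o g) /\
      (\int[mu]_x H (g x) = \int[mu]_x H x)%E].

Lemma preserving_id : preserving id id.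
Proof. by split=> //; exact: measurable_id. Qed.

Lemma preserving_comp f g f' g' : preserving f g -> preserving f' g' ->
  preserving (f' \o f) (g \o g').
Proof.
move=> [fK gK mg Hg] [f'K g'K mg' Hg']; split.
- exact: can_comp.
- exact: can_comp.
- exact: measurableT_comp.
move=> H mH H0 Hp; have [p1 e1] := Hg H mH H0 Hp.
have mHg : measurable_fun setT (H \o g) by exact: measurableT_comp.
have H0g x : (0 <= (H \o g) x)%E by exact: H0.
have [p2 e2] := Hg' _ mHg H0g p1.
by split=> //; rewrite -e1.
Qed.

Lemma torus_periodic_stepV (V : Type) c (f : R3 R -> V) : (forall s, c (s + 2 * pi) = c s) ->
  torus_periodic f -> torus_periodic (f \o stepV c).
Proof.
move=> cp fp x i.
have fe j y : f (y + (2 * pi) *: basis3 R (inord j)) = f y by exact: fp.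
case: i => [[|[|[|//]]] i3] /=.
- rewrite -[RHS](fe 1%N); congr f; rewrite /basis3 !inordK//= /stepV /vec3 /=.
  by congr (_, _, _); rewrite /= ?scaler0 ?addr0// /GRing.scale/= mulr1 cp.
- rewrite -[RHS](fe 2%N); congr f; rewrite /basis3 !inordK//= /stepV /vec3 /=.
  by congr (_, _, _); rewrite /= ?scaler0 ?addr0.
- rewrite -[RHS](fe 0%N); congr f; rewrite /basis3 !inordK//= /stepV /vec3 /=.
  by congr (_, _, _); rewrite /= ?scaler0 ?addr0// addrAC.
Qed.

Lemma preserving_step c : measurable_fun setT c -> (forall s, c (s + 2 * pi) = c s) ->
  preserving (step c) (stepV c).
Proof.
move=> mc cp; split; [exact: stepK|exact: stepVK|exact: measurable_stepV|].
move=> H mH H0 Hp; have p := torus_periodic_stepV cp Hp; split=> //.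
rewrite -(torus_integral_step mc _ _ p)//.
- by apply: eq_integral => x _; rewrite /= stepK.
- exact: (measurableT_comp mH (measurable_stepV mc)).
- by move=> x; exact: H0.
Qed.

Lemma preserving_iter f g k : preserving f g -> preserving (iter k f) (iter k g).
Proof.
move=> fg; elim: k => [|k IH]; first exact: preserving_id.
rewrite (_ : iter k.+1 g = iter k g \o g); last by apply/funext => x; rewrite iterSr.
exact: preserving_comp.
Qed.

Lemma preserving_substep a c : preserving (substep a c) (substepV a c).
Proof.
apply: preserving_step => [|s]; last by rewrite hat_periodic.
by apply: measurable_funM => //; apply: measurable_funM => //; exact: measurable_hat.
Qed.

Lemma preserving_turn a t : preserving (turn a t) (turnV a t).
Proof.
have h c := preserving_substep a c.
exact: (preserving_comp (preserving_comp (h _) (h _)) (h _)).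
Qed.

Lemma preserving_cat_step a : preserving (cat_step a) (substepV a 1).
Proof.
have := preserving_substep a 1; rewrite (_ : substep a 1 = cat_step a)//.
by apply/funext => y; rewrite /substep /cat_step /step mul1r.
Qed.

Lemma torus_measure_lty : (mu setT < +oo)%E.
Proof.
rewrite torus_measureE// (_ : [set: R3 R] = setT `*` setT); last by rewrite setXTT.
rewrite product_measure1E//.
by rewrite lte_mul_pinfty// ?fin_num_measure// ltey_eq fin_num_measure.
Qed.

End preserving.

(** * From the L^1 growth of the push-forward to the norms of the solution *)

Section lower_bound.
Variable R : realType.
Local Notation mu := (@torus_measure R).
Implicit Types (B : R3 R -> R3 R) (x v : R3 R).

Lemma enorm3_ge0 v : 0 <= enorm3 v.
Proof. exact: sqrtr_ge0. Qed.

Lemma l1norm_enorm3 v : l1norm v <= 2 * enorm3 v.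
Proof.
have d0 : 0 <= dot3 v v by rewrite /dot3 !addr_ge0// -expr2 sqr_ge0.
rewrite -(@ler_pXn2r _ 2)// ?nnegrE ?l1norm_ge0 ?mulr_ge0 ?enorm3_ge0//.
rewrite exprMn /enorm3 sqr_sqrtr// /dot3 /l1norm -!expr2.
rewrite -(real_normK (num_real v.1.1)) -(real_normK (num_real v.1.2)) -(real_normK (num_real v.2)).
move: `|v.1.1| `|v.1.2| `|v.2| => u w z.
have := sqr_ge0 (u - w); have := sqr_ge0 (u - z); have := sqr_ge0 (w - z).
by have := sqr_ge0 u; have := sqr_ge0 w; have := sqr_ge0 z; lra.
Qed.

Lemma measurable_enorm3 B : measurable_fun setT B -> measurable_fun setT (fun x => enorm3 (B x)).
Proof.
move=> mB; apply: (@measurableT_comp _ _ _ _ _ _ (@Num.sqrt R)).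
  by apply: continuous_measurable_fun; exact: sqrt_continuous.
by apply: measurable_dot3 => j; exact: measurable_coordT.
Qed.

Lemma Lp_field_integrable (p : \bar R) B : (1 <= p)%E -> Lp_field p B -> integrable_field mu B.
Proof.
move=> p1 [_ mB Bp].
have iB := Lnorm_integrable (torus_measure_lty R) p1 (measurable_enorm3 mB) Bp.
split=> //; apply: (le_integrable measurableT (g := EFin \o (fun x => 2 * enorm3 (B x)))).
- by apply/measurable_EFinP; exact: measurable_l1norm.
- move=> x _ /=; rewrite lee_fin ger0_norm ?l1norm_ge0// ger0_norm ?l1norm_enorm3//.
  by rewrite mulr_ge0// enorm3_ge0.
- exact: (integrableZl measurableT 2 iB).
Qed.

Lemma div_free_closed B : div_free B -> closed_pair mu B id.
Proof.
move=> dB psi tp; apply: dB; [exact: torus_fun_periodic|exact: torus_fun_smooth].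
Qed.

Lemma regular_iter (a : R) k x : regular a x -> regular a (iter k (cat_step a) x).
Proof. by move=> rx j; rewrite -iterD. Qed.

(** Whole periods give the iterated push-forward; the unfinished period consists of at most three
    shears and can shrink a vector by at most the factor [(1 + a) ^+ 3]. *)
Lemma ideal_solution_ge (a : R) (k : nat) (t : R) : 0 <= a -> k%:R <= t <= k%:R + 1 ->
  exists f g, preserving f g /\ forall B x, regular a (g x) ->
    l1norm (cat_push a B (3 * k) (g x))
      <= (1 + a) ^+ 3 * l1norm (ideal_solution (velocity a) B t x).
Proof.
move=> a0 kt; pose f := turn a (t - k%:R) \o iter (3 * k) (cat_step a).
have fE : flow_map (velocity a) t = f by apply/funext => x; exact: flow_mapE.
have fg : preserving f (iter (3 * k) (substepV a 1) \o turnV a (t - k%:R)).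
  exact: (preserving_comp (preserving_iter (3 * k) (preserving_cat_step a)) (preserving_turn a _)).
exists f, (iter (3 * k) (substepV a 1) \o turnV a (t - k%:R)); split=> //.
move: fg; set g := (_ \o turnV _ _) => -[fK gK _ _] B x rx.
rewrite /ideal_solution fE.
have -> : pinv setT f x = g x.
  rewrite -{1}(gK x) pinvKV ?inE// => y z _ _ E.
  exact: (can_inj fK E).
have [L dL hL] := turn_is_diff (t - k%:R) a0 (regular_iter (3 * k) rx).
have df : is_diff (g x) f (fun v => L (cat_push a (fun=> v) (3 * k) (g x))).
  exact: (is_diff_comp (iter_cat_step_is_diff (3 * k) rx) dL).
by rewrite diff_val cat_push_cst; exact: hL.
Qed.

Lemma torus_periodic_cat_push (a : R) B k : torus_periodic B ->
  torus_periodic (cat_push a B k).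
Proof.
move=> Bp; elim: k => [//|k IH] x i; rewrite /cat_push /= -!/(cat_push _ _ _ _) IH.
congr (stepD (a * _) _).
have hp (s : R) : hatD (s + 2 * pi) = hatD s.
  by rewrite /hatD /soft_hatD sin_periodic cos_periodic.
exact: (torus_periodic_orbit a k hp).
Qed.

(** Three steps per unit of time, each doubling the norm, give the exponent [ln 8]; the factor 8
    pays for the unfinished period. *)
Lemma growth_rate (k : nat) (t : R) : t <= k%:R + 1 -> expR (ln 8 * t) <= 8 * 2 ^+ (3 * k).
Proof.
move=> tk; have l8 : 0 <= ln 8 :> R by rewrite ln_ge0//; lra.
apply: (@le_trans _ _ (expR (ln 8 * k.+1%:R))).
  by rewrite ler_expR ler_wpM2l// -natr1.
rewrite [ln 8 * _]mulrC expRM_natl lnK ?posrE//.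
by rewrite exprS exprM; rewrite (_ : 2 ^+ 3 = 8 :> R)//; ring.
Qed.

Lemma growth_factor (u c d e P : R) : 0 <= u * (c * d) -> e <= 8 * P ->
  u * (c * d) / 8 * e <= u * (c * (d * P)).
Proof.
move=> A0; rewrite -subr_ge0 => h; have := mulr_ge0 A0 h.
by move=> ?; lra.
Qed.

Lemma Lp_growth (a : R) (p : \bar R) B : 16 <= a -> (1 <= p)%E -> Lp_field p B ->
  nonzero_field B -> div_free B -> exists2 delta : R, 0 < delta & forall t : R, 0 <= t ->
    ((delta * expR (ln 8 * t))%:E <= Lp_norm p (ideal_solution (velocity a) B t))%E.
Proof.
move=> a16 p1 Bp Bn /div_free_closed cB; have iB := Lp_field_integrable p1 Bp.
have [Bper mB _] := Bp.
have a0 : 0 <= a by lra.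
pose s := Num.sqrt a; have sE : s ^+ 2 = a by rewrite sqr_sqrtr.
have s4 : 4 <= s.
  rewrite -(@ler_pXn2r _ 2)// ?nnegrE ?sqrtr_ge0// sE; apply: le_trans a16.
  by rewrite le_eqVlt; apply/orP; left; apply/eqP; ring.
have [d d0] := cat_push_growth s4 iB cB Bn; rewrite sE => dB.
have [K K0 HK] := integral_le_Lnorm (torus_measure_lty R) p1.
have a1 : 0 < (1 + a) ^+ 3 by rewrite exprn_gt0//; lra.
(* The two losses: the unfinished period, and the passage from [l1norm] to the Euclidean norm. *)
pose c := ((1 + a) ^+ 3 * 2)^-1.
have c0 : 0 < c by rewrite invr_gt0 mulr_gt0.
exists (K^-1 * (c * d) / 8); first by rewrite divr_gt0// mulr_gt0 ?invr_gt0// mulr_gt0.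
move=> t t0; pose k := `|Num.floor t|%N.
have kt : k%:R <= t <= k%:R + 1.
  have f0 : (0 <= Num.floor t)%R by rewrite floor_ge0.
  have -> : k%:R = (Num.floor t)%:~R :> R by rewrite /k -[in RHS](gez0_abs f0) pmulrn.
  by have /andP[-> /ltW] := floor_itv t; rewrite intrD.
have [f [g [[fK gK mg Hg] ge]]] := ideal_solution_ge a0 kt.
pose l x := l1norm (cat_push a B (3 * k) x).
have l0 x : 0 <= l x by exact: l1norm_ge0.
have ml : measurable_fun setT l by apply: measurable_l1norm; exact: measurable_cat_push.
(* A measurable minorant: the lower bound on the solution holds at regular points only, so it is cut
   off elsewhere, on a null set. *)
pose h x : R := c * (l x * \1_[set y | regular a y] x).
have h0 x : 0 <= h x by apply: mulr_ge0; [exact: ltW|apply: mulr_ge0; rewrite ?indicE ?ler0n].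
have mh : measurable_fun setT h.
  apply: measurable_funM => //; apply: measurable_funM => //.
  by apply: measurable_indic; exact: measurable_regular.
have hp : torus_periodic (EFin \o h).
  move=> x i; rewrite /= /h /l; congr (_ * (l1norm _ * _))%:E.
    exact: torus_periodic_cat_push.
  rewrite !indicE; congr (nat_of_bool _)%:R; apply/idP/idP; rewrite !inE /=;
    by rewrite torus_periodic_regular.
have hle x : h (g x) <= enorm3 (ideal_solution (velocity a) B t x).
  rewrite /h indicE; case: (boolP (g x \in _)) => rx; last by rewrite !mulr0 enorm3_ge0.
  rewrite inE/= in rx; rewrite mulr1 /c mulrC ler_pdivrMr; last exact: mulr_gt0.
  apply: (le_trans (ge B x rx)).
  rewrite [leRHS]mulrC -[leRHS]mulrA; apply: ler_wpM2l; first exact: ltW.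
  exact: l1norm_enorm3.
have hgp : measurable_fun setT (h \o g) by exact: measurableT_comp.
have main : ((c * (d * 2 ^+ (3 * k)))%:E <= \int[mu]_x (h x)%:E)%E.
  have il : mu.-integrable setT (EFin \o l) by have [] := integrable_cat_push (3 * k) a0 iB.
  have -> : (\int[mu]_x (h x)%:E = \int[mu]_x (c%:E * (l x)%:E))%E.
    apply: ae_eq_integral => //.
    - exact/measurable_EFinP.
    - by apply/measurable_EFinP; apply: measurable_funM.
    apply: filterS (regular_ae a) => x rx _ /=.
    by rewrite /h indicE mem_set// mulr1.
  rewrite integralZl// EFinM; apply: lee_wpmul2l; first by rewrite lee_fin ltW.
  have := dB (3 * k)%N; rewrite -lee_fin => /le_trans; apply.
  by rewrite /Rintegral fineK//; exact: (integrable_fin_num measurableT il).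
have E8 : expR (ln 8 * t) <= 8 * 2 ^+ (3 * k) by apply: growth_rate; case/andP: kt.
have hK : (\int[mu]_x (h (g x))%:E <= K%:E * Lp_norm p (ideal_solution (velocity a) B t))%E.
  apply: (le_trans (HK (h \o g) hgp (fun x => h0 (g x)))).
  apply: lee_wpmul2l; first by rewrite lee_fin ltW.
  exact: (le_Lnorm mu p1 (fun x => h0 (g x)) hle).
have [_ eH] := Hg (EFin \o h) (measurableT_comp (@EFin_measurable R setT) mh)
  (fun x => h0 x) hp.
have : ((c * (d * 2 ^+ (3 * k)))%:E <= K%:E * Lp_norm p (ideal_solution (velocity a) B t))%E.
  by apply: le_trans hK; rewrite -[leRHS]/(\int[mu]_x (EFin \o h) (g x))%E eH.
rewrite -lee_pdivrMl// => H; apply: le_trans H; rewrite -EFinM lee_fin.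
by apply: growth_factor E8; apply/ltW; rewrite !mulr_gt0// invr_gt0.
Qed.

End lower_bound.

Theorem theorem1p1 (R : realType) :
  exists2 alpha0 : R, 0 < alpha0 &
  forall alpha : R, alpha0 <= alpha ->
    (exists2 lambda1 : R, 0 < lambda1 &
      forall (p : \bar R) (B0 : R3 R -> R3 R),
        (1 <= p)%E -> Lp_field p B0 -> nonzero_field B0 -> div_free B0 ->
        exists2 delta : R, 0 < delta &
        forall t : R, 0 <= t ->
          ((delta * expR (lambda1 * t))%:E
             <= Lp_norm p (ideal_solution (velocity alpha) B0 t))%E) /\
    universal_ideal_dynamo (velocity alpha).
Proof.
(* 16 gives the factor 8, more than 2 ^ 2, over two steps inside the cone, and [s = Num.sqrt alpha]
   is then at least 4, as [flux_rate_lt1] requires. *)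
exists 16 => // alpha a16.
have l8 : 0 < ln 8 :> R by rewrite ln_gt0//; lra.
split; first by exists (ln 8) => // p B0 p1 Bp Bn Bd; exact: Lp_growth.
move=> B0 B2 Bd Bn.
have p1 : (1 <= 2%:E :> \bar R)%E by rewrite lee_fin; lra.
by have [d d0 h] := Lp_growth a16 p1 B2 Bn Bd; exists (ln 8), d.
Qed.
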